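(* Let $p$ be fixed and consider the setting, notation and adaptive LASSO estimator $\widehat\sigma_n^{\,\mathrm{AL}}$ described in the context. Assume that $(\mathbf X_i^\top,\mathbf A_i^\top)^\top$, $i=1,\dots,n$, are independent and identically distributed as $(\mathbf X^\top,\mathbf A^\top)^\top$, and that - the random coefficients $\mathbf A$ have finite fourth moments, - the covariates $\mathbf X=(1,\mathbf W^\top)^\top$ have finite eighth moments, - the matrix $\mathrm C^\sigma=\mathbb E[\operatorname{v}(\mathbf X)\operatorname{v}(\mathbf X)^\top]$ is positive definite. Suppose that the estimator $\widehat\mu_n$ of $\mu^*$ used in the residuals satisfies $\sqrt n\,(\widehat\mu_n-\mu^* )=\mathcal O_{\mathbb P}(1)$ and that the initial estimator satisfies $\sqrt n\,(\widehat\sigma_n^{\,\mathrm{init}}-\sigma^* )=\mathcal O_{\mathbb P}(1)$. If the regularization parameter is chosen such that $\lambda_n^\sigma\to0$, $\sqrt n\,\lambda_n^\sigma\to0$ and $n\,\lambda_n^\sigma\to\infty$, then $\widehat\sigma_n^{\,\mathrm{AL}}$ is sign-consistent, $$\mathbb P\big(\operatorname{sign}(\widehat\sigma_n^{\,\mathrm{AL}})=\operatorname{sign}(\sigma^* )\big)\to1,\qquad n\to\infty,$$ and satisfies $$\sqrt n\,\big(\widehat\sigma^{\,\mathrm{AL}}_{n,S_\sigma}-\sigma^*_{S_\sigma}\big)\ \xrightarrow{\ d\ }\ \mathcal N_{s_\sigma}\Big(\mathbf 0_{s_\sigma},\ (\mathrm C^\sigma_{S_\sigma S_\sigma})^{-1}\,\mathrm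 B^\sigma_{S_\sigma S_\sigma}\,(\mathrm C^\sigma_{S_\sigma S_\sigma})^{-1}\Big).$$
   Context: Model: $Y_i=\mathbf X_i^\top\mathbf A_i$, $i=1,\dots,n$, with $\mathbf X_i=(1,\mathbf W_i^\top)^\top\in\mathbb R^p$; $\mathbf A_i\in\mathbb R^p$ are unobserved random coefficients, $\mathbf X_i$ and $\mathbf A_i$ are independent, and the observations are $(Y_i,\mathbf W_i^\top)^\top$. Put $\mu^*=\mathbb E[\mathbf A]$, $\Sigma^*=\operatorname{Cov}(\mathbf A)$. Half-vectorization of a symmetric $M\in\mathbb R^{p\times p}$: $\operatorname{vec}(M)=(M_{11},\dots,M_{pp},M_{12},\dots,M_{1p},M_{23},\dots,M_{2p},\dots,M_{(p-1)p})^\top\in\mathbb R^{p(p+1)/2}$. For $\mathbf x\in\mathbb R^p$: $\operatorname{v}(\mathbf x)=(x_1^2,\dots,x_p^2,2x_1x_2,\dots,2x_1x_p,2x_2x_3,\dots,2x_2x_p,\dots,2x_{p-1}x_p)^\top$, so $\mathbf x^\top M\mathbf x=\operatorname{v}(\mathbf x)^\top\operatorname{vec}(M)$. Set $\sigma^*=\operatorname{vec}(\Sigma^* )$, $S_\sigma=\{k:\sigma^*_k\ne0\}$, $s_\sigma=|S_\sigma|$. Subscripts $S_\sigma$ (resp. $S_\sigma S_\sigma$) denote the corresponding subvector (resp. submatrix). Given an estimator $\widehat\mu_n$ of $\mu^*$ let $\mathbb Y_n^\sigma=\big((Y_1-\mathbf X_1^\top\widehat\mu_n)^2,\dots,(Y_n-\mathbf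 X_n^\top\widehat\mu_n)^2\big)^\top$ and $\mathbb X_n^\sigma=[\operatorname{v}(\mathbf X_1),\dots,\operatorname{v}(\mathbf X_n)]^\top$. With an initial estimator $\widehat\sigma_n^{\,\mathrm{init}}\in\mathbb R^{p(p+1)/2}$ of $\sigma^*$ and a regularization parameter $\lambda_n^\sigma>0$, the adaptive LASSO is any $$\widehat\sigma_n^{\,\mathrm{AL}}\in\underset{\beta\in\mathbb R^{p(p+1)/2}}{\arg\min}\Big(\frac1n\|\mathbb Y_n^\sigma-\mathbb X_n^\sigma\beta\|_2^2+2\lambda_n^\sigma\sum_{k=1}^{p(p+1)/2}\frac{|\beta_k|}{|\widehat\sigma^{\,\mathrm{init}}_{n,k}|}\Big),$$ where $\beta_k=0$ is required if $\widehat\sigma^{\,\mathrm{init}}_{n,k}=0$. The function $\operatorname{sign}$ acts coordinatewise with values in $\{-1,0,1\}$. $\mathrm B^\sigma=\mathbb E\big[(\operatorname{v}(\mathbf X)^\top\Psi^*\operatorname{v}(\mathbf X))\operatorname{v}(\mathbf X)\operatorname{v}(\mathbf X)^\top\big]$, where $$\Psi^*=\big[\operatorname{vec}(\mathcal M^{11}),\dots,\operatorname{vec}(\mathcal M^{pp}),\operatorname{vec}(\mathcal M^{12}),\dots,\operatorname{vec}(\mathcal M^{1p}),\operatorname{vec}(\mathcal M^{23}),\dots,\operatorname{vec}(\mathcal M^{2p}),\dots,\operatorname{vec}(\mathcal M^{(p-1)p})\big]^\top$$ and $\mathcal M^{kl}\in\mathbb R^{p\times p}$ has entries $(\mathcal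 M^{kl})_{uv}=\operatorname{Cov}\big((A_k-\mu_k^* )(A_l-\mu_l^* ),(A_u-\mu_u^* )(A_v-\mu_v^* )\big)$. *)

(* Defs.v *)
From HB Require Import structures.
From mathcomp Require Import all_boot all_order all_algebra finmap.
From mathcomp Require Import all_classical all_reals all_analysis.

Set Implicit Arguments.
Unset Strict Implicit.
Unset Printing Implicit Defensive.

Import Order.TTheory GRing.Theory Num.Theory.
Import numFieldNormedType.Exports.

Local Open Scope classical_set_scope.
Local Open Scope ring_scope.

(* Matrices, in particular the column vectors 'cV[R]_n, carry the Borel
   sigma-algebra of the library's topology on 'M[R]_(m, n). *)
HB.instance Definition _ (R : realType) (m n : nat) :=
  @isMeasurable.Build (sigma_display (@open 'M[R]_(m, n))) 'M[R]_(m, n)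
    <<s @open 'M[R]_(m, n) >> (@sigma_algebra0 _ setT (@open 'M[R]_(m, n)))
    (@sigma_algebraC _ _) (@sigma_algebra_bigcup _ setT _).

Section linear_algebra.
Context {R : realType}.

Definition dotp n (x y : 'cV[R]_n) : R := (x^T *m y) 0 0.

Definition quad_form n (M : 'M[R]_n) (x : 'cV[R]_n) : R := (x^T *m M *m x) 0 0.

(* The norm `|x| of the library on matrices is the sup norm. *)
Definition l2norm n (x : 'cV[R]_n) : R := Num.sqrt (\sum_i x i 0 ^+ 2).

Definition pos_def n (M : 'M[R]_n) : Prop :=
  M^T = M /\ forall x : 'cV[R]_n, x != 0 -> 0 < quad_form M x.

Definition supp_set n (x : 'cV[R]_n) : {set 'I_n} := [set k | x k 0 != 0].

Definition subvector n (S : {set 'I_n}) (x : 'cV[R]_n) : 'cV[R]_#|S| :=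
  rowsub enum_val x.

Definition principal_submx n (S : {set 'I_n}) (M : 'M[R]_n) : 'M[R]_#|S| :=
  mxsub enum_val enum_val M.

Definition sign_vec n (x : 'cV[R]_n) : 'cV[R]_n := map_mx Num.sg x.

End linear_algebra.

Section half_vectorization.

(* Index pairs in the order 11, ..., pp, 12, ..., 1p, 23, ..., 2p, ...,
   (p-1)p. *)
Definition hvec_pairs p : seq ('I_p * 'I_p) :=
  [seq (k, k) | k <- enum 'I_p] ++
  [seq (k, l) | k : 'I_p <- enum 'I_p,
                l : 'I_p <- [seq l : 'I_p <- enum 'I_p | (k < l)%N]].

Definition hdim p : nat := (p * p.+1)./2.

Lemma size_hvec_pairs p : size (hvec_pairs p) == hdim p.
Proof.
rewrite /hvec_pairs size_cat size_map size_enum_ord size_allpairs_dep.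
rewrite sumnE big_map big_enum /=.
under eq_bigr => k _ do rewrite size_filter -sum1_count big_enum_cond /=.
rewrite (exchange_big_dep xpredT) //=.
have h (l : 'I_p) : (\sum_(k < p | (k < l)%N) 1 = l)%N.
  by rewrite -(big_ord_widen p (fun=> 1%N)) ?sum1_card ?card_ord // ltnW.
under eq_bigr => l _ do rewrite h.
rewrite -(big_mkord xpredT id) bin2_sum addnC -[X in (_ + X)%N]bin1 -binS.
by rewrite bin2 mulnC.
Qed.

Definition hvec_index p (k : 'I_(hdim p)) : 'I_p * 'I_p :=
  tnth (Tuple (size_hvec_pairs p)) k.

Context {R : realType}.

Definition vech p (M : 'M[R]_p) : 'cV[R]_(hdim p) :=
  \col_k M (hvec_index k).1 (hvec_index k).2.

Definition qvec p (x : 'cV[R]_p) : 'cV[R]_(hdim p) :=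
  \col_k let: (i, j) := hvec_index k in
         (if i == j then x i 0 ^+ 2 else 2 * x i 0 * x j 0).

Lemma quad_form_vech p (M : 'M[R]_p) (x : 'cV[R]_p) :
  M^T = M -> quad_form M x = dotp (qvec x) (vech M).
Proof.
move=> symM.
pose F (ij : 'I_p * 'I_p) : R :=
  (if ij.1 == ij.2 then x ij.1 0 ^+ 2 else 2 * x ij.1 0 * x ij.2 0) *
  M ij.1 ij.2.
have -> : dotp (qvec x) (vech M) = \sum_(ij <- hvec_pairs p) F ij.
  rewrite -[hvec_pairs p]/(val (Tuple (size_hvec_pairs p))) big_tuple.
  rewrite /dotp mxE; apply: eq_bigr => k _.
  by rewrite !mxE /hvec_index /F; case: (tnth _ k).
rewrite big_cat big_map big_allpairs_dep !big_enum /=.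
under [X in _ + X]eq_bigr => i _ do rewrite big_filter big_enum_cond /=.
pose G i j := x i 0 * M i j * x j 0.
have GC i j : G i j = G j i.
  by rewrite /G -{1}symM mxE mulrAC [x i 0 * _]mulrC mulrAC.
have -> : quad_form M x = \sum_(i < p) \sum_(j < p) G i j.
  rewrite /quad_form mxE exchange_big; apply: eq_bigr => j _.
  by rewrite mxE mulr_suml; apply: eq_bigr => i _; rewrite mxE.
have -> : \sum_(i < p) \sum_(j < p) G i j = \sum_(i < p) G i i +
    (\sum_(i < p) \sum_(j < p | (i < j)%N) G i j +
     \sum_(i < p) \sum_(j < p | (j < i)%N) G i j).
  rewrite -!big_split /=; apply: eq_bigr => i _.
  rewrite (bigD1 i) //=; congr (_ + _).
  rewrite (bigID (fun j : 'I_p => (i < j)%N)) /=; congr (_ + _).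
    by apply: eq_bigl => j; case: (ltngtP i j); rewrite ?andbF // => ij;
      rewrite ?andbT; apply/eqP => /(congr1 val) ji; move: ij; rewrite ji ltnn.
  apply: eq_bigl => j; rewrite -leqNgt -(inj_eq val_inj) /=.
  by case: (ltngtP j i).
congr (_ + _).
  by apply: eq_bigr => i _; rewrite /F /G /= eqxx expr2 mulrAC.
have -> : \sum_(i < p) \sum_(j < p | (j < i)%N) G i j =
          \sum_(i < p) \sum_(j < p | (i < j)%N) G i j.
  rewrite (exchange_big_dep xpredT) //=; apply: eq_bigr => i _.
  by apply: eq_bigr => j _; exact: GC.
rewrite -big_split; apply: eq_bigr => i _ /=.
rewrite -big_split; apply: eq_bigr => j ij /=.
rewrite /F /G /= ifF; last first.
  by apply/negbTE; rewrite -(inj_eq val_inj) neq_ltn ij.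
by rewrite -!mulrA mulr_natl mulr2n [M i j * _]mulrC.
Qed.

End half_vectorization.

Section probability.
Context {R : realType} {d : measure_display} {T : measurableType d}.
Variable P : probability T R.

Definition independent2 {d1 d2 : measure_display} {T1 : measurableType d1}
    {T2 : measurableType d2} (X : T -> T1) (Y : T -> T2) : Prop :=
  forall B D, measurable B -> measurable D ->
    (P (X @^-1` B `&` Y @^-1` D) = P (X @^-1` B) * P (Y @^-1` D))%E.

Definition mutually_independent {I : choiceType} {d' : measure_display}
    {T' : measurableType d'} (Z : I -> T -> T') : Prop :=
  forall (J : {fset I}) (B : I -> set T'), (forall i, measurable (B i)) ->
    P (\bigcap_(i in [set` J]) (Z i @^-1` B i)) =
      (\prod_(i <- J) P (Z i @^-1` B i))%E.

Definition same_law {d' : measure_display} {T' : measurableType d'}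
    (Y Z : T -> T') : Prop :=
  forall B, measurable B -> P (Y @^-1` B) = P (Z @^-1` B).

Definition finite_moment (r : nat) n (Z : T -> 'cV[R]_n) : Prop :=
  forall k, (fun t => Z t k 0) \in Lfun P (r%:R)%:E.

Definition expect_mx m n (Z : T -> 'M[R]_(m, n)) : 'M[R]_(m, n) :=
  \matrix_(i, j) fine 'E_P[fun t => Z t i j].

Definition cov_mx n (Z : T -> 'cV[R]_n) : 'M[R]_n :=
  \matrix_(i, j) fine (covariance P (fun t => Z t i 0) (fun t => Z t j 0)).

Definition bounded_in_probability n (Z : nat -> T -> 'cV[R]_n) : Prop :=
  forall e : R, 0 < e -> exists M : R,
    \forall N \near \oo, (P [set t | (M < l2norm (Z N t))%R] <= e%:E)%E.

Definition cvg_in_distribution n (Z : nat -> T -> 'cV[R]_n)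
    (Q : probability 'cV[R]_n R) : Prop :=
  forall f : 'cV[R]_n -> R, continuous f -> bounded_fun f ->
    ('E_P[f \o Z N] @[N --> \oo] --> 'E_Q[f])%E.

End probability.

Section normal.
Context {R : realType}.

(* N(m, s2). The library's normal_prob m 0 is not the point mass at m, hence
   the case distinction. *)
Definition gauss1 (m s2 : R) : set R -> \bar R :=
  if s2 == 0 then \d_m else normal_prob m (Num.sqrt s2).

(* N_n(m, V), with V possibly singular: every linear form a^T x is
   N(a^T m, a^T V a). *)
Definition is_normal n (m : 'cV[R]_n) (V : 'M[R]_n)
    (Q : probability 'cV[R]_n R) : Prop :=
  V^T = V /\
  forall (a : 'cV[R]_n) (B : set R), measurable B ->
    Q (dotp a @^-1` B) = gauss1 (dotp a m) (quad_form V a) B.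

End normal.

Section model.
Context {R : realType}.

Definition regressor q (w : 'cV[R]_q) : 'cV[R]_q.+1 :=
  col_mx (1%:M : 'cV[R]_1) w.

(* The n-th sample consists of the indices 0, ..., n - 1. *)
Definition response_sigma p n (X : nat -> 'cV[R]_p) (Y : nat -> R)
    (mu : 'cV[R]_p) : 'cV[R]_n :=
  \col_(i < n) (Y i - dotp (X i) mu) ^+ 2.

Definition design_sigma p n (X : nat -> 'cV[R]_p) : 'M[R]_(n, hdim p) :=
  \matrix_(i < n) (qvec (X i))^T.

Section adaptive_lasso.
Variables (n m : nat) (Y : 'cV[R]_n) (D : 'M[R]_(n, m)).
Variables (init : 'cV[R]_m) (lam : R).

Definition lasso_feasible (b : 'cV[R]_m) : Prop :=
  forall k, init k 0 = 0 -> b k 0 = 0.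

(* For feasible b, an index k with init k 0 = 0 contributes 0 / 0 = 0 to the
   penalty. *)
Definition lasso_objective (b : 'cV[R]_m) : R :=
  n%:R^-1 * l2norm (Y - D *m b) ^+ 2 +
  2 * lam * \sum_k (`|b k 0| / `|init k 0|).

Definition is_adaptive_lasso (b : 'cV[R]_m) : Prop :=
  lasso_feasible b /\
  forall b', lasso_feasible b' -> lasso_objective b <= lasso_objective b'.

End adaptive_lasso.

Section population.
Context {d : measure_display} {T : measurableType d}.
Variables (P : probability T R) (p : nat) (X A : T -> 'cV[R]_p).

Definition mu_star : 'cV[R]_p := expect_mx P A.

Definition sigma_star : 'cV[R]_(hdim p) := vech (cov_mx P A).

Definition C_sigma : 'M[R]_(hdim p) :=
  expect_mx P (fun t => qvec (X t) *m (qvec (X t))^T).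

Definition fourth_cov (k l : 'I_p) : 'M[R]_p :=
  let cent (i : 'I_p) := fun t => A t i 0 - mu_star i 0 in
  \matrix_(u, w) fine (covariance P (cent k \* cent l) (cent u \* cent w)).

Definition Psi_star : 'M[R]_(hdim p) :=
  \matrix_k (vech (fourth_cov (hvec_index k).1 (hvec_index k).2))^T.

Definition B_sigma : 'M[R]_(hdim p) :=
  expect_mx P (fun t =>
    quad_form Psi_star (qvec (X t)) *: (qvec (X t) *m (qvec (X t))^T)).

End population.

End model.

(* Main.v *)
Require Import Defs.
From HB Require Import structures.
From mathcomp Require Import all_boot all_order all_algebra finmap.
From mathcomp Require Import ring lra.
From mathcomp Require Import all_classical all_reals all_analysis.
From mathcomp Require Import measurable_realfun.

(** Write $\sigma_\ast$ for the half-vectorized covariance, $v_i$ for the quadratic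
    regressor of the $i$-th observation, $G_n$ for the Gram matrix of the $v_i$ divided
    by $n$ and $\delta_n = \sqrt n(\hat\sigma_n - \sigma_\ast)$. Squaring the residual turns
    the model into a linear regression: $(Y_i - X_i^T\mu_\ast)^2 = v_i^T\sigma_\ast +
    \varepsilon_i$, where $\varepsilon_i = \sum_l v_{i,l}\, w_l(A_i)$ with centered
    functions $w_l$ of the coefficients alone ([noiseE]). As $A_i$ is independent of
    $X_i$, the summands $\varepsilon_i v_i$ are centered with covariance $B^\sigma$
    ([Ex_noise_score], [Ex_noise_score_sqr]). Replacing $\mu_\ast$ by a
    $\sqrt n$-consistent estimator changes the score
    $u_n = n^{-1/2}\sum_i v_i(r_i^2 - v_i^T\sigma_\ast)$, with the residuals $r_i$, by a
    linear term whose coefficients are centered means, and by a quadratic term of order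
    $n^{-1/2}$; both vanish in probability ([score_expansion],
    [sample_score_linear]). By the weak law
    $G_n \to C^\sigma$.

    The LASSO enters through two deterministic facts. Comparing the objective at the
    estimator and at $\sigma_\ast$ bounds $\delta_n$, because $C^\sigma$ is coercive and the
    penalty on the support has size $\sqrt n\lambda_n \to 0$
    ([lasso_basic_inequality]). Stationarity in a nonzero coordinate $k$ reads
    $(u_n - G_n\delta_n)_k = \sqrt n\lambda_n \mathrm{sign}(\hat\sigma_k) /
    |\hat\sigma^{init}_k|$ ([lasso_stationary]). Off the support the right-hand side is
    at least of order $n\lambda_n \to \infty$ in absolute value while the left-hand side
    is bounded, so the coordinate must be zero; on the support the right-hand side tends
    to zero. Hence, with probability close to one, the signs agree and $C_{SS}\,
    \delta_{n,S} \approx u_{n,S}$ ([lasso_whp]).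

    For the limit law it suffices to study characteristic functions. The central limit
    theorem is proved in that form: addition formulas and independence make
    $(E\cos, E\sin)$ of a sum the real and imaginary parts of a power
    ([clt_characteristic_function]). The possibly
    singular normal law with a given covariance is constructed by adding independent one-dimensional
    Gaussian vectors ([normal_exists]). Levy's continuity theorem ([levy_continuity])
    is proved from the tightness that the bound on $\delta_n$ provides, by
    approximating a continuous function on a cube by Bernstein polynomials in
    $\sin(x_i/L)$, which are trigonometric polynomials with the same global bound. *)

Set Implicit Arguments.
Unset Strict Implicit.
Unset Printing Implicit Defensive.

Import Order.TTheory GRing.Theory Num.Theory.
Import numFieldNormedType.Exports.

Local Open Scope classical_set_scope.
Local Open Scope ring_scope.

(** * Expectation calculus *)

(** Real-valued integrals over the whole space; all expectations below are of
    real functions, so that the extended reals stay out of the computations. *)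
Notation integ P f := (integrable P [set: _] (EFin \o f)).
Notation Ex P f := (Rintegral P [set: _] f).

Section expectation.
Context {R : realType} {d : measure_display} {T : measurableType d}.
Variable P : probability T R.
Implicit Types f g : T -> R.

Lemma integ_measurable f : integ P f -> measurable_fun [set: T] f.
Proof. by move=> /(measurable_int P)/measurable_EFinP. Qed.

Lemma integ_le g f : measurable_fun [set: T] f -> (forall t, `|f t| <= g t) ->
  integ P g -> integ P f.
Proof.
move=> mf fg ig; apply: (le_integrable measurableT _ _ ig).
  exact/measurable_EFinP.
by move=> t _ /=; rewrite lee_fin (le_trans (fg t))// ler_norm.
Qed.

Lemma integ_cst (c : R) : integ P (fun=> c).
Proof. exact: finite_measure_integrable_cst. Qed.

Lemma integ_bounded f (K : R) : measurable_fun [set: T] f ->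
  (forall t, `|f t| <= K) -> integ P f.
Proof. by move=> mf fK; apply: integ_le mf fK _; exact: integ_cst. Qed.

Lemma integD f g : integ P f -> integ P g -> integ P (fun t => f t + g t).
Proof. by move=> fi gi; exact: (integrableD measurableT fi gi). Qed.

Lemma integB f g : integ P f -> integ P g -> integ P (fun t => f t - g t).
Proof. by move=> fi gi; exact: (integrableB measurableT fi gi). Qed.

Lemma integZ (c : R) f : integ P f -> integ P (fun t => c * f t).
Proof. by move=> fi; exact: (integrableZl measurableT c fi). Qed.

Lemma integ_norm f : integ P f -> integ P (fun t => `|f t|).
Proof. by move=> fi; exact: (integrable_norm fi). Qed.

Lemma integ_sum (I : Type) (s : seq I) (F : I -> T -> R) :
  (forall i, integ P (F i)) -> integ P (fun t => \sum_(i <- s) F i t).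
Proof.
move=> iF; elim: s => [|i s IH].
  by under [X in EFin \o X]eq_fun do rewrite big_nil; exact: integ_cst.
under [X in EFin \o X]eq_fun do rewrite big_cons.
exact: integD.
Qed.

Lemma ExD f g : integ P f -> integ P g ->
  Ex P (fun t => f t + g t) = Ex P f + Ex P g.
Proof. exact: RintegralD. Qed.

Lemma ExB f g : integ P f -> integ P g ->
  Ex P (fun t => f t - g t) = Ex P f - Ex P g.
Proof. exact: RintegralB. Qed.

Lemma ExZ (c : R) f : integ P f -> Ex P (fun t => c * f t) = c * Ex P f.
Proof. by move=> fi; exact: RintegralZl. Qed.

Lemma Ex_cst (c : R) : Ex P (fun=> c) = c.
Proof.
rewrite Rintegral_cst// [X in fine X](_ : _ = 1%E) ?mulr1//.
exact: (probability_setT P).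
Qed.

Lemma Ex_sum (I : Type) (s : seq I) (F : I -> T -> R) :
  (forall i, integ P (F i)) ->
  Ex P (fun t => \sum_(i <- s) F i t) = \sum_(i <- s) Ex P (F i).
Proof.
move=> iF; elim: s => [|i s IH].
  rewrite big_nil (_ : (fun t => _) = fun=> 0) ?Ex_cst//.
  by apply/funext => t; rewrite big_nil.
rewrite big_cons -IH -ExD//; last exact: integ_sum.
by congr Rintegral; apply/funext => t; rewrite big_cons.
Qed.

Lemma Ex_le f g : integ P f -> integ P g -> (forall t, f t <= g t) ->
  Ex P f <= Ex P g.
Proof. by move=> fi gi fg; exact: le_Rintegral. Qed.

Lemma Ex_ge0 f : (forall t, 0 <= f t) -> 0 <= Ex P f.
Proof. by move=> f0; exact: Rintegral_ge0. Qed.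

Lemma Ex_norm_le f g : integ P f -> integ P g -> (forall t, `|f t| <= g t) ->
  `|Ex P f| <= Ex P g.
Proof.
move=> fi gi fg; apply: le_trans (le_normr_Rintegral measurableT fi) _.
by apply: Ex_le => //; exact: integ_norm.
Qed.

Lemma Ex_norm_bound f (K : R) : integ P f -> (forall t, `|f t| <= K) ->
  `|Ex P f| <= K.
Proof.
by move=> fi fK; rewrite -[leRHS]Ex_cst; apply: Ex_norm_le => //; exact: integ_cst.
Qed.

Lemma integE f : integ P f -> ('E_P[f] = (Ex P f)%:E)%E.
Proof.
by move=> fi; rewrite unlock fineK//; exact: integrable_fin_num.
Qed.

Lemma Ex_indic (A : set T) : measurable A -> Ex P \1_A = fine (P A).
Proof. by move=> mA; rewrite /Rintegral integral_indic// setIT. Qed.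

Lemma integ_indic (A : set T) : measurable A -> integ P \1_A.
Proof.
move=> mA; apply: (@integ_bounded _ 1) => // t.
by rewrite indicE; case: (_ \in _); rewrite ?normr1 ?normr0.
Qed.

End expectation.

(** The sum is the integer part of [x]. *)
Lemma sumr_indicator_floor {R : realType} (m : nat) (x : R) :
  0 <= x <= m%:R -> `|x - \sum_(k < m) (k.+1%:R <= x)%R%:R| <= 1.
Proof.
elim: m => [|m IH] /andP[x0 xm].
  by rewrite (_ : x = 0) ?big_ord0 ?subr0 ?normr0//; apply: le_anti; rewrite x0 xm.
have [xm'|xm'] := leP x m%:R.
  rewrite big_ord_recr/= [(m.+1%:R <= x)%R](_ : _ = false); last first.
    by apply/negbTE; rewrite -ltNge (le_lt_trans xm')// ltr_nat.
  rewrite addr0.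
  by apply: IH; rewrite x0.
rewrite (_ : \sum__ _ = m%:R + (m.+1%:R <= x)%R%:R); last first.
  rewrite big_ord_recr/=; congr (_ + _).
  rewrite (eq_bigr (fun=> 1))//= ?sumr_const ?card_ord// => i _.
  by rewrite (le_trans _ (ltW xm'))// ler_nat.
rewrite -natr1 in xm *; rewrite ler_norml.
by have [h|h] := leP (m%:R + 1) x; rewrite ?h ?(ltW h) /=; lra.
Qed.

Section weighted_independence.
Context {R : realType} {d : measure_display} {T : measurableType d}.
Variable P : probability T R.
Context {d' : measure_display} {E : measurableType d'}.

(** Approximating a bounded [g] uniformly by step functions
    $m^{-1} \sum_{k<m} 1[g \ge (k+1)/m]$ reduces the claim to indicators of
    events of [Z]. *)
Lemma uncorrelated_bounded (V : T -> R) (Z : T -> E) (g : E -> R) (K : R) :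
  measurable_fun [set: T] Z -> integ P V ->
  (forall B, measurable B ->
     Ex P (fun t => V t * \1_B (Z t)) = Ex P V * Ex P (fun t => \1_B (Z t))) ->
  measurable_fun [set: E] g -> (forall x, `|g x| <= K) ->
  Ex P (fun t => V t * g (Z t)) = Ex P V * Ex P (fun t => g (Z t)).
Proof.
move=> mZ iV indV mg gK.
have mV := integ_measurable iV.
have mindic (B : set E) : measurable B -> measurable_fun setT (fun t => \1_B (Z t) : R).
  by move=> mB; apply: (measurableT_comp (measurable_indic mB) mZ).
have iVb (h : T -> R) (C : R) : measurable_fun setT h -> (forall t, `|h t| <= C) ->
    integ P (fun t => V t * h t).
  move=> mh hC; apply: (@integ_le _ _ _ _ (fun t => C * `|V t|)).
  - exact: measurable_funM.
  - by move=> t; rewrite normrM mulrC ler_wpM2r.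
  - exact/integZ/integ_norm.
have indic1 (B : set E) t : `|\1_B (Z t) : R| <= 1.
  by rewrite indicE; case: (_ \in _); rewrite ?normr1 ?normr0.
have K0 : 0 <= K.
  have [t0|nT] := pselect (exists t : T, True).
    by case: t0 => t _; exact: le_trans (gK (Z t)).
  exfalso; have := probability_setT P; rewrite (_ : setT = set0).
    by rewrite measure0 => /eqP; rewrite eqe eq_sym oner_eq0.
  by apply/seteqP; split => // t _; apply: nT; exists t.
pose K1 := 2 * K + 1.
have K1_gt0 : 0 < K1 by rewrite /K1; lra.
pose gg x := (g x + K) / K1.
have gg01 x : 0 <= gg x <= 1.
  have := gK x; rewrite ler_norml => /andP[g1 g2].
  by rewrite /gg ler_pdivlMr// mul0r ler_pdivrMr// mul1r /K1; apply/andP; split; lra.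
have mgg : measurable_fun setT gg.
  by apply: measurable_funM => //; apply: measurable_funD.
suff H : Ex P (fun t => V t * gg (Z t)) = Ex P V * Ex P (fun t => gg (Z t)).
  have gE x : g x = K1 * gg x - K by rewrite /gg mulrC divfK ?gt_eqF// addrK.
  have igg : integ P (fun t => gg (Z t)).
    apply: (@integ_bounded _ _ _ _ _ 1); first exact: measurableT_comp.
    by move=> t; have /andP[? ?] := gg01 (Z t); rewrite ger0_norm.
  have iVgg : integ P (fun t => V t * gg (Z t)).
    apply: (iVb _ 1); first exact: measurableT_comp.
    by move=> t; have /andP[? ?] := gg01 (Z t); rewrite ger0_norm.
  under eq_Rintegral do rewrite gE mulrBr mulrCA [_ * K]mulrC.
  rewrite ExB; [|exact: integZ|exact: integZ].
  rewrite !ExZ// H.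
  have -> : Ex P (fun t => g (Z t)) = K1 * Ex P (fun t => gg (Z t)) - K.
    rewrite -ExZ// -[in RHS](Ex_cst P K) -ExB; [|exact: integZ|exact: integ_cst].
    by apply: eq_Rintegral => t _; rewrite gE.
  by ring.
apply/eqP; rewrite -subr_eq0 -normr_le0; apply/ler_addgt0Pl => e e0; rewrite addr0.
pose c := Ex P (fun t => `|V t|) + `|Ex P V|.
have c0 : 0 <= c by rewrite addr_ge0// Ex_ge0.
have [m' hm] : exists m : nat, c / e <= m.+1%:R.
  have [k hk] : exists k : nat, c / e <= k%:R.
    exists (Num.truncn (c / e)).+1; exact/ltW/truncnS_gt.
  by exists k; rewrite (le_trans hk)// ler_nat.
pose m := m'.+1; have m0 : 0 < m%:R :> R by rewrite ltr0n.
pose B (k : nat) := [set x : E | k.+1%:R <= m%:R * gg x].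
have mB k : measurable (B k).
  rewrite /B -[X in measurable X]setTI.
  have := @measurable_fun_le _ _ _ setT (fun=> k.+1%:R) (fun x => m%:R * gg x) measurableT.
  rewrite /= => h; apply: h => //; exact: measurable_funM.
pose G (x : E) : R := m%:R^-1 * \sum_(k < m) \1_(B k) x.
have gG x : `|gg x - G x| <= m%:R^-1.
  have -> : gg x - G x = m%:R^-1 * (m%:R * gg x - \sum_(k < m) (k.+1%:R <= m%:R * gg x)%R%:R).
    rewrite mulrBr mulKf ?gt_eqF//; congr (_ - _ * _).
    apply: eq_bigr => k _; rewrite indicE; congr (_%:R); congr nat_of_bool.
    by apply/idP/idP; rewrite inE.
  have mi0 : 0 <= m%:R^-1 :> R by rewrite invr_ge0 ltW.
  rewrite normrM (ger0_norm mi0) ler_piMr//.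
  apply: sumr_indicator_floor; have /andP[? ?] := gg01 x.
  by apply/andP; split; [exact: mulr_ge0 (ltW m0) _|rewrite ler_piMr// ltW].
have mG : measurable_fun setT G.
  apply: measurable_funM => //; apply: measurable_sum => k.
  exact: measurable_indic.
have HG : Ex P (fun t => V t * G (Z t)) = Ex P V * Ex P (fun t => G (Z t)).
  rewrite /G ExZ; last first.
    by apply: integ_sum => k; apply: (@integ_bounded _ _ _ _ _ 1) => //; exact: mindic.
  rewrite Ex_sum; last first.
    by move=> k; apply: (@integ_bounded _ _ _ _ _ 1) => //; exact: mindic.
  under eq_Rintegral do rewrite mulrCA mulr_sumr.
  rewrite ExZ; last first.
    by apply: integ_sum => k; apply: (iVb _ 1) => //; exact: mindic.
  rewrite Ex_sum; last by move=> k; apply: (iVb _ 1) => //; exact: mindic.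
  rewrite mulrCA; congr (_ * _); rewrite mulr_sumr; apply: eq_bigr => k _.
  exact: indV.
have Gb x : `|G x| <= 2.
  have := gG x; have := gg01 x => /andP[? ?] /ler_normlP [].
  have : m%:R^-1 <= 1 :> R by rewrite invf_le1// ler1n.
  by rewrite ler_norml => *; apply/andP; split; lra.
have iG : integ P (fun t => G (Z t)).
  by apply: (@integ_bounded _ _ _ _ _ 2) => //; exact: measurableT_comp.
have iVG : integ P (fun t => V t * G (Z t)).
  by apply: (iVb _ 2) => //; exact: measurableT_comp.
have igg : integ P (fun t => gg (Z t)).
  apply: (@integ_bounded _ _ _ _ _ 1); first exact: measurableT_comp.
  by move=> t; have /andP[? ?] := gg01 (Z t); rewrite ger0_norm.
have iVgg : integ P (fun t => V t * gg (Z t)).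
  apply: (iVb _ 1); first exact: measurableT_comp.
  by move=> t; have /andP[? ?] := gg01 (Z t); rewrite ger0_norm.
have e1 : `|Ex P (fun t => V t * gg (Z t)) - Ex P (fun t => V t * G (Z t))|
    <= m%:R^-1 * Ex P (fun t => `|V t|).
  rewrite -ExB// -ExZ; last exact: integ_norm.
  apply: Ex_norm_le; [exact: integB|exact/integZ/integ_norm|].
  by move=> t; rewrite -mulrBr normrM mulrC ler_wpM2r.
have e2 : `|Ex P (fun t => gg (Z t)) - Ex P (fun t => G (Z t))| <= m%:R^-1.
  by rewrite -ExB//; apply: Ex_norm_bound => //; exact: integB.
have -> : Ex P (fun t => V t * gg (Z t)) - Ex P V * Ex P (fun t => gg (Z t)) =
  (Ex P (fun t => V t * gg (Z t)) - Ex P (fun t => V t * G (Z t))) -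
  Ex P V * (Ex P (fun t => gg (Z t)) - Ex P (fun t => G (Z t))).
  by rewrite HG; ring.
apply: le_trans (ler_normB _ _) _; rewrite normrM.
apply: (@le_trans _ _ (m%:R^-1 * c)).
  by rewrite mulrDr lerD// [leRHS]mulrC ler_wpM2l.
by rewrite mulrC ler_pdivrMr// mulrC -ler_pdivrMr.
Qed.

End weighted_independence.

(** * Laws and independence *)

Section change_of_variables.
Context {R : realType} {d d' : measure_display}.
Context {T : measurableType d} {E : measurableType d'}.
Variables (P : probability T R) (Q : {measure set E -> \bar R}) (Z : T -> E).
Hypothesis mZ : measurable_fun [set: T] Z.
Hypothesis QZ : forall B, measurable B -> Q B = P (Z @^-1` B).

Lemma ge0_integral_law (f : E -> \bar R) : measurable_fun [set: E] f ->
  (forall x, 0 <= f x)%E -> (\int[Q]_x f x = \int[P]_t f (Z t))%E.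
Proof.
move=> mf f0.
rewrite -(@ge0_integral_pushforward _ _ _ _ _ _ mZ P setT f)//.
by apply: eq_measure_integral => A mA _; exact: QZ.
Qed.

Lemma integ_law (f : E -> R) : measurable_fun [set: E] f ->
  integ Q f <-> integ P (fun t => f (Z t)).
Proof.
move=> mf; have E1 : (\int[Q]_x `|(f x)%:E| = \int[P]_t `|(f (Z t))%:E|)%E.
  apply: (ge0_integral_law (f := fun x => `|(f x)%:E|%E)) => //.
  by apply: measurableT_comp => //; exact/measurable_EFinP.
split=> /integrableP[m1 i1]; apply/integrableP; split.
- by apply/measurable_EFinP; exact: measurableT_comp.
- by move: i1; rewrite E1.
- exact/measurable_EFinP.
- by move: i1; rewrite E1.
Qed.

Lemma Ex_law (f : E -> R) : integ Q f -> Ex Q f = Ex P (fun t => f (Z t)).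
Proof.
move=> iQ; have /measurable_EFinP mf := measurable_int _ iQ.
have iP := (integ_law mf).1 iQ.
rewrite /Rintegral; congr fine.
rewrite -[RHS](@integral_pushforward _ _ _ _ _ _ mZ P setT (EFin \o f))//.
  by apply: eq_measure_integral => A mA _; exact: QZ.
exact/measurable_EFinP.
Qed.

End change_of_variables.

Section same_law.
Context {R : realType} {d d' : measure_display}.
Context {T : measurableType d} {E : measurableType d'}.
Variables (P : probability T R) (Y Z : T -> E).
Hypotheses (mY : measurable_fun [set: T] Y) (mZ : measurable_fun [set: T] Z).
Hypothesis YZ : same_law P Y Z.
Let mY_pack : {mfun T >-> E} := HB.pack Y (isMeasurableFun.Build _ _ _ _ _ mY).

Lemma same_law_integ (f : E -> R) : measurable_fun [set: E] f ->
  integ P (fun t => f (Y t)) <-> integ P (fun t => f (Z t)).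
Proof.
move=> mf; rewrite -(integ_law (Q := distribution P mY_pack) mZ)//.
by rewrite -(integ_law (Q := distribution P mY_pack) mY).
Qed.

Lemma same_law_Ex (f : E -> R) : measurable_fun [set: E] f ->
  integ P (fun t => f (Y t)) ->
  Ex P (fun t => f (Y t)) = Ex P (fun t => f (Z t)).
Proof.
move=> mf iY; have iQ : integ (distribution P mY_pack) f.
  by apply/(integ_law (P := P) mY).
by rewrite -(Ex_law mZ _ iQ)// -(Ex_law mY _ iQ).
Qed.

End same_law.

Section product_rule.
Context {R : realType} {d : measure_display} {T : measurableType d}.
Variable P : probability T R.

Lemma independent2_comp {d1 d2 d3 d4 : measure_display}
    {T1 : measurableType d1} {T2 : measurableType d2}
    {T3 : measurableType d3} {T4 : measurableType d4}
    (X : T -> T1) (Y : T -> T2) (f : T1 -> T3) (g : T2 -> T4) :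
  measurable_fun [set: T1] f -> measurable_fun [set: T2] g ->
  independent2 P X Y -> independent2 P (f \o X) (g \o Y).
Proof.
move=> mf mg ind B D mB mD; apply: (ind (f @^-1` B) (g @^-1` D)).
  by rewrite -[X in measurable X]setTI; exact: mf.
by rewrite -[X in measurable X]setTI; exact: mg.
Qed.

Section real.
Variables X Y : T -> R.
Hypotheses (iX : integ P X) (iY : integ P Y).
Hypothesis ind : independent2 P X Y.
Let mX : measurable_fun [set: T] X := integ_measurable iX.
Let mY : measurable_fun [set: T] Y := integ_measurable iY.
Let X' : {mfun T >-> R} := HB.pack X (isMeasurableFun.Build _ _ _ _ _ mX).
Let Y' : {mfun T >-> R} := HB.pack Y (isMeasurableFun.Build _ _ _ _ _ mY).
Let m1 := distribution P X'.
Let m2 := distribution P Y'.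
Let mXY : measurable_fun [set: T] (fun t => (X t, Y t)).
Proof. exact: measurable_fun_pair. Qed.

Let lawXY B : measurable B -> (m1 \x m2)%E B = P ((fun t => (X t, Y t)) @^-1` B).
Proof.
move=> mB; rewrite -[RHS]/(pushforward P (fun t => (X t, Y t)) B).
apply: (product_measure_unique (m' := pushforward P (fun t => (X t, Y t)))) => //.
Qed.

Let ix1 : integ m1 (fun x => x).
Proof. by apply/(integ_law (P := P) mX). Qed.

Let iy2 : integ m2 (fun x => x).
Proof. by apply/(integ_law (P := P) mY). Qed.

Let imul : integ (m1 \x m2)%E (fun xy : R * R => xy.1 * xy.2).
Proof.
have mmul : measurable_fun setT (fun xy : R * R => xy.1 * xy.2).
  by apply: measurable_funM; [exact: measurable_fst|exact: measurable_snd].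
apply/integrable12ltyP; first exact/measurable_EFinP.
under eq_integral => x _.
  under eq_integral => y _ do rewrite /= normrM EFinM.
  rewrite ge0_integralZl//; last first.
    by apply/measurable_EFinP; exact: normr_measurable.
  over.
have [_ fin1] := integrableP _ _ _ ix1; have [_ fin2] := integrableP _ _ _ iy2.
rewrite ge0_integralZr//.
- by rewrite lte_mul_pinfty ?integral_ge0// ge0_fin_numE ?integral_ge0.
- by apply/measurable_EFinP; exact: normr_measurable.
- by apply: integral_ge0.
Qed.

Lemma integM_indep : integ P (fun t => X t * Y t).
Proof.
apply/(integ_law mXY lawXY (f := fun xy : R * R => xy.1 * xy.2)) => //.
by apply: measurable_funM; [exact: measurable_fst|exact: measurable_snd].
Qed.

(** Fubini: by uniqueness the joint law is the product of the marginal laws. *)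
Lemma ExM_indep : Ex P (fun t => X t * Y t) = Ex P X * Ex P Y.
Proof.
rewrite -(Ex_law mXY lawXY imul) -(Ex_law (Q := m1) mX _ ix1)//.
rewrite -(Ex_law (Q := m2) mY _ iy2)//.
rewrite {1}/Rintegral -(integral12_prod_meas1 imul) /fubini_F.
under eq_integral => x _.
  rewrite /= (_ : (\int[m2]_y (x * y)%:E = (Ex m2 (fun y => y))%:E * x%:E)%E); last first.
    under eq_integral do rewrite EFinM.
    rewrite integralZl//= muleC; congr (_ * _)%E.
    by rewrite fineK//; exact: integrable_fin_num.
  over.
rewrite (integralZl measurableT ix1) fineM.
- by rewrite mulrC.
- by [].
- exact: (integrable_fin_num measurableT ix1).
Qed.

End real.

End product_rule.

(** * Taylor bounds and limits *)

Section taylor.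
Context {R : realType}.
Implicit Types u : R.

(** Iterated from $1 - \cos \ge 0$ upwards, this gives the Taylor bounds
    with explicit constants. *)
Lemma ge0_of_derive (f g : R -> R) : (forall x : R, is_derive x 1 f (g x)) ->
  f 0 = 0 -> (forall x, 0 <= x -> 0 <= g x) -> forall x, 0 <= x -> 0 <= f x.
Proof.
move=> fg f0 g0 x x0; rewrite -f0.
have df y : derivable f y 1 by have [] := fg y.
apply: (@ger0_derive1_le_cc _ f 0 x) => //.
- by move=> y /[!in_itv]/= /andP[y0 _]; rewrite derive1E derive_val g0// ltW.
- by apply: derivable_within_continuous => y _.
- by rewrite in_itv/= lexx.
- by rewrite in_itv/= lexx x0.
Qed.

Lemma sin_le u : 0 <= u -> sin u <= u.
Proof.
move=> u0; rewrite -subr_ge0.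
apply: (@ge0_of_derive (fun x => x - sin x) (fun x => 1 - cos x)) => //.
- by rewrite sin0 subr0.
Qed.

Lemma cos_ge_quadratic u : 0 <= u -> 0 <= cos u - 1 + u ^+ 2 / 2.
Proof.
move=> u0.
apply: (@ge0_of_derive (fun x => cos x - 1 + x ^+ 2 / 2) (fun x => x - sin x)) => //.
- move=> x; apply: is_derive_eq; rewrite /GRing.scale/=; lra.
- by rewrite cos0; lra.
- by move=> x x0; rewrite subr_ge0 sin_le.
Qed.

Lemma sin_ge_cubic u : 0 <= u -> 0 <= sin u - u + u ^+ 3 / 6.
Proof.
move=> u0.
apply: (@ge0_of_derive (fun x => sin x - x + x ^+ 3 / 6)
                       (fun x => cos x - 1 + x ^+ 2 / 2)) => //.
- move=> x; apply: is_derive_eq; rewrite /GRing.scale/=; lra.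
- by rewrite sin0; lra.
- exact: cos_ge_quadratic.
Qed.

Lemma cos_le_quartic u : 0 <= u -> 0 <= u ^+ 4 / 24 - (cos u - 1 + u ^+ 2 / 2).
Proof.
move=> u0.
apply: (@ge0_of_derive (fun x => x ^+ 4 / 24 - (cos x - 1 + x ^+ 2 / 2))
                       (fun x => sin x - x + x ^+ 3 / 6)) => //.
- move=> x; apply: is_derive_eq; rewrite /GRing.scale/=; lra.
- by rewrite cos0; lra.
- exact: sin_ge_cubic.
Qed.

(** At the scale $n^{-1/2}$ the higher power gives convergence of the rescaled
    remainder to zero, and the square gives its integrable majorant; the same holds for
    [sin_taylor]. *)
Lemma cos_taylor u : `|cos u - 1 + u ^+ 2 / 2| <= u ^+ 4 /\
  `|cos u - 1 + u ^+ 2 / 2| <= u ^+ 2.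
Proof.
wlog u0 : u / 0 <= u.
  move=> H; have [u0|u0] := leP 0 u; first exact: H.
  have := H (- u); rewrite cosN sqrrN (_ : (- u) ^+ 4 = u ^+ 4); last by ring.
  by apply; rewrite oppr_ge0 ltW.
have h1 := cos_ge_quadratic u0; have h2 := cos_le_quartic u0.
have h3 := cos_le1 u; have h4 := sqr_ge0 u; have h5 : 0 <= u ^+ 4 by rewrite exprn_ge0.
by rewrite ger0_norm//; split; lra.
Qed.

Lemma sin_taylor u : `|sin u - u| <= `|u| ^+ 3 /\ `|sin u - u| <= u ^+ 2.
Proof.
wlog u0 : u / 0 <= u.
  move=> H; have [u0|u0] := leP 0 u; first exact: H.
  have := H (- u); rewrite sinN sqrrN normrN -opprD normrN.
  by apply; rewrite oppr_ge0 ltW.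
have h1 := sin_le u0; have h2 := sin_ge_cubic u0; have h3 := sin_geN1 u.
rewrite distrC (ger0_norm u0) ger0_norm ?subr_ge0//.
have h5 : 0 <= u ^+ 3 by rewrite exprn_ge0.
split; first lra.
have [u6|u6] := leP u 6.
  have : u ^+ 3 <= 6 * u ^+ 2 by rewrite exprS ler_wpM2r ?sqr_ge0.
  by lra.
have : 6 * u <= u ^+ 2 by rewrite expr2 ler_wpM2r// ltW.
by lra.
Qed.

Lemma expRN_quadratic u : 0 <= u -> `|expR (- u) - 1 + u| <= u ^+ 2.
Proof.
move=> u0; have h1 := expR_ge1Dx (- u); have h2 := expR_ge1Dx u.
rewrite ger0_norm; last lra.
have h : expR (- u) <= (1 + u)^-1.
  by rewrite expRN lef_pV2 ?posrE ?expR_gt0//; lra.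
suff : (1 + u)^-1 <= 1 - u + u ^+ 2 by lra.
have u1 : 0 < 1 + u by lra.
rewrite -[leRHS](mulfK (lt0r_neq0 u1)) ler_peMl ?invr_ge0 ?(ltW u1)//.
have : 0 <= u ^+ 3 by rewrite exprn_ge0.
by rewrite !exprS expr0; lra.
Qed.

End taylor.

Section limits.
Context {R : realType}.

Lemma cvg0_le (u v : nat -> R) : (\forall n \near \oo, `|u n| <= v n) ->
  v n @[n --> \oo] --> 0 -> u n @[n --> \oo] --> 0.
Proof.
move=> uv v0; apply: norm_cvg0.
apply: (@squeeze_cvgr _ _ _ _ (fun=> 0) v) => //; last exact: cvg_cst.
by apply: filterS uv => n ->; rewrite andbT.
Qed.

Lemma cvg_near0 (u : nat -> R) l : (u n - l) @[n --> \oo] --> (0 : R) ->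
  u n @[n --> \oo] --> l.
Proof. by move=> /cvg_sub0; apply; exact: cvg_cst. Qed.

Lemma cvg_div_nat (c : R) : c / n%:R @[n --> \oo] --> 0.
Proof.
rewrite -[X in _ --> X](mulr0 c); apply: cvgMr.
rewrite -(cvg_shiftn 1).
rewrite (_ : (fun n => _) = (fun n => n.+1%:R^-1)); first exact: cvg_harmonic.
by apply/funext => n; rewrite addn1.
Qed.

Lemma cvg_div_sqrt (c : R) : c / Num.sqrt n%:R @[n --> \oo] --> 0.
Proof.
apply/cvgr0Pnorm_le => e e0.
near=> n.
have n0 : (0 < n)%N by near: n; exists 1%N.
have s0 : 0 < Num.sqrt n%:R :> R by rewrite sqrtr_gt0 ltr0n.
rewrite normrM normfV (gtr0_norm s0) ler_pdivrMr// mulrC -ler_pdivrMr//.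
rewrite -[leLHS]ger0_norm ?divr_ge0// ?(ltW e0)// -sqrtr_sqr ler_wsqrtr//.
by near: n; exact: nbhs_infty_ger.
Unshelve. all: by end_near. Qed.

End limits.

Section dominated.
Context {R : realType} {d : measure_display} {T : measurableType d}.
Variable P : probability T R.

Lemma Ex_dominated_cvg (f_ : nat -> T -> R) (f g : T -> R) :
  (forall n, measurable_fun [set: T] (f_ n)) -> measurable_fun [set: T] f ->
  (forall t, f_ n t @[n --> \oo] --> f t) ->
  integ P g -> (forall n t, `|f_ n t| <= g t) ->
  Ex P (f_ n) @[n --> \oo] --> Ex P f.
Proof.
move=> mf_ mf f_f ig f_g.
have := @dominated_convergence _ T R P setT measurableT
  (fun n => EFin \o f_ n) (EFin \o f) (EFin \o g).
case.
- by move=> n; exact/measurable_EFinP.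
- exact/measurable_EFinP.
- apply: aeW => t _; apply: cvg_EFin; first exact: nearW.
  exact: f_f.
- exact: ig.
- by apply: aeW => t n _ /=; rewrite lee_fin.
move=> ifi _; rewrite -[X in _ --> X]fineK; last exact: integrable_fin_num.
by move=> /fine_cvgP[_].
Qed.

End dominated.

(** * Stochastic order symbols and the weak law of large numbers *)

Section stochastic_order.
Context {R : realType} {d : measure_display} {T : measurableType d}.
Variable P : probability T R.
Implicit Types (A B : nat -> set T) (Y Z : nat -> T -> R) (e : R).

(** Inner probability: an event need not be measurable, only contain a
    measurable event of probability at least [1 - e]. Thus events about minimizers
    can be handled without measurability proofs. *)
Definition whp e A := \forall n \near \oo,
  exists2 D, measurable D & D `<=` A n /\ 1 - e <= fine (P D).

Definition OP Z := forall e, 0 < e ->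
  exists M, whp e (fun n => [set t | `|Z n t| <= M]).

Definition oP Z := forall eta e, 0 < eta -> 0 < e ->
  whp e (fun n => [set t | `|Z n t| <= eta]).

Lemma whpS e A B : (\forall n \near \oo, A n `<=` B n) -> whp e A -> whp e B.
Proof.
move=> AB wA; near=> n.
have AnBn : A n `<=` B n by near: n.
have [D mD [DA PD]] : exists2 D, measurable D & D `<=` A n /\ 1 - e <= fine (P D).
  by near: n.
by exists D => //; split => //; exact: subset_trans AnBn.
Unshelve. all: by end_near. Qed.

Lemma whpI e1 e2 A B : whp e1 A -> whp e2 B ->
  whp (e1 + e2) (fun n => A n `&` B n).
Proof.
move=> wA wB; near=> n.
have [D mD [DA PD]] : exists2 D, measurable D & D `<=` A n /\ 1 - e1 <= fine (P D).
  by near: n.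
have [F mF [FB PF]] : exists2 D, measurable D & D `<=` B n /\ 1 - e2 <= fine (P D).
  by near: n.
exists (D `&` F); first exact: measurableI.
split; first exact: setISS.
rewrite -!Ex_indic// in PD PF *; last exact: measurableI.
have iD := integ_indic P mD; have iF := integ_indic P mF.
have iDF := integ_indic P (measurableI _ _ mD mF).
suff : Ex P (\1_D) + Ex P (\1_F) - 1 <= Ex P (\1_(D `&` F)) by lra.
rewrite -(Ex_cst P 1) -ExD// -ExB//; [|exact: integD|exact: integ_cst].
apply: Ex_le => //; first by apply: integB; [exact: integD|exact: integ_cst].
move=> t; rewrite !indicE in_setI.
by case: (t \in D); case: (t \in F) => /=; lra.
Unshelve. all: by end_near. Qed.

Lemma whpT e A : 0 <= e -> (forall n t, A n t) -> whp e A.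
Proof.
move=> e0 AT; apply: nearW => n; exists setT => //; split => //.
rewrite (_ : P setT = 1%E); last exact: (probability_setT P).
by rewrite /= lerBlDr lerDl.
Qed.

Lemma whp_le e A : (forall n, measurable (A n)) -> whp e A ->
  \forall n \near \oo, 1 - e <= fine (P (A n)).
Proof.
move=> mA; apply: filterS => n [D mD [DA PD]].
apply: le_trans PD _; rewrite fine_le ?fin_num_measure//.
by apply: le_measure => //; rewrite inE.
Qed.

Lemma whp_compl e A : (forall n, measurable (A n)) ->
  (\forall n \near \oo, fine (P (~` A n)) <= e) -> whp e A.
Proof.
move=> mA; apply: filterS => n PA; exists (A n) => //; split => //.
have -> : P (A n) = (1 - P (~` A n))%E.
  rewrite -[in LHS](setCK (A n)) probability_setC//; exact: measurableC.
rewrite fineB//; last exact/fin_num_measure/measurableC.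
by rewrite /= lerB.
Qed.

Lemma chebyshev_fine (Z : T -> R) (eta : R) : 0 < eta ->
  measurable_fun [set: T] Z -> integ P (fun t => Z t ^+ 2) ->
  fine (P (~` [set t | `|Z t| <= eta])) <= Ex P (fun t => Z t ^+ 2) / eta ^+ 2.
Proof.
move=> eta0 mZ iZ.
have mA : measurable (~` [set t | `|Z t| <= eta]).
  apply: measurableC; rewrite -[X in measurable X]setTI.
  apply: (measurable_fun_le measurableT) => //.
  exact: measurableT_comp.
rewrite -Ex_indic// ler_pdivlMr ?exprn_gt0// mulrC -ExZ; last exact: integ_indic.
apply: Ex_le => //; first exact/integZ/integ_indic.
move=> t; rewrite indicE; have [|] := boolP (_ \in _); last by rewrite mulr0 sqr_ge0.
rewrite inE/= => /negP; rewrite -ltNge mulr1 => h.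
by rewrite -[leRHS]real_normK ?num_real// ler_sqr ?nnegrE ?(ltW h) ?(ltW eta0).
Qed.

Lemma measurable_norm_le (Z : T -> R) (M : R) : measurable_fun [set: T] Z ->
  measurable [set t | `|Z t| <= M].
Proof.
move=> mZ; rewrite -[X in measurable X]setTI.
by apply: (measurable_fun_le measurableT) => //; exact: measurableT_comp.
Qed.

Lemma OP_second_moment Z K : (forall n, measurable_fun [set: T] (Z n)) ->
  (forall n, integ P (fun t => Z n t ^+ 2)) ->
  (\forall n \near \oo, Ex P (fun t => Z n t ^+ 2) <= K) -> OP Z.
Proof.
move=> mZ iZ EZ e e0; exists (Num.sqrt ((`|K| + 1) / e)).
have K0 : 0 < (`|K| + 1) / e by rewrite divr_gt0// ltr_wpDl.
apply: whp_compl => [n|]; first exact: measurable_norm_le.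
apply: filterS EZ => n EZ.
apply: le_trans (chebyshev_fine _ (mZ n) (iZ n)) _; first by rewrite sqrtr_gt0.
rewrite sqr_sqrtr ?(ltW K0)// ler_pdivrMr// mulrCA divff ?gt_eqF// mulr1.
by rewrite (le_trans EZ)// (le_trans (ler_norm _))// lerDl.
Qed.

Lemma oP_second_moment Z : (forall n, measurable_fun [set: T] (Z n)) ->
  (forall n, integ P (fun t => Z n t ^+ 2)) ->
  Ex P (fun t => Z n t ^+ 2) @[n --> \oo] --> 0 -> oP Z.
Proof.
move=> mZ iZ EZ eta e eta0 e0.
apply: whp_compl => [n|]; first exact: measurable_norm_le.
have e2 : 0 < e * eta ^+ 2 by rewrite mulr_gt0// exprn_gt0.
move/cvgr0Pnorm_le : EZ => /(_ _ e2); apply: filterS => n EZ.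
apply: le_trans (chebyshev_fine _ (mZ n) (iZ n)) _ => //.
rewrite ler_pdivrMr ?exprn_gt0//; exact: le_trans (ler_norm _) EZ.
Qed.

Lemma OP_le Y Z : (forall n t, `|Y n t| <= `|Z n t|) -> OP Z -> OP Y.
Proof.
move=> YZ OZ e e0; have [M wM] := OZ e e0; exists M; apply: whpS wM.
by apply: nearW => n t /=; exact: le_trans.
Qed.

Lemma oP_le Y Z : (forall n t, `|Y n t| <= `|Z n t|) -> oP Z -> oP Y.
Proof.
move=> YZ OZ eta e eta0 e0; apply: whpS (OZ eta e eta0 e0).
by apply: nearW => n t /=; exact: le_trans.
Qed.

Lemma OP_eq Y Z : (forall n t, Y n t = Z n t) -> OP Z -> OP Y.
Proof. by move=> YZ; apply: OP_le => n t; rewrite YZ. Qed.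

Lemma oP_eq Y Z : (forall n t, Y n t = Z n t) -> oP Z -> oP Y.
Proof. by move=> YZ; apply: oP_le => n t; rewrite YZ. Qed.

Lemma oP_OP Z : oP Z -> OP Z.
Proof. by move=> oZ e e0; exists 1; exact: oZ. Qed.

Lemma OP_cst (c : R) : OP (fun _ _ => c).
Proof. by move=> e e0; exists `|c|; apply: whpT => [|n t /=]; [exact: ltW|]. Qed.

Lemma oP_cvg (c : nat -> R) : c n @[n --> \oo] --> 0 -> oP (fun n _ => c n).
Proof.
move=> /cvgr0Pnorm_le c0 eta e eta0 e0; apply: filterS (c0 eta eta0) => n cn.
exists setT => //; split => //.
rewrite (_ : P setT = 1%E); last exact: (probability_setT P).
by rewrite /= lerBlDr lerDl ltW.
Qed.

Lemma OPD Y Z : OP Y -> OP Z -> OP (fun n t => Y n t + Z n t).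
Proof.
move=> OY OZ e e0; have e20 : 0 < e / 2 by rewrite divr_gt0.
have [M wM] := OY _ e20; have [N wN] := OZ _ e20; exists (M + N).
rewrite (splitr e); apply: whpS (whpI wM wN).
by apply: nearW => n t /= [YM ZN]; rewrite (le_trans (ler_normD _ _))// lerD.
Qed.

Lemma oPD Y Z : oP Y -> oP Z -> oP (fun n t => Y n t + Z n t).
Proof.
move=> OY OZ eta e eta0 e0; have e20 : 0 < e / 2 by rewrite divr_gt0.
have eta20 : 0 < eta / 2 by rewrite divr_gt0.
rewrite (splitr e); apply: whpS (whpI (OY _ _ eta20 e20) (OZ _ _ eta20 e20)).
apply: nearW => n t /= [YM ZN]; rewrite (le_trans (ler_normD _ _))//.
by rewrite (splitr eta) lerD.
Qed.

Lemma OPM Y Z : OP Y -> OP Z -> OP (fun n t => Y n t * Z n t).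
Proof.
move=> OY OZ e e0; have e20 : 0 < e / 2 by rewrite divr_gt0.
have [M wM] := OY _ e20; have [N wN] := OZ _ e20; exists (M * N).
rewrite (splitr e); apply: whpS (whpI wM wN).
by apply: nearW => n t /= [YM ZN]; rewrite normrM ler_pM.
Qed.

Lemma oPM Y Z : oP Y -> OP Z -> oP (fun n t => Y n t * Z n t).
Proof.
move=> oY OZ eta e eta0 e0; have e20 : 0 < e / 2 by rewrite divr_gt0.
have [N wN] := OZ _ e20.
have N1 : 0 < `|N| + 1 by rewrite ltr_wpDl.
have eta20 : 0 < eta / (`|N| + 1) by rewrite divr_gt0.
rewrite (splitr e); apply: whpS (whpI (oY _ _ eta20 e20) wN).
apply: nearW => n t /= [YM ZN]; rewrite normrM.
apply: (@le_trans _ _ (eta / (`|N| + 1) * (`|N| + 1))); last by rewrite divfK ?gt_eqF.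
by rewrite ler_pM// (le_trans ZN)// (le_trans (ler_norm _))// lerDl.
Qed.

Lemma OP_sum (I : Type) (s : seq I) (Z : I -> nat -> T -> R) :
  (forall i, OP (Z i)) -> OP (fun n t => \sum_(i <- s) Z i n t).
Proof.
move=> OZ; elim: s => [|i s IH].
  by apply: OP_eq (OP_cst 0) => n t; rewrite big_nil.
by apply: OP_eq (OPD (OZ i) IH) => n t; rewrite big_cons.
Qed.

Lemma oP_sum (I : Type) (s : seq I) (Z : I -> nat -> T -> R) :
  (forall i, oP (Z i)) -> oP (fun n t => \sum_(i <- s) Z i n t).
Proof.
move=> OZ; elim: s => [|i s IH].
  by apply: oP_eq (oP_cvg (cvg_cst 0)) => n t; rewrite big_nil.
by apply: oP_eq (oPD (OZ i) IH) => n t; rewrite big_cons.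
Qed.

End stochastic_order.

Section iid.
Context {R : realType} {d d' : measure_display}.
Context {T : measurableType d} {E : measurableType d'}.
Variables (P : probability T R) (Zs : nat -> T -> E) (Z : T -> E).
Hypotheses (mZs : forall i, measurable_fun [set: T] (Zs i))
           (mZ : measurable_fun [set: T] Z).
Hypothesis indZ : mutually_independent P Zs.
Hypothesis lawZ : forall i, same_law P (Zs i) Z.

Let measurable_preim (B : set E) i : measurable B -> measurable (Zs i @^-1` B).
Proof. by move=> mB; rewrite -[X in measurable X]setTI; exact: mZs. Qed.

(** Mutual independence tested on the index set $\{i, j\}$. *)
Lemma pairwise_independent i j : i != j -> independent2 P (Zs i) (Zs j).
Proof.
move=> ij B D mB mD.
have := indZ [fset i; j]%fset (B := fun k => if k == i then B else D).
rewrite big_fsetU1/= ?inE// big_seq_fset1 eqxx eq_sym (negbTE ij) => <-; last first.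
  by move=> k; case: ifP.
congr (P _); apply/seteqP; split => t /=.
  move=> [Bt Dt] k /=; rewrite !inE => /orP[/eqP->|/eqP->]; rewrite ?eqxx//.
  by rewrite eq_sym (negbTE ij).
move=> H; split.
  by have := H i; rewrite /= !inE eqxx; exact.
by have := H j; rewrite /= !inE eqxx orbT eq_sym (negbTE ij); exact.
Qed.

Lemma iid_indicators n (B : nat -> set E) : (forall i, measurable (B i)) ->
  Ex P (fun t => \prod_(i < n) \1_(B i) (Zs i t)) =
  \prod_(i < n) Ex P (fun t => \1_(B i) (Zs i t)).
Proof.
move=> mB.
pose J : {fset nat} := [fset k | k in iota 0 n]%fset.
have memJ k : (k \in J) = (k < n)%N.
  by rewrite !inE/= mem_iota add0n.
have JE : perm_eq J (iota 0 n).
  by apply: uniq_perm => [||k]; rewrite ?fset_uniq ?iota_uniq// memJ mem_iota.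
have mI : measurable (\bigcap_(i in [set` J]) (Zs i @^-1` B i)).
  by apply: fin_bigcap_measurable => // i _; exact: measurable_preim.
have -> : (fun t => \prod_(i < n) \1_(B i) (Zs i t)) =
    \1_(\bigcap_(i in [set` J]) (Zs i @^-1` B i)) :> (T -> R).
  apply/funext => t; rewrite indicE; have [|] := boolP (t \in _).
    rewrite inE => tJ; rewrite big1// => i _; rewrite indicE mem_set//.
    by apply: tJ => /=; rewrite memJ.
  move=> tJ; have [i niB] : exists i : 'I_n, ~ B i (Zs i t).
    apply/not_existsP => H; move/negP : tJ; apply; rewrite inE => i /=.
    by rewrite memJ => ni; have := H (Ordinal ni) => /contrapT.
  by rewrite (bigD1 i)//= indicE memNset// mul0r.
rewrite Ex_indic// indZ// (perm_big _ JE)/=.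
rewrite -[in RHS](big_mkord xpredT (fun i => Ex P (fun t => \1_(B i) (Zs i t)))).
rewrite /index_iota subn0; elim: (iota 0 n) => [|k s IH]; first by rewrite !big_nil.
rewrite !big_cons fineM//; first last.
- elim: s {IH} => [|i s IH]; first by rewrite big_nil.
  by rewrite big_cons fin_numM// fin_num_measure//; exact: measurable_preim.
- by apply: fin_num_measure; exact: measurable_preim.
rewrite IH; congr (_ * _); rewrite -Ex_indic//; exact: measurable_preim.
Qed.

Lemma iid_integ (h : E -> R) i : measurable_fun [set: E] h ->
  integ P (fun t => h (Z t)) -> integ P (fun t => h (Zs i t)).
Proof. by move=> mh ih; apply/(same_law_integ (mZs i) mZ (lawZ i)). Qed.

Lemma iid_Ex (h : E -> R) i : measurable_fun [set: E] h ->
  integ P (fun t => h (Z t)) -> Ex P (fun t => h (Zs i t)) = Ex P (fun t => h (Z t)).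
Proof.
by move=> mh ih; apply: (same_law_Ex (mZs i) mZ (lawZ i)) => //; exact: iid_integ.
Qed.

Lemma integ_of_sqr (h : T -> R) : measurable_fun [set: T] h ->
  integ P (fun t => h t ^+ 2) -> integ P h.
Proof.
move=> mh ih; apply: (@integ_le _ _ _ P (fun t => 1 + h t ^+ 2)) => //.
  move=> t; rewrite -[h t ^+ 2]real_normK ?num_real//.
  by have := sqr_ge0 (`|h t| - 1); rewrite sqrrB expr1n mulr1; have := normr_ge0 (h t); nra.
by apply: integD => //; exact: integ_cst.
Qed.

Section second_order.
Variable h : E -> R.
Hypothesis mh : measurable_fun [set: E] h.
Hypothesis ih2 : integ P (fun t => h (Z t) ^+ 2).

Let mhZ i : measurable_fun [set: T] (fun t => h (Zs i t)).
Proof. exact: measurableT_comp (mZs i). Qed.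

Let ih : integ P (fun t => h (Z t)).
Proof. by apply: integ_of_sqr => //; exact: measurableT_comp mZ. Qed.

Let ihZ i : integ P (fun t => h (Zs i t)).
Proof. exact: iid_integ. Qed.

Let ihZ2 i : integ P (fun t => h (Zs i t) ^+ 2).
Proof. by apply: (iid_integ (h := fun x => h x ^+ 2)) => //; exact: measurable_funX. Qed.

Let ihZM i j : integ P (fun t => h (Zs i t) * h (Zs j t)).
Proof.
have [->|ij] := eqVneq i j.
  by under [X in EFin \o X]eq_fun do rewrite -expr2.
apply: integM_indep => //.
apply: (independent2_comp (X := Zs i) (Y := Zs j) mh mh).
exact: pairwise_independent.
Qed.

Hypothesis Eh0 : Ex P (fun t => h (Z t)) = 0.

Lemma integ_sqr_sum n : integ P (fun t => (\sum_(i < n) h (Zs i t)) ^+ 2).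
Proof.
under [X in EFin \o X]eq_fun do rewrite expr2 mulr_suml.
apply: integ_sum => i; under [X in EFin \o X]eq_fun do rewrite mulr_sumr.
by apply: integ_sum => j.
Qed.

(** The cross terms vanish by independence and centering. *)
Lemma Ex_sqr_sum n : Ex P (fun t => (\sum_(i < n) h (Zs i t)) ^+ 2) =
  n%:R * Ex P (fun t => h (Z t) ^+ 2).
Proof.
under eq_Rintegral do rewrite expr2 mulr_suml.
rewrite Ex_sum => [|i]; last first.
  under [X in EFin \o X]eq_fun do rewrite mulr_sumr.
  by apply: integ_sum => j.
rewrite (eq_bigr (fun=> Ex P (fun t => h (Z t) ^+ 2))).
  by rewrite sumr_const card_ord mulr_natl.
move=> i _; under eq_Rintegral do rewrite mulr_sumr.
rewrite Ex_sum// (bigD1 i)//= big1 ?addr0.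
  under eq_Rintegral do rewrite -expr2.
  by apply: (iid_Ex (h := fun x => h x ^+ 2)) => //; exact: measurable_funX.
move=> j ji; rewrite ExM_indep//; last first.
  apply: (independent2_comp (X := Zs i) (Y := Zs j) mh mh).
  by apply: pairwise_independent; rewrite eq_sym.
by rewrite iid_Ex// Eh0 mul0r.
Qed.

Let measurable_hsum n : measurable_fun [set: T] (fun t => \sum_(i < n) h (Zs i t)).
Proof. by apply: measurable_sum => i. Qed.

Lemma OP_normalized_sum :
  OP P (fun n t => (Num.sqrt n%:R)^-1 * \sum_(i < n) h (Zs i t)).
Proof.
apply: (@OP_second_moment _ _ _ _ _ (Ex P (fun t => h (Z t) ^+ 2))).
- by move=> n; apply: measurable_funM.
- move=> n; under [X in EFin \o X]eq_fun do rewrite exprMn.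
  exact/integZ/integ_sqr_sum.
- near=> n; under eq_Rintegral do rewrite exprMn.
  rewrite ExZ; last exact: integ_sqr_sum.
  rewrite Ex_sqr_sum exprVn sqr_sqrtr// mulKf//.
  by rewrite pnatr_eq0 -lt0n; near: n; exists 1%N.
Unshelve. all: by end_near. Qed.

Lemma oP_centered_mean : oP P (fun n t => n%:R^-1 * \sum_(i < n) h (Zs i t)).
Proof.
apply: oP_second_moment.
- by move=> n; apply: measurable_funM.
- move=> n; under [X in EFin \o X]eq_fun do rewrite exprMn.
  exact/integZ/integ_sqr_sum.
- apply: (@cvg0_le _ _ (fun n => Ex P (fun t => h (Z t) ^+ 2) / n%:R)); last first.
    exact: cvg_div_nat.
  near=> n; under eq_Rintegral do rewrite exprMn.
  rewrite ExZ; last exact: integ_sqr_sum.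
  have n0 : n%:R != 0 :> R.
    by rewrite pnatr_eq0 -lt0n; near: n; exists 1%N.
  rewrite Ex_sqr_sum exprVn expr2 invfM -mulrA mulKf// mulrC ger0_norm//.
  by rewrite divr_ge0// Ex_ge0// => t; exact: sqr_ge0.
Unshelve. all: by end_near. Qed.

End second_order.

Lemma weak_law (h : E -> R) : measurable_fun [set: E] h ->
  integ P (fun t => h (Z t) ^+ 2) ->
  oP P (fun n t => n%:R^-1 * \sum_(i < n) h (Zs i t) - Ex P (fun t => h (Z t))).
Proof.
move=> mh ih2; set m := Ex P _.
have ih : integ P (fun t => h (Z t)).
  by apply: integ_of_sqr => //; exact: measurableT_comp mZ.
have : oP P (fun n t => n%:R^-1 * \sum_(i < n) (h (Zs i t) - m)).
  apply: (oP_centered_mean (h := fun x => h x - m)).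
  - exact: measurable_funB.
  - under [X in EFin \o X]eq_fun do rewrite sqrrB.
    apply: integD; last exact: integ_cst.
    apply: integB => //; under [X in EFin \o X]eq_fun do rewrite -mulr_natl mulrA mulrAC.
    exact: integZ.
  - by rewrite ExB// ?Ex_cst ?subrr//; exact: integ_cst.
move=> H eta e eta0 e0; apply: whpS (H eta e eta0 e0).
near=> n; move=> t /=; rewrite sumrB sumr_const card_ord mulrBr -[m *+ n]mulr_natl.
rewrite mulKf// pnatr_eq0 -lt0n; near: n; exists 1%N => //.
Unshelve. all: by end_near. Qed.

End iid.

(** * The central limit theorem for characteristic functions *)

Section rotation_powers.
Context {R : realType}.
Variables (C D : nat -> R) (a b r : R).
Hypotheses (C0 : C 0%N = 1) (D0 : D 0%N = 0).
Hypothesis CS : forall j, C j.+1 = C j * a - D j * b.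
Hypothesis DS : forall j, D j.+1 = D j * a + C j * b.
Hypotheses (C1 : forall j, `|C j| <= 1) (D1 : forall j, `|D j| <= 1).
Hypotheses (a1 : `|a| <= 1) (r01 : 0 <= r <= 1).

(** The recursion is that of the real and imaginary parts of $(a + ib)^n$, and
    the bound is $|z^n - r^n| \le n |z - r|$ in real coordinates, valid as all powers
    stay in the unit disc. *)
Lemma rotation_powers_cos n : `|C n - r ^+ n| <= n%:R * (`|a - r| + `|b|).
Proof.
elim: n => [|n IH]; first by rewrite C0 expr0 subrr normr0 mul0r.
have -> : C n.+1 - r ^+ n.+1 = C n * (a - r) - D n * b + r * (C n - r ^+ n).
  by rewrite CS exprS; ring.
rewrite (le_trans (ler_normD _ _))// -natr1 mulrDl mul1r addrC lerD//.
  have /andP[r0 r1] := r01.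
  rewrite normrM (ger0_norm r0); apply: le_trans IH.
  by rewrite ler_piMl.
rewrite (le_trans (ler_normB _ _))// !normrM lerD//.
  by rewrite ler_piMl.
by rewrite ler_piMl.
Qed.

Lemma rotation_powers_sin n : `|D n| <= n%:R * `|b|.
Proof.
elim: n => [|n IH]; first by rewrite D0 normr0 mul0r.
rewrite DS (le_trans (ler_normD _ _))// !normrM -natr1 mulrDl mul1r lerD//.
  by apply: le_trans IH; rewrite ler_piMr.
by rewrite ler_piMl.
Qed.

End rotation_powers.

Lemma prod_ord_recl {R : realType} (F : nat -> R) k :
  \prod_(i < k.+1) F i = F 0%N * \prod_(i < k) F i.+1.
Proof. by rewrite big_ord_recl. Qed.

Section characteristic_function_of_sums.
Context {R : realType} {d d' : measure_display}.
Context {T : measurableType d} {E : measurableType d'}.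
Variables (P : probability T R) (Zs : nat -> T -> E) (Z : T -> E).
Hypotheses (mZs : forall i, measurable_fun [set: T] (Zs i))
           (mZ : measurable_fun [set: T] Z).
Hypothesis indZ : mutually_independent P Zs.
Hypothesis lawZ : forall i, same_law P (Zs i) Z.

(** Under expectation the bounded function [U] behaves as if it were independent
    of $Z_j, Z_{j+1}, \dots$ This form of independence is closed under differences and
    under multiplication by bounded functions of $Z_j$, so it can be propagated along
    partial sums without sigma-algebras. *)
Definition factors_from (j : nat) (U : T -> R) : Prop :=
  [/\ measurable_fun [set: T] U, exists K, forall t, `|U t| <= K &
   forall k (B : nat -> set E), (forall i, measurable (B i)) ->
     Ex P (fun t => U t * \prod_(i < k) \1_(B i) (Zs (j + i) t)) =
     Ex P U * \prod_(i < k) Ex P (fun t => \1_(B i) (Zs (j + i) t))].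

Let mindic (B : set E) i : measurable B ->
  measurable_fun [set: T] (fun t => \1_B (Zs i t) : R).
Proof. by move=> mB; exact: (measurableT_comp (measurable_indic mB) (mZs i)). Qed.

Let prod_indic_le1 k (B : nat -> set E) j t :
  `|\prod_(i < k) \1_(B i) (Zs (j + i) t) : R| <= 1.
Proof.
rewrite normr_prod; apply: prodr_ile1 => i _; rewrite normr_ge0 indicE.
by case: (_ \in _) => /=; rewrite ?normr1 ?normr0 ?ler01 ?lexx.
Qed.

Let mprod_indic k (B : nat -> set E) j : (forall i, measurable (B i)) ->
  measurable_fun [set: T] (fun t => \prod_(i < k) \1_(B i) (Zs (j + i) t) : R).
Proof. by move=> mB; apply: measurable_prod => i _; exact: mindic. Qed.

Lemma factors_from0 : factors_from 0 (fun=> 1).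
Proof.
split; [exact: measurable_cst|by exists 1 => t; rewrite normr1|move=> k B mB].
under eq_Rintegral do rewrite mul1r.
by rewrite Ex_cst mul1r (iid_indicators mZs indZ).
Qed.

Lemma factors_from_bounded j U : factors_from j U -> integ P U.
Proof. by case=> mU [K UK] _; exact: integ_bounded UK. Qed.

Lemma factors_fromB j U V : factors_from j U -> factors_from j V ->
  factors_from j (fun t => U t - V t).
Proof.
move=> fU fV; have iU := factors_from_bounded fU; have iV := factors_from_bounded fV.
have [mU [K UK] EU] := fU; have [mV [L VL] EV] := fV.
split; first exact: measurable_funB.
  by exists (K + L) => t; rewrite (le_trans (ler_normB _ _))// lerD.
move=> k B mB; under eq_Rintegral do rewrite mulrBl.
have ip (W : T -> R) M : measurable_fun setT W -> (forall t, `|W t| <= M) ->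
    integ P (fun t => W t * \prod_(i < k) \1_(B i) (Zs (j + i) t)).
  move=> mW WM; apply: (@integ_bounded _ _ _ _ _ M).
    by apply: measurable_funM => //; exact: mprod_indic.
  by move=> t; rewrite normrM (le_trans _ (WM t))// ler_piMr.
rewrite !ExB ?EU ?EV ?mulrBl//.
- exact: ip UK.
- exact: ip VL.
Qed.

(** The events of the later variables are put into the weight of
    [uncorrelated_bounded]; the hypothesis on [U] is then used with the full space or an
    arbitrary event in position [j]. *)
Lemma factors_from_step j U (g : E -> R) (K : R) : factors_from j U ->
  measurable_fun [set: E] g -> (forall x, `|g x| <= K) ->
  Ex P (fun t => U t * g (Zs j t)) = Ex P U * Ex P (fun t => g (Zs j t)) /\
  factors_from j.+1 (fun t => U t * g (Zs j t)).
Proof.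
move=> fU mg gK; have iU := factors_from_bounded fU; have [mU [L UL] EU] := fU.
have step k (B : nat -> set E) : (forall i, measurable (B i)) ->
    Ex P (fun t => U t * \prod_(i < k) \1_(B i) (Zs (j.+1 + i) t) * g (Zs j t)) =
    Ex P U * \prod_(i < k) Ex P (fun t => \1_(B i) (Zs (j.+1 + i) t)) *
    Ex P (fun t => g (Zs j t)).
  move=> mB.
  have EV : Ex P (fun t => U t * \prod_(i < k) \1_(B i) (Zs (j.+1 + i) t)) =
      Ex P U * \prod_(i < k) Ex P (fun t => \1_(B i) (Zs (j.+1 + i) t)).
    pose B' i := if i is i'.+1 then B i' else [set: E].
    have mB' i : measurable (B' i) by case: i => [|i]; [exact: measurableT|exact: mB].
    have := EU k.+1 B' mB'.
    rewrite (prod_ord_recl (fun i => Ex P (fun t => \1_(B' i) (Zs (j + i) t)))).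
    rewrite addn0 indicT/= Ex_cst mul1r.
    under [X in _ = _ * X -> _]eq_bigr do rewrite addnS -addSn.
    move=> <-; apply: eq_Rintegral => t _.
    rewrite (prod_ord_recl (fun i => \1_(B' i) (Zs (j + i) t))) indicT mul1r.
    by congr (_ * _); apply: eq_bigr => i _; rewrite /= addnS -addSn.
  rewrite -EV; apply: (uncorrelated_bounded (Z := Zs j)) gK => //.
    apply: (@integ_bounded _ _ _ _ _ L).
      by apply: measurable_funM => //; exact: mprod_indic.
    by move=> t; rewrite normrM (le_trans _ (UL t))// ler_piMr.
  move=> B0 mB0; rewrite EV.
  pose B' i := if i is i'.+1 then B i' else B0.
  have mB' i : measurable (B' i) by case: i => [|i] //; exact: mB.
  have := EU k.+1 B' mB'.
  rewrite (prod_ord_recl (fun i => Ex P (fun t => \1_(B' i) (Zs (j + i) t)))) addn0.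
  under [X in _ = _ * (_ * X) -> _]eq_bigr do rewrite addnS -addSn.
  rewrite [in X in _ = X -> _]mulrCA [in X in _ = X -> _]mulrC => <-.
  apply: eq_Rintegral => t _.
  rewrite (prod_ord_recl (fun i => \1_(B' i) (Zs (j + i) t))) addn0 -mulrA.
  congr (_ * _); rewrite mulrC; congr (_ * _).
  by apply: eq_bigr => i _; rewrite /= addnS -addSn.
have E1 : Ex P (fun t => U t * g (Zs j t)) = Ex P U * Ex P (fun t => g (Zs j t)).
  have := step 0%N (fun=> setT) (fun=> measurableT); rewrite big_ord0 mulr1 => <-.
  by apply: eq_Rintegral => t _; rewrite big_ord0 mulr1.
split=> //; split.
- by apply: measurable_funM => //; exact: measurableT_comp (mZs j).
- by exists (L * K) => t; rewrite normrM ler_pM.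
- move=> k B mB; rewrite E1 mulrAC -step//.
  by apply: eq_Rintegral => t _; rewrite mulrAC.
Qed.

Variable h : E -> R.
Hypothesis mh : measurable_fun [set: E] h.

Let S j t := \sum_(i < j) h (Zs i t).

Let mcos : measurable_fun [set: R] (@cos R).
Proof. exact: (continuous_measurable_fun (@continuous_cos R)). Qed.

Let msin : measurable_fun [set: R] (@sin R).
Proof. exact: (continuous_measurable_fun (@continuous_sin R)). Qed.

Let factors_cos_sin j : factors_from j (fun t => cos (S j t)) /\
  factors_from j (fun t => sin (S j t)).
Proof.
elim: j => [|j [IHc IHs]].
  have S0 t : S 0 t = 0 by rewrite /S big_ord0.
  split; first by rewrite (_ : (fun t => _) = fun=> 1);
    [exact: factors_from0|apply/funext => t; rewrite S0 cos0].
  have := factors_fromB factors_from0 factors_from0.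
  by rewrite subrr (_ : (fun t => sin _) = fun=> 0)//; apply/funext => t; rewrite S0 sin0.
have SS t : S j.+1 t = S j t + h (Zs j t) by rewrite /S big_ord_recr.
have mc : measurable_fun setT (fun x => cos (h x)) by exact: measurableT_comp.
have ms : measurable_fun setT (fun x => sin (h x)) by exact: measurableT_comp.
have [_ cc] := factors_from_step IHc mc (fun x => cos_max (h x)).
have [_ cs] := factors_from_step IHc ms (fun x => sin_max (h x)).
have [_ sc] := factors_from_step IHs mc (fun x => cos_max (h x)).
have [_ ss] := factors_from_step IHs ms (fun x => sin_max (h x)).
split.
  have := factors_fromB cc ss; congr factors_from.
  by apply/funext => t; rewrite SS cosD.
have zz := factors_fromB (factors_fromB cs cs) cs.
have := factors_fromB sc zz; congr factors_from.
by apply/funext => t; rewrite SS sinD; ring.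
Qed.

Let a := Ex P (fun t => cos (h (Z t))).
Let b := Ex P (fun t => sin (h (Z t))).

Let bounded_comp (f : R -> R) (g : T -> R) : measurable_fun [set: R] f ->
  (forall x, `|f x| <= 1) -> measurable_fun [set: T] g -> integ P (fun t => f (g t)).
Proof. by move=> mf f1 mg; apply: (@integ_bounded _ _ _ P _ 1) => //; exact: measurableT_comp. Qed.

(** Addition formulas and independence make the pair $(E\cos, E\sin)$ of a partial
    sum evolve like the powers of a complex number. *)
Lemma Ex_cos_sin_sum n (r : R) : 0 <= r <= 1 ->
  `|Ex P (fun t => cos (S n t)) - r ^+ n| <= n%:R * (`|a - r| + `|b|) /\
  `|Ex P (fun t => sin (S n t))| <= n%:R * `|b|.
Proof.
move=> r01.
have mS j : measurable_fun setT (S j).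
  by apply: measurable_sum => i; exact: measurableT_comp (mZs i).
pose C j := Ex P (fun t => cos (S j t)); pose D j := Ex P (fun t => sin (S j t)).
have C0 : C 0%N = 1.
  by rewrite /C -[RHS](Ex_cst P); apply: eq_Rintegral => t _; rewrite /S big_ord0 cos0.
have D0 : D 0%N = 0.
  by rewrite /D -[RHS](Ex_cst P); apply: eq_Rintegral => t _; rewrite /S big_ord0 sin0.
have iC j : integ P (fun t => cos (S j t)) by exact: bounded_comp (@cos_max R) _.
have iD j : integ P (fun t => sin (S j t)) by exact: bounded_comp (@sin_max R) _.
have mhZ j : measurable_fun setT (fun t => h (Zs j t)) by exact: measurableT_comp (mZs j).
have mc : measurable_fun setT (fun x => cos (h x)) by exact: measurableT_comp.
have ms : measurable_fun setT (fun x => sin (h x)) by exact: measurableT_comp.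
have ac j : Ex P (fun t => cos (h (Zs j t))) = a.
  apply: (iid_Ex mZs mZ lawZ j (h := fun x => cos (h x))) => //.
  by apply: (@bounded_comp _ (fun t => h (Z t))) => //; [exact: cos_max|exact: measurableT_comp mZ].
have bs j : Ex P (fun t => sin (h (Zs j t))) = b.
  apply: (iid_Ex mZs mZ lawZ j (h := fun x => sin (h x))) => //.
  by apply: (@bounded_comp _ (fun t => h (Z t))) => //; [exact: sin_max|exact: measurableT_comp mZ].
have iM (f g : R -> R) j : measurable_fun setT f -> measurable_fun setT g ->
    (forall x, `|f x| <= 1) -> (forall x, `|g x| <= 1) ->
    integ P (fun t => f (S j t) * g (h (Zs j t))).
  move=> mf mg f1 g1; apply: (@integ_bounded _ _ _ P _ 1).
    by apply: measurable_funM; exact: measurableT_comp.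
  by move=> t; rewrite normrM mulr_ile1.
have CS j : C j.+1 = C j * a - D j * b.
  have [fc fs] := factors_cos_sin j.
  have [e1 _] := factors_from_step fc mc (fun x => cos_max (h x)).
  have [e2 _] := factors_from_step fs ms (fun x => sin_max (h x)).
  rewrite /C /D -(ac j) -(bs j) -e1 -e2 -ExB; last 2 first.
  - by apply: iM => //; exact: cos_max.
  - by apply: iM => //; exact: sin_max.
  by apply: eq_Rintegral => t _; rewrite /S big_ord_recr/= cosD.
have DS j : D j.+1 = D j * a + C j * b.
  have [fc fs] := factors_cos_sin j.
  have [e1 _] := factors_from_step fs mc (fun x => cos_max (h x)).
  have [e2 _] := factors_from_step fc ms (fun x => sin_max (h x)).
  rewrite /C /D -(ac j) -(bs j) -e1 -e2 -ExD; last 2 first.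
  - by apply: iM => //; [exact: sin_max|exact: cos_max].
  - by apply: iM => //; [exact: cos_max|exact: sin_max].
  by apply: eq_Rintegral => t _; rewrite /S big_ord_recr/= sinD.
have C1 j : `|C j| <= 1 by apply: Ex_norm_bound => // t; exact: cos_max.
have D1 j : `|D j| <= 1 by apply: Ex_norm_bound => // t; exact: sin_max.
have a1 : `|a| <= 1 by rewrite -(ac 0%N); apply: Ex_norm_bound => [|t];
  [exact: bounded_comp (@cos_max R) _|exact: cos_max].
split; first exact: (rotation_powers_cos C0 CS).
exact: (rotation_powers_sin D0 DS).
Qed.

End characteristic_function_of_sums.

Section central_limit.
Context {R : realType} {d : measure_display} {T : measurableType d}.
Variable P : probability T R.

Section expansion.
Variable X : T -> R.
Hypotheses (mX : measurable_fun [set: T] X) (iX2 : integ P (fun t => X t ^+ 2)).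

Let mcos : measurable_fun [set: R] (@cos R).
Proof. exact: (continuous_measurable_fun (@continuous_cos R)). Qed.

Let msin : measurable_fun [set: R] (@sin R).
Proof. exact: (continuous_measurable_fun (@continuous_sin R)). Qed.

(** Dominated convergence with majorant $X^2$, so that second moments suffice. *)
Lemma Ex_cos_expansion :
  n%:R * (Ex P (fun t => cos ((Num.sqrt n%:R)^-1 * X t)) - 1) +
    Ex P (fun t => X t ^+ 2) / 2 @[n --> \oo] --> 0.
Proof.
pose f n t := n%:R * (cos ((Num.sqrt n%:R)^-1 * X t) - 1 +
  ((Num.sqrt n%:R)^-1 * X t) ^+ 2 / 2).
have fE : \forall n \near \oo, Ex P (f n) =
    n%:R * (Ex P (fun t => cos ((Num.sqrt n%:R)^-1 * X t)) - 1) +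
    Ex P (fun t => X t ^+ 2) / 2.
  near=> n; have n0 : n%:R != 0 :> R.
    by rewrite pnatr_eq0 -lt0n; near: n; exists 1%N.
  have ic : integ P (fun t => cos ((Num.sqrt n%:R)^-1 * X t)).
    apply: (@integ_bounded _ _ _ P _ 1); last by move=> t; exact: cos_max.
    by apply: measurableT_comp => //; exact: measurable_funM.
  rewrite -[X in _ * (_ - X)](Ex_cst P 1) -ExB//; last exact: integ_cst.
  rewrite -ExZ; last exact: (integB ic (integ_cst P 1)).
  rewrite [in RHS]mulrC -[X in _ + X]ExZ// -ExD; last 2 first.
  - exact: (integZ _ (integB ic (integ_cst P 1))).
  - exact: integZ.
  apply: eq_Rintegral => t _; rewrite /f mulrDr; congr (_ + _).
  by rewrite exprMn exprVn sqr_sqrtr//; field.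
have -> : (0 : R) = Ex P (fun=> 0) by rewrite Ex_cst.
have : Ex P (f n) @[n --> \oo] --> Ex P (fun=> 0).
  apply: (Ex_dominated_cvg (g := fun t => X t ^+ 2)) => //.
  - move=> n; apply: measurable_funM => //; apply: measurable_funD.
      apply: measurable_funB => //.
      by apply: measurableT_comp => //; exact: measurable_funM.
    by apply: measurable_funM => //; apply: measurable_funX; exact: measurable_funM.
  - move=> t; apply: (@cvg0_le _ _ (fun n => X t ^+ 4 / n%:R)); last exact: cvg_div_nat.
    near=> n; have n0 : n%:R != 0 :> R.
      by rewrite pnatr_eq0 -lt0n; near: n; exists 1%N.
    rewrite /f normrM ger0_norm// -ler_pdivlMl ?lt0r ?n0 ?ler0n//.
    apply: le_trans (cos_taylor _).1 _.
    rewrite exprMn (exprM (_^-1) 2 2) exprVn sqr_sqrtr//.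
    by rewrite le_eqVlt; apply/orP; left; apply/eqP; field.
  - move=> n t; have [->|n0] := eqVneq n 0%N.
      by rewrite /f mul0r normr0 sqr_ge0.
    rewrite /f normrM ger0_norm// -ler_pdivlMl ?ltr0n ?lt0n//.
    apply: le_trans (cos_taylor _).2 _.
    by rewrite exprMn exprVn sqr_sqrtr.
by apply: cvg_trans; apply: near_eq_cvg.
Unshelve. all: by end_near. Qed.

Hypothesis EX0 : Ex P X = 0.

Lemma Ex_sin_expansion :
  n%:R * Ex P (fun t => sin ((Num.sqrt n%:R)^-1 * X t)) @[n --> \oo] --> 0.
Proof.
have iX : integ P X by exact: integ_of_sqr.
pose f n t := n%:R * (sin ((Num.sqrt n%:R)^-1 * X t) - (Num.sqrt n%:R)^-1 * X t).
have fE n : Ex P (f n) = n%:R * Ex P (fun t => sin ((Num.sqrt n%:R)^-1 * X t)).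
  have ic : integ P (fun t => sin ((Num.sqrt n%:R)^-1 * X t)).
    apply: (@integ_bounded _ _ _ P _ 1); last by move=> t; exact: sin_max.
    by apply: measurableT_comp => //; exact: measurable_funM.
  rewrite ExZ; last by apply: integB => //; exact: integZ.
  by rewrite ExB//; [rewrite ExZ// EX0 mulr0 subr0|exact: integZ].
have -> : (0 : R) = Ex P (fun=> 0) by rewrite Ex_cst.
under eq_fun do rewrite -fE.
apply: (Ex_dominated_cvg (g := fun t => X t ^+ 2)) => //.
- move=> n; apply: measurable_funM => //; apply: measurable_funB => //.
    by apply: measurableT_comp => //; exact: measurable_funM.
  by apply: measurable_funM.
- move=> t; apply: (@cvg0_le _ _ (fun n => `|X t| ^+ 3 / Num.sqrt n%:R)).
    near=> n; have n0 : 0 < Num.sqrt n%:R :> R.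
      by rewrite sqrtr_gt0 ltr0n; near: n; exists 1%N.
    rewrite /f normrM ger0_norm//.
    apply: (le_trans (ler_wpM2l _ (sin_taylor _).1)) => //.
    rewrite normrM normfV (gtr0_norm n0) -{1}(@sqr_sqrtr _ n%:R)// exprMn.
    by rewrite le_eqVlt; apply/orP; left; apply/eqP; field; rewrite gt_eqF.
  exact: cvg_div_sqrt.
- move=> n t; have [->|n0] := eqVneq n 0%N.
    by rewrite /f mul0r normr0 sqr_ge0.
  rewrite /f normrM ger0_norm// -ler_pdivlMl ?ltr0n ?lt0n//.
  apply: le_trans (sin_taylor _).2 _.
  by rewrite exprMn exprVn sqr_sqrtr.
Unshelve. all: by end_near. Qed.

End expansion.

Lemma expRN_expansion (s : R) : 0 <= s ->
  n%:R * (expR (- (s / 2 / n%:R)) - 1) + s / 2 @[n --> \oo] --> 0.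
Proof.
move=> s0; apply: (@cvg0_le _ _ (fun n => (s / 2) ^+ 2 / n%:R)); last exact: cvg_div_nat.
near=> n; have n0 : 0 < n%:R :> R by rewrite ltr0n; near: n; exists 1%N.
have -> : n%:R * (expR (- (s / 2 / n%:R)) - 1) + s / 2 =
    n%:R * (expR (- (s / 2 / n%:R)) - 1 + s / 2 / n%:R).
  by field; rewrite gt_eqF.
rewrite normrM (gtr0_norm n0) -ler_pdivlMl//.
apply: le_trans (expRN_quadratic _) _; first by rewrite !divr_ge0.
by rewrite le_eqVlt; apply/orP; left; apply/eqP; field; rewrite gt_eqF.
Unshelve. all: by end_near. Qed.

Lemma power_limit_bound (a : nat -> R) (s : R) : 0 <= s ->
  n%:R * (a n - 1) + s / 2 @[n --> \oo] --> 0 ->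
  n%:R * `|a n - expR (- (s / 2 / n%:R))| @[n --> \oo] --> 0.
Proof.
move=> s0 a0; have := cvg_norm (cvgB a0 (expRN_expansion s0)); rewrite subr0 normr0.
move=> H; rewrite (_ : (fun n => _) = (fun n => `|n%:R * (a n - 1) + s / 2 -
  (n%:R * (expR (- (s / 2 / n%:R)) - 1) + s / 2)|)); first exact: H.
by apply/funext => n; rewrite -{1}[n%:R]ger0_norm// -normrM; congr (`|_|); ring.
Qed.

Lemma expR_power (s : R) n : (0 < n)%N ->
  expR (- (s / 2 / n%:R)) ^+ n = expR (- (s / 2)).
Proof.
move=> n0; rewrite -expRM_natl; congr expR; rewrite mulrN mulrC divfK//.
by rewrite pnatr_eq0 -lt0n.
Qed.

Context {d' : measure_display} {E : measurableType d'}.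
Variables (Zs : nat -> T -> E) (Z : T -> E).
Hypotheses (mZs : forall i, measurable_fun [set: T] (Zs i))
           (mZ : measurable_fun [set: T] Z).
Hypothesis indZ : mutually_independent P Zs.
Hypothesis lawZ : forall i, same_law P (Zs i) Z.
Variable h : E -> R.
Hypothesis mh : measurable_fun [set: E] h.
Hypothesis ih2 : integ P (fun t => h (Z t) ^+ 2).
Hypothesis Eh0 : Ex P (fun t => h (Z t)) = 0.
Let s := Ex P (fun t => h (Z t) ^+ 2).

(** Comparison of the $n$-th power with that of $e^{-s/(2n)}$, which differs from
    the characteristic function of a single summand by $o(1/n)$. *)
Theorem clt_characteristic_function :
  Ex P (fun t => cos ((Num.sqrt n%:R)^-1 * \sum_(i < n) h (Zs i t)))
    @[n --> \oo] --> expR (- (s / 2)) /\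
  Ex P (fun t => sin ((Num.sqrt n%:R)^-1 * \sum_(i < n) h (Zs i t)))
    @[n --> \oo] --> 0.
Proof.
have s0 : 0 <= s by apply: Ex_ge0 => t; exact: sqr_ge0.
have mhZ : measurable_fun setT (fun t => h (Z t)) by exact: measurableT_comp mZ.
pose a n := Ex P (fun t => cos ((Num.sqrt n%:R)^-1 * h (Z t))).
pose b n := Ex P (fun t => sin ((Num.sqrt n%:R)^-1 * h (Z t))).
pose r n := expR (- (s / 2 / n%:R)).
have na : n%:R * `|a n - r n| @[n --> \oo] --> 0.
  by apply: power_limit_bound => //; exact: Ex_cos_expansion.
have nb : n%:R * `|b n| @[n --> \oo] --> 0.
  have := cvg_norm (Ex_sin_expansion mhZ ih2 Eh0); rewrite normr0 => H.
  rewrite (_ : (fun n => _) = (fun n => `|n%:R * b n|)); first exact: H.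
  by apply/funext => n; rewrite normrM (@ger0_norm _ n%:R).
have mcs n : measurable_fun setT (fun x => (Num.sqrt n%:R)^-1 * h x).
  exact: measurable_funM.
have r01 n : 0 <= r n <= 1.
  by rewrite expR_ge0 -[leRHS]expR0 ler_expR oppr_le0 !divr_ge0.
have H n := Ex_cos_sin_sum mZs mZ indZ lawZ (mcs n) n (r01 n).
split.
  apply: cvg_near0; apply: (cvg0_le _ _ (v := fun n => n%:R * `|a n - r n| + n%:R * `|b n|)).
    near=> n; rewrite -(@expR_power s n); last by near: n; exists 1%N.
    have [+ _] := H n; rewrite mulrDr.
    by under eq_Rintegral do rewrite -mulr_sumr.
  by rewrite -[X in _ --> X](addr0 0); exact: cvgD.
apply: (cvg0_le _ nb); apply: nearW => n; have [_] := H n.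
by under eq_Rintegral do rewrite -mulr_sumr.
Unshelve. all: by end_near. Qed.

End central_limit.

(** * One-dimensional Gaussian laws *)

Section density.
Context {d : measure_display} {T : measurableType d} {R : realType}.
Variables (mu nu : {measure set T -> \bar R}) (g : T -> \bar R).
Hypotheses (mg : measurable_fun [set: T] g) (g0 : forall x, (0 <= g x)%E).
Hypothesis gfin : forall x, g x \is a fin_num.
Hypothesis nuE : forall A, measurable A -> nu A = (\int[mu]_(x in A) g x)%E.

Import HBNNSimple.

Let nnsfun_density (h : {nnsfun T >-> R}) :
  (\int[nu]_x (h x)%:E = \int[mu]_x ((h x)%:E * g x))%E.
Proof.
under eq_integral do rewrite fimfunE -fsumEFin//.
rewrite [LHS]ge0_integral_fsum//; last 2 first.
- by move=> r; exact/measurable_EFinP/measurableT_comp.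
- by move=> n x _; rewrite EFinM nnfun_muleindic_ge0.
under [RHS]eq_integral.
  move=> x _; rewrite fimfunE -fsumEFin// ge0_mule_fsuml; last first.
    by move=> r; rewrite EFinM nnfun_muleindic_ge0.
  over.
rewrite [RHS]ge0_integral_fsum//; last 2 first.
- move=> r; apply: emeasurable_funM => //.
  by apply/measurable_EFinP; exact: measurable_funM.
- by move=> n x _; rewrite mule_ge0// EFinM nnfun_muleindic_ge0.
apply: eq_fsbigr => r rh.
under [LHS]eq_integral do rewrite EFinM.
rewrite integralZl_indic_nnsfun// integral_indic// setIT.
under [RHS]eq_integral do rewrite EFinM -muleA.
rewrite ge0_integralZl//.
- rewrite nuE//; congr (_ * _)%E; rewrite integral_mkcond.
  apply: eq_integral => x _; rewrite patchE indicE; case: ifPn => xr.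
    by rewrite mul1e.
  by rewrite mul0e.
- by apply: emeasurable_funM => //; apply/measurable_EFinP.
- by move=> t _; rewrite mule_ge0 // lee_fin.
- by move: rh; rewrite inE => -[t _ <-]; rewrite lee_fin.
Qed.

(** True for simple functions, hence in the monotone limit. *)
Lemma ge0_integral_density (f : T -> \bar R) : measurable_fun [set: T] f ->
  (forall x, 0 <= f x)%E -> (\int[nu]_x f x = \int[mu]_x (f x * g x))%E.
Proof.
move=> mf f0; pose h := nnsfun_approx measurableT mf.
have hf x : (h n x)%:E @[n --> \oo] --> f x by exact: cvg_nnsfun_approx.
transitivity (limn (fun n => \int[nu]_x (h n x)%:E))%E.
  rewrite -monotone_convergence//.
  - by apply: eq_integral => x _; apply/esym/cvg_lim.
  - by move=> n; apply/measurable_EFinP.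
  - by move=> n x _; rewrite lee_fin.
  - by move=> x _ a b ab; rewrite lee_fin; exact/lefP/nd_nnsfun_approx.
under eq_fun do rewrite nnsfun_density.
rewrite -monotone_convergence//.
- apply: eq_integral => x _; apply/cvg_lim => //.
  by apply: cvgeZr; [exact: gfin|exact: hf].
- by move=> n; apply: emeasurable_funM => //; apply/measurable_EFinP.
- by move=> n x _; rewrite mule_ge0// lee_fin.
- move=> x _ a b ab; rewrite lee_wpmul2r// lee_fin; exact/lefP/nd_nnsfun_approx.
Qed.

End density.

Section gauss1.
Context {R : realType}.
Implicit Types (m s t c y : R) (B : set R).
Local Notation mu := (@lebesgue_measure R).
Local Notation N01 := (@normal_prob R 0 1).


Let affine y c : measurableTypeR R -> measurableTypeR R := fun t => y + t * c.

Let measurable_affine y c : measurable_fun [set: measurableTypeR R] (affine y c).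
Proof. by apply: measurable_funD => //; exact: measurable_funM. Qed.

(** The right-hand side is a measure in [B] that agrees with Lebesgue measure on
    intervals. *)
Lemma lebesgue_measure_affine y c B : c != 0 -> measurable B ->
  mu B = (`|c|%:E * mu (affine y c @^-1` B))%E.
Proof.
move=> c0 mB; have mphi := measurable_affine y c.
pose nu := mscale (NngNum (normr_ge0 c)) (pushforward mu (affine y c)).
rewrite -[RHS]/(nu mphi B).
apply: (@lebesgue_measure_unique R (nu mphi)) => // _ [[a b]] _ <-.
rewrite /nu /mscale /pushforward /= lebesgue_measure_itv/= lte_fin.
have [cp|cn|c00] := ltrgtP 0 c; last by rewrite -c00 eqxx in c0.
- rewrite [X in _ = (_ * mu X)%E](_ : _ = `]((a - y) / c), ((b - y) / c)]%classic); last first.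
    apply/seteqP; split => t /=; rewrite /affine !in_itv/=.
      by rewrite ltr_pdivrMr// ler_pdivlMr// ltrBlDl lerBrDl.
    by rewrite ltr_pdivrMr// ler_pdivlMr// ltrBlDl lerBrDl.
  rewrite lebesgue_measure_itv/= lte_fin ltr_pM2r ?invr_gt0// ltrD2r (gtr0_norm cp).
  case: ifP => _; last by rewrite mule0.
  by rewrite -!EFinD -EFinM; congr EFin; field.
- rewrite [X in _ = (_ * mu X)%E](_ : _ = `[((b - y) / c), ((a - y) / c)[%classic); last first.
    apply/seteqP; split => t /=; rewrite /affine !in_itv/=.
      by rewrite ltr_ndivlMr// ler_ndivrMr// ltrBlDl lerBrDl andbC.
    by rewrite ltr_ndivlMr// ler_ndivrMr// ltrBlDl lerBrDl andbC.
  rewrite lebesgue_measure_itv/= lte_fin ltr_nM2r ?invr_lt0// ltrD2r (ltr0_norm cn).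
  case: ifP => _; last by rewrite mule0.
  by rewrite -!EFinD -EFinM; congr EFin; field.
Qed.

Lemma ge0_integral_affine y c (f : R -> \bar R) : c != 0 ->
  measurable_fun [set: R] f -> (forall x, 0 <= f x)%E ->
  (\int[mu]_x f x = `|c|%:E * \int[mu]_t f (y + t * c)%R)%E.
Proof.
move=> c0 mf f0; have mphi := measurable_affine y c.
have := @ge0_integral_pushforward _ _ _ _ R _ mphi mu setT f measurableT mf (fun x _ => f0 x).
rewrite preimage_setT => <-.
have <- := ge0_integral_mscale (pushforward mu (affine y c)) measurableT
  (NngNum (normr_ge0 c)) mf (fun x _ => f0 x).
apply: eq_measure_integral => A mA _ /=.
by rewrite (lebesgue_measure_affine y c0 mA).
Qed.

Lemma normal_pdf_std_affine y c t : c != 0 ->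
  `|c| * normal_pdf y `|c| (y + t * c) = normal_pdf 0 1 t.
Proof.
move=> c0; rewrite !normal_pdfE ?normr_eq0 ?oner_neq0//.
rewrite mulrA; congr (_ * _).
  rewrite /normal_peak real_normK ?num_real// expr1n mul1r -mulrnAr.
  by rewrite sqrtrM ?sqr_ge0// sqrtr_sqr invfM mulVKf// normr_eq0.
rewrite /normal_fun; congr expR; rewrite real_normK ?num_real// expr1n subr0.
by rewrite [y + _]addrC addrK exprMn; field.
Qed.

(** Every law [gauss1], the point masses included, is an affine image of the
    standard normal law; statements about [gauss1] can thus avoid its case distinction. *)
Lemma gauss1_affine y c B : measurable B ->
  N01 ((fun t => y + t * c) @^-1` B) = gauss1 y (c ^+ 2) B.
Proof.
move=> mB; rewrite /gauss1 sqrf_eq0; case: eqVneq => [->|c0].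
  rewrite diracE; have [yB|yB] := boolP (y \in B).
    rewrite (_ : _ @^-1` _ = setT) ?probability_setT//.
    by apply/seteqP; split => // t _ /=; rewrite mulr0 addr0; exact: set_mem.
  rewrite (_ : _ @^-1` _ = set0) ?measure0//.
  by apply/seteqP; split => // t /=; rewrite mulr0 addr0 => /mem_set; rewrite (negbTE yB).
rewrite sqrtr_sqr /normal_prob integral_mkcond [RHS]integral_mkcond.
have mg (p : R -> R) : measurable_fun setT p ->
    measurable_fun setT ((fun x => (p x)%:E) \_ B).
  by move=> mp; apply/(measurable_restrictT _ mB); apply/measurable_EFinP; exact: measurable_funTS.
rewrite [RHS](ge0_integral_affine y c0)//; first last.
- by move=> x; rewrite patchE; case: ifP => // _; rewrite lee_fin normal_pdf_ge0.
- exact: (mg _ (measurable_normal_pdf _ _)).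
rewrite -ge0_integralZl//; first last.
- by move=> t _; rewrite patchE; case: ifP => // _; rewrite lee_fin normal_pdf_ge0.
- apply: measurableT_comp; first exact: (mg _ (measurable_normal_pdf _ _)).
  exact: measurable_affine.
apply: eq_integral => t _; rewrite !patchE.
rewrite (_ : (t \in _) = (y + t * c \in B)); last by apply/idP/idP; rewrite !inE.
by case: ifP => _; [rewrite -EFinM normal_pdf_std_affine|rewrite mule0].
Qed.

(** Completing the square in [x]. *)
Lemma normal_pdf_mul s t x z : s != 0 -> t != 0 -> 0 < s -> 0 < t ->
  normal_pdf x t z * normal_pdf 0 s x =
  normal_pdf 0 (Num.sqrt (s ^+ 2 + t ^+ 2)) z *
  normal_pdf (z * s ^+ 2 / (s ^+ 2 + t ^+ 2)) (s * t / Num.sqrt (s ^+ 2 + t ^+ 2)) x.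
Proof.
move=> s0 t0 sp tp.
have s2 : 0 < s ^+ 2 by rewrite exprn_gt0.
have t2 : 0 < t ^+ 2 by rewrite exprn_gt0.
have st2 : 0 < s ^+ 2 + t ^+ 2 by rewrite addr_gt0.
have r0 : 0 < Num.sqrt (s ^+ 2 + t ^+ 2) by rewrite sqrtr_gt0.
rewrite !normal_pdfE ?gt_eqF ?divr_gt0 ?mulr_gt0//.
rewrite mulrACA [RHS]mulrACA; congr (_ * _).
  have pk (u : R) : 0 <= u ^+ 2 * pi *+ 2.
    by apply: mulrn_wge0; apply: mulr_ge0; [exact: sqr_ge0|exact: pi_ge0].
  rewrite /normal_peak -!invfM -!(sqrtrM _ (pk _)).
  congr (Num.sqrt _)^-1; rewrite !exprMn exprVn sqr_sqrtr ?(ltW st2)//.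
  by field; rewrite gt_eqF.
rewrite /normal_fun -!expRD; congr expR.
rewrite !exprMn exprVn sqr_sqrtr ?(ltW st2)//.
by field; rewrite !gt_eqF.
Qed.

End gauss1.

Section gaussian.
Context {R : realType}.
Implicit Types (m s t c y : R) (B : set R).
Local Notation mu := (@lebesgue_measure R).
Local Notation N01 := (@normal_prob R 0 1).

Lemma ge0_integral_normal_prob m s (f : R -> \bar R) :
  measurable_fun [set: R] f -> (forall x, 0 <= f x)%E ->
  (\int[normal_prob m s]_x f x = \int[mu]_x (f x * (normal_pdf m s x)%:E))%E.
Proof.
move=> mf f0.
apply: (@ge0_integral_density _ _ R mu (normal_prob m s)
  (fun x => (normal_pdf m s x)%:E)) => //.
- by apply/measurable_EFinP; exact: measurable_normal_pdf.
- by move=> x; rewrite lee_fin normal_pdf_ge0.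
Qed.

Let measurable_normal_pdf2 t : t != 0 ->
  measurable_fun [set: R * R] (fun xz : R * R => normal_pdf xz.1 t xz.2).
Proof.
move=> t0; rewrite (_ : (fun _ => _) = (fun xz : R * R => normal_pdf 0 t (xz.2 - xz.1))).
  apply: (measurableT_comp (measurable_normal_pdf 0 t)).
  by apply: measurable_funB; [exact: measurable_snd|exact: measurable_fst].
apply/funext => xz; rewrite !normal_pdfE//; congr (_ * _).
by rewrite normal_fun_center.
Qed.

Lemma measurable_gauss1_mean c B : measurable B ->
  measurable_fun [set: R] (fun y => gauss1 y (c ^+ 2) B).
Proof.
move=> mB; have mphi : measurable_fun setT (fun yt : R * R => yt.1 + yt.2 * c).
  apply: measurable_funD; first exact: measurable_fst.
  by apply: measurable_funM => //; exact: measurable_snd.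
rewrite (_ : (fun y => _) = (fun y => N01 (xsection ((fun yt : R * R => yt.1 + yt.2 * c) @^-1` B) y))).
  apply: measurable_fun_xsection; rewrite -[X in measurable X]setTI; exact: mphi.
apply/funext => y; rewrite -gauss1_affine//; congr N01.
by apply/seteqP; split => t /=; rewrite /xsection/= inE.
Qed.

Let normal_conv s t B : 0 < s -> 0 < t -> measurable B ->
  (\int[normal_prob 0 s]_y normal_prob y t B =
   normal_prob 0 (Num.sqrt (s ^+ 2 + t ^+ 2)) B)%E.
Proof.
move=> sp tp mB; have s0 := lt0r_neq0 sp; have t0 := lt0r_neq0 tp.
have mF : measurable_fun [set: R] (fun y => normal_prob y t B).
  have := measurable_gauss1_mean t mB; congr (measurable_fun _ _).
  by apply/funext => y; rewrite /gauss1 sqrf_eq0 (negbTE t0) sqrtr_sqr gtr0_norm.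
rewrite ge0_integral_normal_prob//.
pose G (yz : R * R) := ((normal_pdf yz.1 t yz.2 * normal_pdf 0 s yz.1) * \1_B yz.2)%:E.
have mG : measurable_fun setT G.
  apply/measurable_EFinP; apply: measurable_funM; first apply: measurable_funM.
  - exact: measurable_normal_pdf2.
  - exact: (measurableT_comp (measurable_normal_pdf 0 s) measurable_fst).
  - exact: (measurableT_comp (measurable_indic mB) measurable_snd).
have G0 yz : (0 <= G yz)%E.
  by rewrite lee_fin !mulr_ge0 ?normal_pdf_ge0// indicE.
transitivity (\int[mu]_y \int[mu]_z G (y, z))%E.
  apply: eq_integral => y _; rewrite /normal_prob integral_mkcond.
  rewrite -ge0_integralZr//; last 3 first.
  - apply/(measurable_restrictT _ mB)/measurable_EFinP/measurable_funTS.
    exact: measurable_normal_pdf.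
  - by move=> z _; rewrite patchE; case: ifP => // _; rewrite lee_fin normal_pdf_ge0.
  - by rewrite lee_fin normal_pdf_ge0.
  apply: eq_integral => z _; rewrite patchE /G/= indicE.
  by case: ifP => _; rewrite ?mulr1 ?mulr0 ?mul0e ?EFinM.
rewrite (fubini_tonelli (m1 := mu) (m2 := mu) G mG G0)/=.
rewrite [RHS]/normal_prob [RHS]integral_mkcond; apply: eq_integral => z _.
set r := Num.sqrt _.
rewrite /G patchE/= indicE; case: ifP => _; last first.
  by under eq_integral do rewrite mulr0; rewrite integral0.
under eq_integral do rewrite mulr1 normal_pdf_mul// EFinM.
rewrite ge0_integralZl//.
- by rewrite integral_normal_pdf mule1.
- by apply/measurable_EFinP; exact: measurable_normal_pdf.
- by move=> x _; rewrite lee_fin normal_pdf_ge0.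
- by rewrite lee_fin normal_pdf_ge0.
Qed.

(** By [normal_pdf_mul] the inner integral is over a normal density in the mean
    variable and equals one; if one of the variances vanishes, a law is a point mass. *)
Lemma gauss1_convolution (Q : {measure set (measurableTypeR R) -> \bar R}) s c B : 0 <= s ->
  (forall D, measurable D -> Q D = gauss1 0 s D) -> measurable B ->
  (\int[Q]_y gauss1 y (c ^+ 2) B = gauss1 0 (s + c ^+ 2) B)%E.
Proof.
move=> s0 QE mB.
have [->|c0] := eqVneq c 0.
  rewrite expr0n/= addr0 -QE// -[in RHS](setIT B) -integral_indic//.
  apply: eq_integral => y _; rewrite /gauss1 eqxx diracE indicE.
  by case: (_ \in _).
have [s00|sn0] := eqVneq s 0.
  rewrite (eq_measure_integral (\d_(0 : measurableTypeR R))); last first.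
    by move=> A mA _; rewrite QE// /gauss1 s00 eqxx.
  by rewrite integral_dirac ?diracT ?mul1e ?s00 ?add0r//; exact: measurable_gauss1_mean.
have sp : 0 < s by rewrite lt_def sn0.
transitivity (\int[normal_prob 0 (Num.sqrt s)]_y gauss1 y (c ^+ 2) B)%E.
  apply: (@eq_measure_integral _ (measurableTypeR R) R setT (normal_prob 0 (Num.sqrt s)) Q) => A mA _.
  by rewrite QE// /gauss1 (negbTE sn0).
have c20 : c ^+ 2 != 0 by rewrite sqrf_eq0.
have scp : 0 < s + c ^+ 2 by rewrite ltr_wpDr ?sqr_ge0.
under eq_integral do rewrite /gauss1 (negbTE c20) sqrtr_sqr.
have sq0 : 0 < Num.sqrt s by rewrite sqrtr_gt0.
have cn0 : 0 < `|c| by rewrite normr_gt0.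
have e : Num.sqrt s ^+ 2 + `|c| ^+ 2 = s + c ^+ 2.
  by rewrite sqr_sqrtr ?(ltW sp)// real_normK ?num_real.
rewrite /gauss1 (gt_eqF scp) (normal_conv sq0 cn0 mB) e.
exact: erefl.
Qed.

(** Up to a constant, the integrand times the standard normal density is the normal
    density of variance $1/(1-\theta)$. *)
Lemma normal_exp_sqr (th : R) : th < 1 ->
  (\int[N01]_x (expR (th * x ^+ 2 / 2))%:E = (Num.sqrt (1 - th))^-1%:E)%E.
Proof.
move=> th1; have th0 : 0 < 1 - th by rewrite subr_gt0.
pose s := (Num.sqrt (1 - th))^-1.
have s0 : 0 < s by rewrite invr_gt0 sqrtr_gt0.
have mexp : measurable_fun setT (fun x : R => expR (th * x ^+ 2 / 2)).
  apply: measurableT_comp => //; apply: measurable_funM => //.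
  by apply: measurable_funM => //; exact: measurable_funX.
rewrite ge0_integral_normal_prob; last 2 first.
- exact/measurable_EFinP.
- by move=> x; rewrite lee_fin expR_ge0.
transitivity (s%:E * \int[mu]_x (normal_pdf 0 s x)%:E)%E; last first.
  by rewrite integral_normal_pdf mule1.
rewrite -ge0_integralZl; last 4 first.
- exact: measurableT.
- by apply/measurable_EFinP; exact: measurable_normal_pdf.
- by move=> x _; rewrite lee_fin normal_pdf_ge0.
- by rewrite lee_fin ltW.
apply: eq_integral => x _; rewrite -!EFinM; congr EFin.
rewrite !normal_pdfE ?oner_neq0 ?gt_eqF// mulrCA [RHS]mulrA; congr (_ * _).
  rewrite /normal_peak expr1n mul1r -mulrnAr sqrtrM ?sqr_ge0//.
  by rewrite sqrtr_sqr gtr0_norm// invfM mulVKf ?gt_eqF.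
rewrite /normal_fun -expRD; congr expR.
rewrite /s exprVn sqr_sqrtr ?(ltW th0)// expr1n subr0.
by field; rewrite gt_eqF.
Qed.

Let m2 := Ex N01 (fun x => x ^+ 2).

Let integ_exp (th : R) : th < 1 -> integ N01 (fun x => expR (th * x ^+ 2 / 2)).
Proof.
move=> th1; apply/integrableP; split.
  apply/measurable_EFinP; apply: measurableT_comp => //; apply: measurable_funM => //.
  by apply: measurable_funM => //; exact: measurable_funX.
under eq_integral do rewrite /= ger0_norm ?expR_ge0//.
by rewrite normal_exp_sqr// ltry.
Qed.

Lemma integ_normal_sqr : integ N01 (fun x => x ^+ 2).
Proof.
have h : (1 / 2 : R) < 1 by lra.
apply: (integ_le _ _ (integZ 4 (integ_exp h))); first exact: measurable_funX.
move=> x; rewrite ger0_norm ?sqr_ge0//.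
by have := expR_ge1Dx (1 / 2 * x ^+ 2 / 2); lra.
Qed.

(** $1 + u \le e^u$ with $u = \theta x^2 / 2$ bounds the second moment from both
    sides by the explicit exponential moments. *)
Lemma normal_sqr_Ex : Ex N01 (fun x => x ^+ 2) = 1.
Proof.
rewrite -/m2.
have m20 : 0 <= m2 by apply: Ex_ge0 => x; exact: sqr_ge0.
have key (th : R) : th < 1 -> 0 <= 1 + th * m2 / 2 ->
    (1 + th * m2 / 2) ^+ 2 * (1 - th) <= 1.
  move=> th1 pos; have th0 : 0 < 1 - th by rewrite subr_gt0.
  have le1 : 1 + th * m2 / 2 <= (Num.sqrt (1 - th))^-1.
    have -> : (Num.sqrt (1 - th))^-1 = Ex N01 (fun x => expR (th * x ^+ 2 / 2)).
      by rewrite /Rintegral normal_exp_sqr.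
    have -> : 1 + th * m2 / 2 = Ex N01 (fun x => 1 + th / 2 * x ^+ 2).
      rewrite ExD ?Ex_cst ?ExZ//; last 3 first.
      - exact: integ_normal_sqr.
      - exact: integ_cst.
      - exact/integZ/integ_normal_sqr.
      by rewrite /m2; ring.
    apply: Ex_le; [|exact: integ_exp|].
      by apply: integD; [exact: integ_cst|exact/integZ/integ_normal_sqr].
    by move=> x; have := expR_ge1Dx (th * x ^+ 2 / 2); lra.
  rewrite -ler_pdivlMr// mul1r -[X in _ <= X^-1](sqr_sqrtr (ltW th0)) -exprVn.
  by rewrite ler_sqr ?nnegrE// invr_ge0 sqrtr_ge0.
apply: le_anti; apply/andP; split; rewrite leNgt; apply/negP => m1.
  (* to first order in [th], [key] says [th * (m2 - 1) <= 0]; this [th] is small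
     enough to absorb the second-order terms *)
  pose th := (m2 - 1) / (2 * (m2 + m2 ^+ 2)).
  have D0 : 0 < 2 * (m2 + m2 ^+ 2) by rewrite mulr_gt0// ltr_wpDr ?sqr_ge0//; lra.
  have thE : th * (2 * (m2 + m2 ^+ 2)) = m2 - 1 by rewrite /th divfK// gt_eqF.
  have th0 : 0 < th by rewrite divr_gt0// subr_gt0.
  have th1 : th < 1 by rewrite ltr_pdivrMr//; nra.
  have := key th th1; have : 0 <= 1 + th * m2 / 2 by nra.
  move=> h /(_ h); nra.
pose th := (1 - m2) / 2.
have th0 : 0 < th by rewrite divr_gt0// subr_gt0.
have th1 : th < 1 by rewrite /th; lra.
have thE : m2 = 1 - 2 * th by rewrite /th; field.
have h : 0 <= 1 + - th * m2 / 2 by nra.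
have := key (- th) _ h; rewrite thE in m20 *.
have -> : - th < 1 by lra.
move=> /(_ isT).
have -> : (1 + - th * (1 - 2 * th) / 2) ^+ 2 * (1 - - th) =
    1 + th ^+ 2 + 2 * th ^+ 3 + (th / 2 - th ^+ 2) ^+ 2 * (1 + th) by field.
have e1 : 0 < th ^+ 2 by rewrite exprn_gt0.
have e2 : 0 < th ^+ 3 by rewrite exprn_gt0.
have e3 : 0 <= (th / 2 - th ^+ 2) ^+ 2 * (1 + th).
  by rewrite mulr_ge0 ?sqr_ge0// addr_ge0// ltW.
by lra.
Qed.

Lemma normal_law_scale (f : R -> R) u (Q : {measure set (measurableTypeR R) -> \bar R}) :
  (forall D, measurable D -> Q D = gauss1 0 (u ^+ 2) D) ->
  integ Q f -> Ex Q f = Ex N01 (fun x => f (u * x)).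
Proof.
move=> QE iQ.
have maff : measurable_fun [set: measurableTypeR R]
    ((fun x => 0 + x * u) : measurableTypeR R -> measurableTypeR R).
  by apply: measurable_funD => //; exact: measurable_funM.
rewrite (Ex_law (P := N01) maff _ iQ)//.
  by apply: eq_Rintegral => x _; rewrite add0r mulrC.
by move=> B mB; rewrite QE// -gauss1_affine.
Qed.

Section independent_noise.
Context {d : measure_display} {T : measurableType d} (P : probability T R).
Variable f : T -> R.
Hypothesis mf : measurable_fun [set: T] f.

(** Fubini and [gauss1_convolution]. *)
Lemma gauss1_add_noise s c : 0 <= s ->
  (forall D, measurable D -> P (f @^-1` D) = gauss1 0 s D) ->
  forall D, measurable D ->
  (P \x N01)%E ((fun xt => f xt.1 + xt.2 * c) @^-1` D) = gauss1 0 (s + c ^+ 2) D.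
Proof.
move=> s0 lawf D mD.
have mf' : measurable_fun [set: T] (f : T -> measurableTypeR R) by [].
rewrite -(@gauss1_convolution (pushforward P (f : T -> measurableTypeR R))
  s c D s0 lawf mD).
rewrite (ge0_integral_law (P := P) mf').
- rewrite /product_measure1; apply: eq_integral => x _.
  rewrite -gauss1_affine//; congr N01.
  by apply/seteqP; split => t /=; rewrite /xsection/= inE.
- by [].
- exact: measurable_gauss1_mean.
- move=> y; rewrite -gauss1_affine//; exact: measure_ge0.
Qed.

End independent_noise.

Let mcos : measurable_fun [set: R] (@cos R).
Proof. exact: (continuous_measurable_fun (@continuous_cos R)). Qed.

Let msin : measurable_fun [set: R] (@sin R).
Proof. exact: (continuous_measurable_fun (@continuous_sin R)). Qed.

Let phi u := Ex N01 (fun x => cos (u * x)).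

Let mul_measurable u : measurable_fun [set: measurableTypeR R] (fun x : measurableTypeR R => u * x).
Proof. exact: measurable_funM. Qed.

Let normal_sin u : Ex N01 (fun x => sin (u * x)) = 0.
Proof.
have i1 v : integ N01 (fun x => sin (v * x)).
  apply: (@integ_bounded _ _ _ _ _ 1) => [|x]; last exact: sin_max.
  exact: measurableT_comp.
have := @normal_law_scale (fun x => sin (u * x)) (-1) N01.
rewrite sqrrN expr1n /gauss1 oner_eq0 sqrtr1 => /(_ (fun _ _ => erefl) (i1 u)).
under [X in _ = X -> _]eq_Rintegral do rewrite mulN1r mulrN sinN -mulN1r.
by rewrite ExZ//; lra.
Qed.

(** Addition formula and independence; the sine part vanishes by symmetry. *)
Let phiM a b : phi (Num.sqrt (a ^+ 2 + b ^+ 2)) = phi a * phi b.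
Proof.
pose f (x : measurableTypeR R) : measurableTypeR R := 0 + x * a.
have mf : measurable_fun setT f.
  by apply: measurable_funD => //; exact: measurable_funM.
have lawf D : measurable D -> N01 (f @^-1` D) = gauss1 0 (a ^+ 2) D.
  exact: gauss1_affine.
have law := gauss1_add_noise mf b (sqr_ge0 a) lawf.
pose P2 : probability (measurableTypeR R * measurableTypeR R)%type R := (N01 \x N01)%E.
pose g (xt : measurableTypeR R * measurableTypeR R) : measurableTypeR R := f xt.1 + xt.2 * b.
have mg : measurable_fun setT g.
  apply: measurable_funD; first exact: (measurableT_comp mf measurable_fst).
  by apply: measurable_funM => //; exact: measurable_snd.
have P2E A B : measurable A -> measurable B -> (P2 (A `*` B) = N01 A * N01 B)%E.
  by move=> mA mB; exact: (product_measure1E N01 N01 mA mB).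
have ind : independent2 P2 fst snd.
  move=> A B mA mB.
  rewrite (_ : fst @^-1` A `&` snd @^-1` B = A `*` B)//.
  rewrite (_ : fst @^-1` A = A `*` setT); last by apply/seteqP; split => -[x y]//= [].
  rewrite (_ : snd @^-1` B = setT `*` B); last by apply/seteqP; split => -[x y]//= [].
  rewrite !P2E//.
  by rewrite (probability_setT N01) mule1 mul1e.
have ib (h : R -> R) v (p : measurableTypeR R * measurableTypeR R -> measurableTypeR R) :
    measurable_fun setT h -> (forall x, `|h x| <= 1) -> measurable_fun setT p ->
    integ P2 (fun xt => h (v * p xt)).
  move=> mh h1 mp; apply: (@integ_bounded _ _ _ P2 _ 1) => [|x]; last exact: h1.
  by apply: measurableT_comp => //; exact: measurable_funM.
have indc (h k : R -> R) : measurable_fun setT h -> measurable_fun setT k ->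
    independent2 P2 (fun xt => h (a * xt.1)) (fun xt => k (b * xt.2)).
  move=> mh mk.
  apply: (independent2_comp (f := fun x => h (a * x)) (g := fun x => k (b * x))) ind.
    exact: measurableT_comp.
  exact: measurableT_comp.
have fstE (h : R -> R) : integ N01 h -> Ex P2 (fun xt => h xt.1) = Ex N01 h.
  move=> ih; rewrite -(Ex_law (P := P2) measurable_fst _ ih)//.
  move=> B mB; rewrite (_ : fst @^-1` B = B `*` setT); last by apply/seteqP; split => -[x y]//= [].
  by rewrite P2E// (probability_setT N01) mule1.
have sndE (h : R -> R) : integ N01 h -> Ex P2 (fun xt => h xt.2) = Ex N01 h.
  move=> ih; rewrite -(Ex_law (P := P2) measurable_snd _ ih)//.
  move=> B mB; rewrite (_ : snd @^-1` B = setT `*` B); last by apply/seteqP; split => -[x y]//= [].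
  by rewrite P2E// (probability_setT N01) mul1e.
have iN (h : R -> R) v : measurable_fun setT h -> (forall x, `|h x| <= 1) ->
    integ N01 (fun x => h (v * x)).
  move=> mh h1; apply: (@integ_bounded _ _ _ N01 _ 1) => [|x]; last exact: h1.
  exact: measurableT_comp.
have iQ : integ (pushforward P2 g) (@cos R).
  apply: (@integ_bounded _ _ _ (distribution P2 (HB.pack g (isMeasurableFun.Build _ _ _ _ _ mg) : {mfun _ >-> _})) _ 1) => // x.
  exact: cos_max.
have <- : Ex P2 (fun xt => cos (g xt)) = phi (Num.sqrt (a ^+ 2 + b ^+ 2)).
  rewrite -(Ex_law (P := P2) mg _ iQ)//.
  have st : Num.sqrt (a ^+ 2 + b ^+ 2) ^+ 2 = a ^+ 2 + b ^+ 2.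
    by rewrite sqr_sqrtr// addr_ge0 ?sqr_ge0.
  have lawQ D : measurable D ->
      pushforward P2 g D = gauss1 0 (Num.sqrt (a ^+ 2 + b ^+ 2) ^+ 2) D.
    by move=> mD; rewrite st; exact: law.
  exact: normal_law_scale lawQ iQ.
have ic1 := ib cos a fst mcos (@cos_max R) measurable_fst.
have ic2 := ib cos b snd mcos (@cos_max R) measurable_snd.
have is1 := ib sin a fst msin (@sin_max R) measurable_fst.
have is2 := ib sin b snd msin (@sin_max R) measurable_snd.
have indcc := indc cos cos mcos mcos; have indss := indc sin sin msin msin.
have -> : Ex P2 (fun xt => cos (g xt)) =
    Ex P2 (fun xt => cos (a * xt.1) * cos (b * xt.2)) -
    Ex P2 (fun xt => sin (a * xt.1) * sin (b * xt.2)).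
  rewrite -(ExB (integM_indep ic1 ic2 indcc) (integM_indep is1 is2 indss)).
  by apply: eq_Rintegral => xt _; rewrite /g /f add0r cosD ![_ * a]mulrC ![_ * b]mulrC.
rewrite (ExM_indep ic1 ic2 indcc) (ExM_indep is1 is2 indss).
rewrite (fstE _ (iN cos a mcos (@cos_max R))) (sndE _ (iN cos b mcos (@cos_max R))).
rewrite (fstE _ (iN sin a msin (@sin_max R))).
by rewrite normal_sin mul0r subr0.
Qed.

Let phi_sqrt_nat u n : phi (Num.sqrt n%:R * u) = phi u ^+ n.
Proof.
elim: n => [|n IH].
  rewrite sqrtr0 mul0r expr0 -[RHS](Ex_cst N01 1); apply: eq_Rintegral => x _.
  by rewrite mul0r cos0.
rewrite exprSr -IH -phiM exprMn sqr_sqrtr// -[X in _ + X]mul1r -mulrDl natr1.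
by rewrite sqrtrM// sqrtr_sqr /phi; apply: eq_Rintegral => x _;
  rewrite -[in LHS]cos_norm -[in RHS]cos_norm !normrM normr_id.
Qed.

(** By [phiM] the characteristic function satisfies $\varphi(u) =
    \varphi(u/\sqrt n)^n$, and the expansion of the cosine identifies the limit of the
    right-hand side. *)
Lemma normal_cos u : Ex N01 (fun x => cos (u * x)) = expR (- (u ^+ 2 / 2)).
Proof.
have iX2 : integ N01 (fun x => (u * x) ^+ 2).
  by under [X in EFin \o X]eq_fun do rewrite exprMn; exact/integZ/integ_normal_sqr.
have s0 : 0 <= u ^+ 2 by exact: sqr_ge0.
have EX2 : Ex N01 (fun x => (u * x) ^+ 2) = u ^+ 2.
  under eq_Rintegral do rewrite exprMn.
  by rewrite ExZ ?normal_sqr_Ex ?mulr1//; exact: integ_normal_sqr.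
pose a n := phi ((Num.sqrt n%:R)^-1 * u).
pose r n : R := expR (- (u ^+ 2 / 2 / n%:R)).
have na : n%:R * `|a n - r n| @[n --> \oo] --> 0.
  apply: power_limit_bound => //.
  have := Ex_cos_expansion (mul_measurable u) iX2; rewrite EX2 /a /phi.
  by under [X in X @ _ --> _ -> _]eq_fun do under eq_Rintegral do rewrite mulrA.
have r01 n : 0 <= r n <= 1.
  by rewrite expR_ge0 -[leRHS]expR0 ler_expR oppr_le0 !divr_ge0.
have a1 n : `|a n| <= 1.
  apply: Ex_norm_bound => [|x]; last exact: cos_max.
  apply: (@integ_bounded _ _ _ N01 _ 1) => [|x]; last exact: cos_max.
  exact: measurableT_comp.
have : phi u - expR (- (u ^+ 2 / 2)) = 0; last by move/eqP; rewrite subr_eq0 => /eqP.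
apply/eqP; rewrite -normr_le0; apply/ler_addgt0Pl => eps eps0; rewrite addr0.
move/cvgr0Pnorm_le : na => /(_ _ eps0) na.
near \oo => n.
apply: (@le_trans _ _ (n%:R * `|a n - r n|)); last first.
  by rewrite -[leLHS]ger0_norm ?mulr_ge0//; near: n.
have n0 : (0 < n)%N by near: n; exists 1%N.
have sn0 : Num.sqrt n%:R != 0 :> R by rewrite gt_eqF// sqrtr_gt0 ltr0n.
have -> : phi u = a n ^+ n by rewrite -phi_sqrt_nat mulVKf.
rewrite -(@expR_power _ (u ^+ 2) n)//.
have := @rotation_powers_cos R (fun j => a n ^+ j) (fun=> 0) (a n) 0 (r n).
rewrite normr0 addr0 => H; apply: H => //.
- by move=> j /=; rewrite mulr0 subr0 exprSr.
- by move=> j; rewrite normrX exprn_ile1.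
Unshelve. all: by end_near. Qed.

Section gauss1_law.
Variables (Q : {measure set (measurableTypeR R) -> \bar R}) (s : R).
Hypotheses (s0 : 0 <= s) (QE : forall D, measurable D -> Q D = gauss1 0 s D).

Let lawQ D : measurable D -> Q D = gauss1 0 (Num.sqrt s ^+ 2) D.
Proof. by move=> mD; rewrite sqr_sqrtr// QE. Qed.

Let maff : measurable_fun [set: measurableTypeR R]
  ((fun x => 0 + x * Num.sqrt s) : measurableTypeR R -> measurableTypeR R).
Proof. by apply: measurable_funD => //; exact: measurable_funM. Qed.

Let iQ (f : R -> R) : measurable_fun [set: R] f -> (forall x, `|f x| <= 1) -> integ Q f.
Proof.
move=> mf f1; apply/(integ_law (P := N01) maff).
- by move=> B mB; rewrite lawQ// -gauss1_affine.
- exact: mf.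
- apply: (@integ_bounded _ _ _ N01 _ 1) => [|x]; last exact: f1.
  exact: measurableT_comp.
Qed.

Lemma gauss1_cos : Ex Q (@cos R) = expR (- (s / 2)).
Proof.
rewrite (normal_law_scale lawQ (iQ mcos (@cos_max R))) normal_cos.
by rewrite sqr_sqrtr.
Qed.

Lemma gauss1_sin : Ex Q (@sin R) = 0.
Proof. by rewrite (normal_law_scale lawQ (iQ msin (@sin_max R))) normal_sin. Qed.

End gauss1_law.

End gaussian.

(** * Borel sets of matrices and multivariate normal laws *)

Section borel_matrices.
Context {R : realType}.
Variables m n : nat.

Lemma continuous_matrix_measurable (f : 'M[R]_(m, n) -> R) : continuous f ->
  measurable_fun [set: 'M[R]_(m, n)] f.
Proof.
move=> /continuousP cf; apply: (measurability _ (RGenOpens.measurableE R)).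
move=> _ [_ [a [b ->] <-]]; rewrite setTI.
by apply: sub_sigma_algebra; exact/cf/interval_open.
Qed.

Lemma measurable_coord i j :
  measurable_fun [set: 'M[R]_(m, n)] (fun M : 'M[R]_(m, n) => M i j).
Proof. by apply: continuous_matrix_measurable; exact: coord_continuous. Qed.

(** Rational boxes form a countable base of the topology of matrices. *)
Lemma measurable_fun_matrix d (T : measurableType d) (f : T -> 'M[R]_(m, n)) :
  (forall i j, measurable_fun [set: T] (fun t => f t i j)) ->
  measurable_fun [set: T] f.
Proof.
move=> mf; apply: (@measurability _ _ _ _ _ _ (@open 'M[R]_(m, n))) => //.
move=> _ [U oU <-]; rewrite setTI.
pose box (p : 'M[rat]_(m, n) * nat) : set 'M[R]_(m, n) :=
  [set y | forall i j, `|y i j - ratr (p.1 i j)| < p.2.+1%:R^-1].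
have mbox p : measurable (f @^-1` box p).
  rewrite (_ : _ @^-1` _ = \bigcap_(i in [set: 'I_m]) \bigcap_(j in [set: 'I_n])
     [set t | `|f t i j - ratr (p.1 i j)| < p.2.+1%:R^-1]); last first.
    apply/seteqP; split => t /=; first by move=> H i _ j _; exact: H.
    by move=> H i j; apply: H.
  apply: fin_bigcap_measurable => // i _; apply: fin_bigcap_measurable => // j _.
  rewrite (_ : [set t | _] = ~` [set t | p.2.+1%:R^-1 <= `|f t i j - ratr (p.1 i j)|]); last first.
    by apply/seteqP; split => t /=; rewrite ltNge => /negP.
  apply: measurableC; rewrite -[X in measurable X]setTI.
  apply: (measurable_fun_le measurableT) => //.
  by apply: measurableT_comp => //; exact: measurable_funB.
rewrite (_ : f @^-1` U = \bigcup_(p in [set: 'M[rat]_(m, n) * nat])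
    [set t | box p (f t) /\ box p `<=` U]); last first.
  apply/seteqP; split => t /=; last by move=> [p _ [bp pU]]; exact: pU.
  move=> Uft; have /nbhs_ballP[e /= e0 eU] : nbhs (f t) U by exact: open_nbhs_nbhs.
  have [k ke] : exists k : nat, k.+1%:R^-1 < e / 2 :> R.
    have e20 : 0 < e / 2 by rewrite divr_gt0.
    exists (Num.truncn (e / 2)^-1); rewrite invf_plt ?posrE//.
    exact: truncnS_gt.
  have k0 : 0 < k.+1%:R^-1 :> R by rewrite invr_gt0.
  have /choice[c cE] : forall ij : 'I_m * 'I_n, exists q : rat,
      `|f t ij.1 ij.2 - ratr q| < k.+1%:R^-1.
    move=> ij; move: (k.+1%:R^-1 : R) k0 => r k0; have : f t ij.1 ij.2 - r < f t ij.1 ij.2 + r by lra.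
    move=> /rat_in_itvoo[q]; rewrite in_itv/= => /andP[q1 q2]; exists q.
    by rewrite ltr_norml; apply/andP; split; lra.
  exists (\matrix_(i, j) c (i, j), k) => //; split => [i j|y yb].
    by rewrite mxE; exact: (cE (i, j)).
  have {}yb i j : `|y i j - ratr (c (i, j))| < k.+1%:R^-1.
    by have := yb i j; rewrite mxE.
  move: (k.+1%:R^-1 : R) k0 ke cE yb => r k0 ke cE yb.
  apply: eU; split => // i j; have := yb i j; have := cE (i, j) => /=.
  rewrite /ball/= !ltr_norml => /andP[? ?] /andP[? ?].
  by apply/andP; split; lra.
apply: countable_bigcupT_measurable; first exact: countableP.
move=> p; have [pU|npU] := pselect (box p `<=` U).
  rewrite (_ : [set t | _] = f @^-1` box p)//.
  by apply/seteqP; split => t /= => [[]|].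
rewrite (_ : [set t | _] = set0)//.
by apply/seteqP; split => t //= [].
Qed.

End borel_matrices.

Section normal_vectors.
Context {R : realType}.
Variable n : nat.
Implicit Types (V : 'M[R]_n) (l a x : 'cV[R]_n).

Lemma dotpE x y : dotp x y = \sum_i x i 0 * y i 0 :> R.
Proof. by rewrite /dotp mxE; apply: eq_bigr => i _; rewrite mxE. Qed.

Lemma dotpDr a x y : dotp a (x + y) = dotp a x + dotp a y.
Proof. by rewrite /dotp mulmxDr mxE. Qed.

Lemma dotpZr a c x : dotp a (c *: x) = c * dotp a x.
Proof. by rewrite /dotp -scalemxAr mxE. Qed.

Lemma dotpC x y : dotp x y = dotp y x.
Proof. by rewrite !dotpE; apply: eq_bigr => i _; rewrite mulrC. Qed.

Lemma dotpDl x y a : dotp (x + y) a = dotp x a + dotp y a.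
Proof. by rewrite dotpC dotpDr !(dotpC a). Qed.

Lemma dotpZl c x a : dotp (c *: x) a = c * dotp x a.
Proof. by rewrite dotpC dotpZr (dotpC a). Qed.

Lemma measurable_dotp a : measurable_fun [set: 'cV[R]_n] (dotp a).
Proof.
rewrite (_ : dotp a = fun x => \sum_i a i 0 * x i 0); last first.
  by apply/funext => x; rewrite dotpE.
by apply: measurable_sum => i; apply: measurable_funM => //; exact: measurable_coord.
Qed.

Definition psd V := V^T = V /\ forall x, 0 <= quad_form V x.

Lemma quad_formE V x : quad_form V x = dotp x (V *m x).
Proof. by rewrite /quad_form /dotp mulmxA. Qed.

Lemma dotp_mx V x y : dotp x (V *m y) = dotp (V^T *m x) y.
Proof. by rewrite /dotp trmx_mul trmxK mulmxA. Qed.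

Lemma quad_form_rank1 V l x :
  quad_form (V - l *m l^T) x = quad_form V x - dotp x l ^+ 2.
Proof.
rewrite !quad_formE mulmxBl -mulmxA.
have -> : l^T *m x = (dotp x l)%:M.
  by rewrite [LHS]mx11_scalar dotpC.
by rewrite mul_mx_scalar -scaleN1r dotpDr !dotpZr mulN1r expr2.
Qed.

Lemma quad_form0 x : quad_form (0 : 'M[R]_n) x = 0.
Proof. by rewrite /quad_form mulmx0 mul0mx mxE. Qed.

(** Positivity at $x + ty$ for the minimizing $t$; if $y^T V y = 0$, positivity
    for all $t$ forces the mixed term to vanish. *)
Lemma psd_cauchy_schwarz V x y : psd V ->
  dotp x (V *m y) ^+ 2 <= quad_form V x * quad_form V y.
Proof.
move=> [symV posV]; set b := dotp x (V *m y).
have expand s t : quad_form V (s *: x + t *: y) =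
    s ^+ 2 * quad_form V x + 2 * s * t * b + t ^+ 2 * quad_form V y.
  have bC : dotp y (V *m x) = b by rewrite dotp_mx symV dotpC.
  rewrite !quad_formE mulmxDr -!scalemxAr !dotpDr !dotpDl !dotpZr !dotpZl bC -/b.
  ring.
have [y0|yn0] := eqVneq (quad_form V y) 0.
  suff -> : b = 0 by rewrite expr0n mulr_ge0.
  apply/eqP/negPn/negP => b0.
  have := posV (1 *: x + (- (1 + quad_form V x) / b) *: y).
  rewrite expand y0 mulr0 addr0 expr1n !mul1r mulr1.
  rewrite (_ : 2 * _ * b = - 2 * (1 + quad_form V x)); last by field.
  by have := posV x; lra.
have yp : 0 < quad_form V y by rewrite lt_def yn0 posV.
have := posV (1 *: x + (- b / quad_form V y) *: y); rewrite expand.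
rewrite (_ : _ + _ = quad_form V x - b ^+ 2 / quad_form V y); last by field.
by rewrite subr_ge0 ler_pdivrMr.
Qed.

Lemma quad_form_delta V i : quad_form V (delta_mx i 0) = V i i.
Proof.
by rewrite /quad_form trmx_delta -rowE -colE !mxE.
Qed.

Lemma psd_diag_ge0 V i : psd V -> 0 <= V i i.
Proof. by move=> [_ /(_ (delta_mx i 0))]; rewrite quad_form_delta. Qed.

Lemma psd_diag0 V : psd V -> (forall i, V i i = 0) -> V = 0.
Proof.
move=> pV V0; apply/matrixP => i j; rewrite mxE; apply/eqP.
have := @psd_cauchy_schwarz V (delta_mx i 0) (delta_mx j 0) pV.
rewrite quad_form_delta V0 mul0r /dotp trmx_delta -colE -rowE !mxE => h.
by rewrite -sqrf_eq0 eq_le h sqr_ge0.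
Qed.

Lemma is_normal_dirac : is_normal (0 : 'cV[R]_n) 0 (\d_(0 : 'cV[R]_n)).
Proof.
split; first by rewrite trmx0.
move=> a B mB; rewrite quad_form0 /gauss1 eqxx.
have -> : dotp a 0 = 0 :> R by rewrite /dotp mulmx0 mxE.
rewrite !diracE; congr (_%:E); congr (_%:R); congr nat_of_bool.
by apply/idP/idP; rewrite !inE /= /dotp mulmx0 mxE.
Qed.

(** The law of $x + gl$ with $x$ distributed as [Q] and $g$ independent standard
    normal. *)
Lemma is_normal_add_rank1 V l (Q : probability 'cV[R]_n R) : psd V ->
  is_normal 0 V Q ->
  exists Q' : probability 'cV[R]_n R, is_normal 0 (V + l *m l^T) Q'.
Proof.
move=> [symV posV] [_ QV].
pose N01 := @normal_prob R 0 1.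
pose g (xt : 'cV[R]_n * measurableTypeR R) : 'cV[R]_n := xt.1 + xt.2 *: l.
have mg : measurable_fun setT g.
  apply: measurable_fun_matrix => i j.
  rewrite (_ : (fun _ => _) = (fun xt : 'cV[R]_n * measurableTypeR R => xt.1 i j + xt.2 * l i j)).
    apply: measurable_funD.
      exact: (measurableT_comp (@measurable_coord _ _ _ i j) measurable_fst).
    by apply: measurable_funM => //; exact: measurable_snd.
  by apply/funext => xt; rewrite !mxE.
pose g' : {mfun _ >-> _} := HB.pack g (isMeasurableFun.Build _ _ _ _ _ mg).
exists (distribution (Q \x N01)%E g'); split.
  by rewrite linearD /= trmx_mul trmxK symV.
move=> a B mB.
have law D : measurable D -> Q (dotp a @^-1` D) = gauss1 0 (quad_form V a) D.
  by move=> mD; rewrite QV//; congr gauss1; rewrite /dotp mulmx0 mxE.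
have := gauss1_add_noise (measurable_dotp a) (dotp a l) (posV a) law mB.
have -> : dotp a 0 = 0 :> R by rewrite /dotp mulmx0 mxE.
have -> : quad_form (V + l *m l^T) a = quad_form V a + dotp a l ^+ 2.
  have := quad_form_rank1 (V + l *m l^T) l a; rewrite addrK => ->.
  by rewrite subrK.
move=> <-; rewrite /distribution /pushforward; apply: (congr1 (fun A => (Q \x N01)%E A)).
by apply/seteqP; split => xt /=; rewrite dotpDr dotpZr.
Qed.

(** Subtracting $l l^T$ with $l = V e_i / \sqrt{V_{ii}}$ keeps [V] positive
    semidefinite by Cauchy-Schwarz and kills a diagonal entry; a matrix with zero
    diagonal is zero. *)
Theorem normal_exists V : psd V ->
  exists Q : probability 'cV[R]_n R, is_normal 0 V Q.
Proof.
have [k] := ubnP #|[set i | V i i != 0]%SET|.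
elim: k V => // k IH V /ltnSE cardV pV.
have [V0|/existsNP[i /eqP Vi0]] := pselect (forall i, V i i = 0).
  by exists (\d_(0 : 'cV[R]_n)); rewrite (psd_diag0 pV V0); exact: is_normal_dirac.
have Vip : 0 < V i i by rewrite lt_def Vi0 psd_diag_ge0.
pose l := (Num.sqrt (V i i))^-1 *: col i V.
have dl x : dotp x l ^+ 2 = dotp x (V *m delta_mx i 0) ^+ 2 / V i i.
  by rewrite /l dotpZr colE exprMn exprVn sqr_sqrtr ?(ltW Vip)// mulrC.
have pV' : psd (V - l *m l^T).
  split; first by rewrite linearB /= trmx_mul trmxK pV.1.
  move=> x; rewrite quad_form_rank1 dl subr_ge0 ler_pdivrMr//.
  by rewrite -[in leRHS](quad_form_delta V i); exact: psd_cauchy_schwarz.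
have diagV' j : (V - l *m l^T) j j = V j j - V j i ^+ 2 / V i i.
  rewrite -(quad_form_delta (V - l *m l^T) j) quad_form_rank1 quad_form_delta dl.
  by congr (_ - _ ^+ 2 / _); rewrite /dotp trmx_delta -colE -rowE !mxE.
have card' : (#|[set j | (V - l *m l^T)%R j j != 0%R]%SET| < k)%N.
  apply: leq_trans cardV; apply: proper_card; apply/properP; split.
    apply/fintype.subsetP => j; rewrite !inE; apply: contraNN => /eqP Vj0.
    have := psd_diag_ge0 j pV'; rewrite diagV' Vj0 sub0r oppr_ge0 => h.
    rewrite oppr_eq0 eq_le h/= divr_ge0 ?sqr_ge0//; exact: ltW.
  exists i; first by rewrite inE.
  by rewrite inE diagV' expr2 mulfK// subrr eqxx.
have [Q HQ] := IH _ card' pV'.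
have [Q' HQ'] := is_normal_add_rank1 l pV' HQ.
by exists Q'; rewrite subrK in HQ'.
Qed.

End normal_vectors.

(** * Multivariate Bernstein operators *)

Section bernstein.
Context {R : realType}.
Variable k : nat.
Implicit Types (u : 'I_k -> R) (s : seq 'I_k) (G H : ('I_k -> nat) -> R).

(** Expectation of [G] at the end of a random walk on $\mathbb N^k$: the step
    labelled [i] moves along the coordinate [i] with probability [u i]. With [N]
    steps along each coordinate this is the multivariate Bernstein operator, and
    the recursion avoids its binomial coefficients. *)
Fixpoint walk u s G : R :=
  if s is i :: s' then
    u i * walk u s' (fun m => G (fun j => (i == j) + m j)%N) +
    (1 - u i) * walk u s' G
  else G (fun=> 0%N).

Lemma walk_cst u s (c : R) : walk u s (fun=> c) = c.
Proof. by elim: s => //= i s ->; ring. Qed.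

Lemma walkD u s G H : walk u s (fun m => G m + H m) = walk u s G + walk u s H.
Proof. by elim: s G H => //= i s IH G H; rewrite !IH; ring. Qed.

Lemma walkZ u s (c : R) G : walk u s (fun m => c * G m) = c * walk u s G.
Proof. by elim: s G => //= i s IH G; rewrite !IH; ring. Qed.

Lemma walk_sum u s (I : Type) (r : seq I) (F : I -> ('I_k -> nat) -> R) :
  walk u s (fun m => \sum_(i <- r) F i m) = \sum_(i <- r) walk u s (F i).
Proof.
elim: r => [|i r IH].
  rewrite big_nil (_ : (fun m => _) = fun=> 0) ?walk_cst//.
  by apply/funext => m; rewrite big_nil.
rewrite big_cons -IH -walkD; congr walk; apply/funext => m; by rewrite big_cons.
Qed.

Lemma walk_le u s G H : (forall i, 0 <= u i <= 1) -> (forall m, G m <= H m) ->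
  walk u s G <= walk u s H.
Proof.
move=> u01; elim: s G H => //= i s IH G H GH; have /andP[u0 u1] := u01 i.
by rewrite lerD// ler_wpM2l ?subr_ge0// IH.
Qed.

Lemma walk_norm_le u s G (K : R) : (forall i, 0 <= u i <= 1) ->
  (forall m, `|G m| <= K) -> `|walk u s G| <= K.
Proof.
move=> u01 GK; rewrite ler_norml -{1}(walk_cst u s (- K)) -{2}(walk_cst u s K).
by apply/andP; split; apply: walk_le => // m; have := GK m; rewrite ler_norml => /andP[].
Qed.

(** The number of steps along [i] is binomial; the shift [c] absorbs the step taken
    in the recursion. *)
Lemma walk_second_moment u s i (c : R) :
  walk u s (fun m => ((m i)%:R + c) ^+ 2) =
  ((count_mem i s)%:R * u i + c) ^+ 2 + (count_mem i s)%:R * (u i * (1 - u i)).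
Proof.
elim: s c => [|j s IH] c; first by rewrite /= !mul0r addr0 add0r.
rewrite [walk _ _ _]/= IH.
have [->|ji] := eqVneq j i.
  under [X in walk u s X]eq_fun do rewrite natrD [true%:R + _]addrC -addrA.
  have t1 : true%:R = 1 :> R by [].
  by rewrite IH /= eqxx natrD !t1; ring.
under [X in walk u s X]eq_fun do rewrite add0n.
by rewrite IH /= (negbTE ji) add0n; ring.
Qed.

Definition balanced N : seq 'I_k := flatten (nseq N (enum 'I_k)).

Lemma count_balanced N i : count_mem i (balanced N) = N.
Proof.
rewrite /balanced count_flatten map_nseq sumn_nseq count_uniq_mem ?enum_uniq//.
by rewrite mem_enum mul1n.
Qed.

(** Chebyshev's inequality for the walk, stated as a pointwise majorization of
    [G - c] by a quadratic function. *)
Lemma bernstein_error u N G (c K e dl : R) : (forall i, 0 <= u i <= 1) ->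
  (0 < N)%N -> 0 < dl -> 0 <= e -> 0 <= K -> (forall m, `|G m - c| <= K) ->
  (forall m, (forall i, `|(m i)%:R / N%:R - u i| < dl) -> `|G m - c| <= e) ->
  `|walk u (balanced N) G - c| <= e + K * k%:R / dl ^+ 2 / N%:R.
Proof.
move=> u01 N0 dl0 e0 K0 GK Ge.
have N0' : 0 < N%:R :> R by rewrite ltr0n.
have N0n : N%:R != 0 :> R by rewrite gt_eqF.
have dn : dl != 0 by rewrite gt_eqF.
pose w := K / dl ^+ 2 / N%:R ^+ 2.
have w0 : 0 <= w by rewrite !divr_ge0 ?sqr_ge0.
pose H (m : 'I_k -> nat) := e + w * \sum_i ((m i)%:R - N%:R * u i) ^+ 2.
have GH m : `|G m - c| <= H m.
  have S0 (A : pred 'I_k) : 0 <= \sum_(i | A i) ((m i)%:R - N%:R * u i) ^+ 2.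
    by apply: sumr_ge0 => i _; exact: sqr_ge0.
  have [small|/existsNP[i /negP]] := pselect (forall i, `|(m i)%:R / N%:R - u i| < dl).
    by rewrite (le_trans (Ge m small))// lerDl mulr_ge0.
  rewrite -leNgt => big.
  rewrite (le_trans (GK m))// (@le_trans _ _ (w * \sum_i ((m i)%:R - N%:R * u i) ^+ 2))//; last by rewrite lerDr.
  rewrite (bigD1 i)//=.
  apply: (@le_trans _ _ (w * ((m i)%:R - N%:R * u i) ^+ 2)); last first.
    by rewrite ler_wpM2l// lerDl; exact: S0.
  have -> : w * ((m i)%:R - N%:R * u i) ^+ 2 = K * (((m i)%:R / N%:R - u i) / dl) ^+ 2.
    by rewrite /w; field; rewrite N0n dn.
  rewrite ler_peMr// -[leRHS]real_normK ?num_real// exprn_ege1//.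
  by rewrite normrM normfV (gtr0_norm dl0) ler_pdivlMr// mul1r.
have wH : walk u (balanced N) H <= e + K * k%:R / dl ^+ 2 / N%:R.
  rewrite /H walkD walk_cst walkZ walk_sum lerD2l.
  apply: (@le_trans _ _ (w * \sum_(i < k) N%:R)).
    apply: ler_wpM2l => //; apply: ler_sum => i _.
    rewrite (walk_second_moment _ _ _ (- (N%:R * u i))) count_balanced subrr expr0n add0r.
    rewrite ler_piMr//; have /andP[? ?] := u01 i; nra.
  by rewrite sumr_const card_ord -mulr_natl /w; rewrite le_eqVlt; apply/orP; left; apply/eqP; field; rewrite N0n dn.
apply: le_trans wH; rewrite ler_norml.
have -> : walk u (balanced N) G - c = walk u (balanced N) (fun m => G m - c).
  by rewrite walkD walk_cst.
have -> : - walk u (balanced N) H = walk u (balanced N) (fun m => - 1 * H m).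
  by rewrite walkZ mulN1r.
by apply/andP; split; apply: walk_le => // m; have := GH m; rewrite ler_norml ?mulN1r => /andP[].
Qed.

End bernstein.

Section heine_cantor.
Context {R : realType}.

(** Only one of the two points ranges over the compact set, because the nodes of
    the Bernstein operator may lie outside of it. *)
Lemma heine_cantor (U : normedModType R) (K : set U) (f : U -> R) (e : R) :
  compact K -> (forall x, K x -> {for x, continuous f}) -> 0 < e ->
  exists2 dl, 0 < dl & forall x y, K x -> `|x - y| < dl -> `|f x - f y| <= e.
Proof.
move=> /compact_near_coveringP cK cf e0; have e20 : 0 < e / 2 by rewrite divr_gt0.
have := cK R (0^'+) (fun dl x => forall y, `|x - y| < dl -> `|f x - f y| <= e) _.
case.
  move=> x Kx; have := cf x Kx => /cvgrPdist_le /(_ _ e20).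
  move=> /nbhs_ballP[r /= r0 fr].
  have r20 : 0 < r / 2 by rewrite divr_gt0.
  exists (ball x (r / 2), [set dl | dl < r / 2]) => /=.
    split; first exact: nbhsx_ballx.
    exact: nbhs_right_lt.
  move=> [x' dl] /= [xx' dlr] y x'y.
  rewrite -ball_normE /= in xx'.
  have h1 : `|f x - f x'| <= e / 2.
    by apply: fr; rewrite -ball_normE /=; apply: lt_trans xx' _; lra.
  have h2 : `|f x - f y| <= e / 2.
    apply: fr; rewrite -ball_normE /=.
    have := ler_distD x' x y; have := lt_trans x'y dlr; lra.
  rewrite (splitr e); apply: le_trans (ler_distD (f x) _ _) _.
  by rewrite lerD// distrC.
move=> dl0 /= dl0_gt0 H; exists (dl0 / 2); first by rewrite divr_gt0.
move=> x y Kx; apply: (H (dl0 / 2)) => //=; last by rewrite divr_gt0.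
by rewrite sub0r normrN gtr0_norm ?divr_gt0//; lra.
Qed.

Lemma cV_norm_le n (x : 'cV[R]_n) (c : R) : 0 <= c ->
  (forall i, `|x i 0| <= c) -> `|x| <= c.
Proof.
move=> c0 xc; rewrite [leLHS]/Num.norm/= mx_normrE; apply: bigmax_le => // i _.
by rewrite (ord1 i.2).
Qed.

Lemma cV_coord_le n (x : 'cV[R]_n) i : `|x i 0| <= `|x|.
Proof.
rewrite [leRHS]/Num.norm/= mx_normrE.
exact: (le_bigmax _ (fun ij : 'I_n * 'I_1 => `|x ij.1 ij.2|) (i, 0)).
Qed.

Lemma cV_cube_compact n (M : R) : compact [set x : 'cV[R]_n | forall i, `|x i 0| <= M].
Proof.
have ctr : continuous (@trmx R 1 n).
  move=> x A /nbhs_ballP[e /= e0 eA]; apply/nbhs_ballP; exists e => // y [_ xy].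
  by apply: eA; split => // i j; rewrite !mxE; exact: xy.
have -> : [set x : 'cV[R]_n | forall i, `|x i 0| <= M] =
    (@trmx R 1 n) @` [set v : 'rV[R]_n | forall i, `[- M, M]%classic (v ord0 i)].
  apply/seteqP; split => [x xM|x [v vM <-] i].
    exists x^T; last by rewrite trmxK.
    by move=> i /=; rewrite in_itv/= mxE -ler_norml.
  by rewrite mxE; have := vM i; rewrite /= in_itv/= -ler_norml.
apply: continuous_compact; first exact: continuous_subspaceT.
by apply: (@rV_compact R n (fun=> `[- M, M]%classic)) => i; exact: segment_compact.
Qed.

End heine_cantor.

(** * Levy's continuity theorem *)

Lemma cvg_eq {R : realType} (u v : nat -> R) (l l' : R) : u =1 v -> l = l' ->
  v n @[n --> \oo] --> l' -> u n @[n --> \oo] --> l.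
Proof. by move=> /funext -> ->. Qed.

Lemma cvg_scale {R : realType} (c : R) (u : nat -> R) (l : R) :
  u n @[n --> \oo] --> l -> c * u n @[n --> \oo] --> c * l.
Proof. by move=> ul; apply: cvgM => //; exact: cvg_cst. Qed.
Arguments cvg_scale {R} c [u l] _.

Section levy.
Context {R : realType} {d : measure_display} {T : measurableType d}.
Variables (P : probability T R) (k : nat) (Z : nat -> T -> 'cV[R]_k).
Variable Q : probability 'cV[R]_k R.
Hypothesis mZ : forall n, measurable_fun [set: T] (Z n).
Hypothesis cvg_cos : forall a,
  Ex P (fun t => cos (dotp a (Z n t))) @[n --> \oo] --> Ex Q (fun x => cos (dotp a x)).
Hypothesis cvg_sin : forall a,
  Ex P (fun t => sin (dotp a (Z n t))) @[n --> \oo] --> Ex Q (fun x => sin (dotp a x)).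

Let mcos a : measurable_fun [set: 'cV[R]_k] (fun x => cos (dotp a x)).
Proof.
apply: measurableT_comp (measurable_dotp a).
exact: (continuous_measurable_fun (@continuous_cos R)).
Qed.

Let msin a : measurable_fun [set: 'cV[R]_k] (fun x => sin (dotp a x)).
Proof.
apply: measurableT_comp (measurable_dotp a).
exact: (continuous_measurable_fun (@continuous_sin R)).
Qed.

(** The test functions whose products with all characters have convergent
    expectations; product-to-sum formulas make the class stable under
    multiplication by characters. *)
Definition trig_stable (f : 'cV[R]_k -> R) : Prop :=
  [/\ measurable_fun [set: 'cV[R]_k] f, exists K, forall x, `|f x| <= K &
   forall a,
    Ex P (fun t => f (Z n t) * cos (dotp a (Z n t))) @[n --> \oo]
      --> Ex Q (fun x => f x * cos (dotp a x)) /\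
    Ex P (fun t => f (Z n t) * sin (dotp a (Z n t))) @[n --> \oo]
      --> Ex Q (fun x => f x * sin (dotp a x))].

Let integM (f g : 'cV[R]_k -> R) : measurable_fun [set: 'cV[R]_k] f ->
  (exists K, forall x, `|f x| <= K) -> measurable_fun [set: 'cV[R]_k] g ->
  (forall x, `|g x| <= 1) ->
  integ Q (fun x => f x * g x) /\ forall n, integ P (fun t => f (Z n t) * g (Z n t)).
Proof.
move=> mf [K fK] mg g1.
have mfg : measurable_fun setT (fun x => f x * g x) by exact: measurable_funM.
have fgK x : `|f x * g x| <= K.
  by rewrite normrM (le_trans _ (fK x))// ler_piMr.
split; first exact: integ_bounded mfg fgK.
move=> n; apply: (@integ_bounded _ _ _ P _ K) => [|t]; last exact: fgK.
exact: (measurableT_comp mfg (mZ n)).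
Qed.

Lemma trig_stable_cst c : trig_stable (fun=> c).
Proof.
split=> //; first by exists `|c|.
have iP (g : R -> R) a : measurable_fun setT (fun x => g (dotp a x)) ->
    (forall x, `|g x| <= 1) -> integ Q (fun x => g (dotp a x)) /\
    forall n, integ P (fun t => g (dotp a (Z n t))).
  move=> mg g1; split=> [|n]; first by apply: (@integ_bounded _ _ _ Q _ 1).
  by apply: (@integ_bounded _ _ _ P _ 1) => //; exact: (measurableT_comp mg (mZ n)).
move=> a; have [iQc iPc] := iP cos a (mcos a) (@cos_max R).
have [iQs iPs] := iP sin a (msin a) (@sin_max R).
split.
  by apply: (cvg_eq _ _ (cvg_scale c (@cvg_cos a))) => [n /=|]; rewrite ExZ.
by apply: (cvg_eq _ _ (cvg_scale c (@cvg_sin a))) => [n /=|]; rewrite ExZ.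
Qed.

Lemma trig_stableD f g : trig_stable f -> trig_stable g ->
  trig_stable (fun x => f x + g x).
Proof.
move=> [mf bf cf] [mg bg cg]; split; first exact: measurable_funD.
  have [K fK] := bf; have [L gL] := bg; exists (K + L) => x.
  by rewrite (le_trans (ler_normD _ _))// lerD.
move=> a; have [c1 s1] := cf a; have [c2 s2] := cg a.
have [Q1 P1] := integM mf bf (mcos a) (fun x => @cos_max R _).
have [Q2 P2] := integM mg bg (mcos a) (fun x => @cos_max R _).
have [Q3 P3] := integM mf bf (msin a) (fun x => @sin_max R _).
have [Q4 P4] := integM mg bg (msin a) (fun x => @sin_max R _).
split.
  apply: (cvg_eq _ _ (cvgD c1 c2)) => [n /=|]; rewrite -ExD//.
    by apply: eq_Rintegral => t _; rewrite mulrDl.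
  by apply: eq_Rintegral => t _; rewrite mulrDl.
apply: (cvg_eq _ _ (cvgD s1 s2)) => [n /=|]; rewrite -ExD//.
  by apply: eq_Rintegral => t _; rewrite mulrDl.
by apply: eq_Rintegral => t _; rewrite mulrDl.
Qed.

Lemma trig_stableZ c f : trig_stable f -> trig_stable (fun x => c * f x).
Proof.
move=> [mf bf cf]; split; first exact: measurable_funM.
  by have [K fK] := bf; exists (`|c| * K) => x; rewrite normrM ler_wpM2l.
move=> a; have [c1 s1] := cf a.
have [Q1 P1] := integM mf bf (mcos a) (fun x => @cos_max R _).
have [Q3 P3] := integM mf bf (msin a) (fun x => @sin_max R _).
split.
  apply: (cvg_eq _ _ (cvg_scale c c1)) => [n /=|]; rewrite -ExZ//.
    by apply: eq_Rintegral => t _; rewrite mulrA.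
  by apply: eq_Rintegral => t _; rewrite mulrA.
apply: (cvg_eq _ _ (cvg_scale c s1)) => [n /=|]; rewrite -ExZ//.
  by apply: eq_Rintegral => t _; rewrite mulrA.
by apply: eq_Rintegral => t _; rewrite mulrA.
Qed.

Lemma trig_stable_sin b f : trig_stable f -> trig_stable (fun x => f x * sin (dotp b x)).
Proof.
move=> [mf bf cf]; split.
- exact: measurable_funM (msin b).
- have [K fK] := bf; exists K => x.
  by rewrite normrM (le_trans _ (fK x))// ler_piMr// sin_max.
move=> a; have [c1 s1] := cf (a + b); have [c2 s2] := cf (a + - 1 *: b).
have [Q1 P1] := integM mf bf (mcos (a + b)) (fun x => @cos_max R _).
have [Q2 P2] := integM mf bf (mcos (a + - 1 *: b)) (fun x => @cos_max R _).
have [Q3 P3] := integM mf bf (msin (a + b)) (fun x => @sin_max R _).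
have [Q4 P4] := integM mf bf (msin (a + - 1 *: b)) (fun x => @sin_max R _).
have ec x : f x * sin (dotp b x) * cos (dotp a x) =
    2^-1 * (f x * sin (dotp (a + b) x) - f x * sin (dotp (a + - 1 *: b) x)).
  by rewrite !dotpDl dotpZl mulN1r !sinD cosN sinN; field.
have es x : f x * sin (dotp b x) * sin (dotp a x) =
    2^-1 * (f x * cos (dotp (a + - 1 *: b) x) - f x * cos (dotp (a + b) x)).
  by rewrite !dotpDl dotpZl mulN1r !cosD cosN sinN; field.
split.
  apply: (cvg_eq _ _ (cvg_scale 2^-1 (cvgB s1 s2))) => [n /=|].
    rewrite -ExB// -ExZ; last exact: integB.
    by apply: eq_Rintegral => t _; rewrite ec.
  rewrite -ExB// -ExZ; last exact: integB.
  by apply: eq_Rintegral => t _; rewrite ec.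
apply: (cvg_eq _ _ (cvg_scale 2^-1 (cvgB c2 c1))) => [n /=|].
  rewrite -ExB// -ExZ; last exact: integB.
  by apply: eq_Rintegral => t _; rewrite es.
rewrite -ExB// -ExZ; last exact: integB.
by apply: eq_Rintegral => t _; rewrite es.
Qed.

Lemma trig_stable_cvg f : trig_stable f ->
  Ex P (fun t => f (Z n t)) @[n --> \oo] --> Ex Q f.
Proof.
move=> [_ _ /(_ 0)[c0 _]].
have d0 x : dotp (0 : 'cV[R]_k) x = 0 by rewrite /dotp trmx0 mul0mx mxE.
by apply: (cvg_eq _ _ c0) => [n /=|]; apply: eq_Rintegral => t _;
  rewrite d0 cos0 mulr1.
Qed.

(** A coordinate coded as a probability: since multiplication by it preserves
    [trig_stable], so does the Bernstein operator with these step probabilities. *)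
Let prob L (x : 'cV[R]_k) (i : 'I_k) : R := (1 + sin (x i 0 / L)) / 2.

Let dotp_coord L i x : dotp (L^-1 *: delta_mx i 0 : 'cV[R]_k) x = x i 0 / L.
Proof.
rewrite dotpZl dotpE (bigD1 i)//= big1 => [|j ji]; rewrite !mxE ?(negbTE ji) ?mul0r//.
by rewrite !eqxx mul1r addr0 mulrC.
Qed.

Let trig_stable_prob L i f : trig_stable f -> trig_stable (fun x => prob L x i * f x).
Proof.
move=> sf; have := trig_stableD (trig_stableZ 2^-1 sf)
  (trig_stableZ 2^-1 (trig_stable_sin (L^-1 *: delta_mx i 0) sf)).
by congr trig_stable; apply/funext => x; rewrite dotp_coord /prob; field.
Qed.

Let trig_stable_walk L s G : trig_stable (fun x => walk (prob L x) s G).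
Proof.
elim: s G => [|i s IH] G /=; first exact: trig_stable_cst.
apply: trig_stableD; first exact: trig_stable_prob.
have := trig_stableD (IH G) (trig_stableZ (- 1) (trig_stable_prob L i (IH G))).
by congr trig_stable; apply/funext => x; ring.
Qed.

(** The functions differ by at most [e] on [D], and by at most [2 * K] elsewhere. *)
Lemma Ex_close d' (T' : measurableType d') (P' : probability T' R) (f g : T' -> R)
  (K e e' : R) (D : set T') : measurable D -> measurable_fun [set: T'] f ->
  measurable_fun [set: T'] g -> (forall t, `|f t| <= K) -> (forall t, `|g t| <= K) ->
  0 <= e -> (forall t, D t -> `|f t - g t| <= e) -> 1 - e' <= fine (P' D) ->
  `|Ex P' f - Ex P' g| <= e + 2 * K * e'.
Proof.
move=> mD mf mg fK gK e0 fg PD.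
have [t0|nT] := pselect (exists t : T', True); last first.
  exfalso; have := probability_setT P'; rewrite (_ : setT = set0).
    by rewrite measure0 => /eqP; rewrite eqe eq_sym oner_eq0.
  by apply/seteqP; split => // t _; apply: nT; exists t.
have K0 : 0 <= K by case: t0 => t _; exact: le_trans (fK t).
have i_f := integ_bounded P' mf fK; have i_g := integ_bounded P' mg gK.
rewrite -ExB//.
have iD := integ_indic P' mD.
apply: (@le_trans _ _ (Ex P' (fun t => e + 2 * K - 2 * K * \1_D t))).
  apply: Ex_norm_le; [exact: integB| |].
    by apply: integB; [exact: integ_cst|exact: integZ].
  move=> t; rewrite indicE; have [tD|tD] := boolP (t \in D).
    by rewrite mulr1 addrK; apply: fg; exact: set_mem.
  rewrite mulr0 subr0 (le_trans (ler_normB _ _))//.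
  by have := fK t; have := gK t; lra.
rewrite ExB; [|exact: integ_cst|exact: integZ].
rewrite Ex_cst ExZ// Ex_indic//.
have : 2 * K * (1 - e') <= 2 * K * fine (P' D) by rewrite ler_wpM2l// mulr_ge0.
by lra.
Qed.

Let cube M : set 'cV[R]_k := [set x | forall i, `|x i 0| <= M].

Let measurable_cube M : measurable (cube M).
Proof.
rewrite (_ : cube M = \bigcap_(i in [set: 'I_k]) [set x : 'cV[R]_k | `|x i 0| <= M]).
  apply: fin_bigcap_measurable => // i _; apply: measurable_norm_le.
  exact: measurable_coord.
by apply/seteqP; split => x H i => [_|]; exact: H.
Qed.

(** Uniformly on a cube of radius [M], a bounded continuous function is a limit of
    trigonometric polynomials with the same global bound: Bernstein
    polynomials in the variables $(1 + \sin(x_i/L))/2$, where [L] is so large that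
    the sine is injective on the cube. *)
Let trig_approximation (f : 'cV[R]_k -> R) (K M e : R) : continuous f ->
  (forall x, `|f x| <= K) -> 0 < M -> 0 < e ->
  exists g, [/\ trig_stable g, forall x, `|g x| <= K &
    forall x, cube M x -> `|g x - f x| <= e].
Proof.
move=> cf fK M0 e0; have K0 : 0 <= K by exact: le_trans (fK 0).
have e20 : 0 < e / 2 by rewrite divr_gt0.
have pi4 : 0 < pi / 4 :> R by rewrite divr_gt0 ?pi_gt0.
pose L := M / (pi / 4); have L0 : 0 < L by rewrite divr_gt0.
have Ln0 : L != 0 by rewrite gt_eqF.
have [dl1 dl10 Hf] := heine_cantor (@cV_cube_compact R k M) (fun x _ => cf x) e20.
pose c := sin (pi / 4 : R).
have pi2 : pi / 4 <= pi / 2 :> R by have := pi_gt0 R; lra.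
have angle_pi2 (th : R) : `|th| <= pi / 4 -> th \in `[(- (pi / 2)), (pi / 2)].
  by rewrite ler_norml in_itv/= => /andP[? ?]; have := pi_gt0 R; lra.
have c1 : c < 1.
  rewrite -(sin_pihalf R) /c ltr_sin//.
  - by have := pi_gt0 R; lra.
  - by apply: angle_pi2; rewrite ger0_norm// ltW.
  - by rewrite in_itv/= lexx andbT; have := pi_gt0 R; lra.
have sin_c (th : R) : `|th| <= pi / 4 -> `|sin th| <= c.
  move=> h; rewrite ler_norml /c -sinN.
  have hp : (pi / 4 : R) \in `[(- (pi / 2)), (pi / 2)] by apply: angle_pi2; rewrite ger0_norm// ltW.
  have hn : (- (pi / 4) : R) \in `[(- (pi / 2)), (pi / 2)].
    by apply: angle_pi2; rewrite normrN ger0_norm// ltW.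
  have := angle_pi2 _ h; move: h; rewrite ler_norml => /andP[h1 h2] h3.
  apply/andP; split; rewrite leNgt ltr_sin// -leNgt//.
have [dl2 dl20 Hasin] : exists2 dl, 0 < dl & forall x y : R, `[- c, c]%classic x ->
    `|x - y| < dl -> `|asin x - asin y| <= dl1 / 2 / L.
  apply: (@heine_cantor R R^o `[- c, c]%classic (@asin R)).
  - exact: segment_compact.
  - move=> x /=; rewrite in_itv/= => /andP[x1 x2]; apply: continuous_asin.
    by apply/andP; split; lra.
  - by do 2 apply: divr_gt0 => //.
pose y N (m : 'I_k -> nat) : 'cV[R]_k := \col_i (L * asin (2 * ((m i)%:R / N%:R) - 1)).
pose dl := dl2 / 2; have dl0 : 0 < dl by rewrite divr_gt0.
pose B := 2 * K * k%:R / dl ^+ 2.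
have B0 : 0 <= B by rewrite divr_ge0 ?sqr_ge0// !mulr_ge0.
have [N' hN] : exists N' : nat, B / (e / 2) <= N'.+1%:R.
  by exists (Num.truncn (B / (e / 2))); exact/ltW/truncnS_gt.
pose N := N'.+1.
have prob01 x i : 0 <= prob L x i <= 1.
  have := sin_geN1 (x i 0 / L); have := sin_le1 (x i 0 / L).
  by rewrite /prob => ? ?; apply/andP; split; lra.
exists (fun x => walk (prob L x) (balanced k N) (fun m => f (y N m))); split.
- exact: trig_stable_walk.
- by move=> x; exact: walk_norm_le.
move=> x xM.
have step : `|walk (prob L x) (balanced k N) (fun m => f (y N m)) - f x| <=
    e / 2 + 2 * K * k%:R / dl ^+ 2 / N%:R.
  apply: bernstein_error => //.
  - exact: ltW.
  - by rewrite mulr_ge0.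
  - move=> m; rewrite (le_trans (ler_normB _ _))//.
    by have := fK x; have := fK (y N m); lra.
  - move=> m mu; rewrite distrC; apply: Hf => //.
    apply: (@le_lt_trans _ _ (dl1 / 2)); last lra.
    apply: cV_norm_le; first by rewrite divr_ge0// ltW.
    move=> i; rewrite !mxE.
    have thi : `|x i 0 / L| <= pi / 4.
      rewrite normrM normfV (gtr0_norm L0) ler_pdivrMr//.
      by rewrite /L mulrC divfK ?gt_eqF//; exact: xM.
    have -> : x i 0 - L * asin (2 * ((m i)%:R / N%:R) - 1) =
        L * (asin (sin (x i 0 / L)) - asin (2 * ((m i)%:R / N%:R) - 1)).
      by rewrite sinK; [field|exact: angle_pi2].
    rewrite normrM (gtr0_norm L0) mulrC -ler_pdivlMr//; apply: Hasin.
      by rewrite /= in_itv/= -ler_norml; exact: sin_c.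
    have := mu i; rewrite /prob distrC => h.
    have -> : sin (x i 0 / L) - (2 * ((m i)%:R / N%:R) - 1) =
      2 * ((1 + sin (x i 0 / L)) / 2 - (m i)%:R / N%:R) by field; rewrite ?pnatr_eq0.
    rewrite normrM ger0_norm//; move: h; rewrite /dl; lra.
apply: le_trans step _.
rewrite [leRHS](splitr e) lerD2l -/B ler_pdivrMr ?ltr0n//.
by rewrite mulrC -ler_pdivrMr.
Qed.

Hypothesis tight : forall e, 0 < e -> exists M, whp P e (fun n => Z n @^-1` cube M).

Let tightQ e : 0 < e -> exists M, 1 - e <= fine (Q (cube M)).
Proof.
move=> e0.
have : Q (cube n%:R) @[n --> \oo] --> Q (\bigcup_n cube n%:R).
  apply: nondecreasing_cvg_mu => //.
    exact: bigcup_measurable.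
  move=> n m nm; apply/subsetPset => x H i; apply: le_trans (H i) _.
  by rewrite ler_nat.
rewrite (_ : \bigcup_n _ = setT); last first.
  apply/seteqP; split => // x _; exists (Num.truncn `|x|).+1 => //= i.
  by apply: le_trans (cV_coord_le x i) _; exact/ltW/truncnS_gt.
rewrite (probability_setT Q) => /fine_cvgP[_] /cvgrPdist_le/(_ e e0) H.
near \oo => n.
have : `|1 - (fine \o (fun n => Q (cube n%:R))) n| <= e by near: n.
move=> /= h; exists n%:R; move: h; rewrite ler_norml => /andP[_]; lra.
Unshelve. all: by end_near. Qed.

Lemma cubeS M M' : M <= M' -> cube M `<=` cube M'.
Proof. by move=> MM x H i; exact: le_trans (H i) MM. Qed.

(** The test function is replaced by a trigonometric polynomial with the same
    bound, close to it on a cube that carries most of the mass of all laws involved. *)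
Theorem levy_continuity : cvg_in_distribution P Z Q.
Proof.
move=> f cf bf.
have mf := continuous_matrix_measurable cf.
have [K fK] : exists K, forall x, `|f x| <= K.
  have [K [_ HK]] := bf; exists (K + 1) => x.
  by apply: (HK (K + 1)) => //; rewrite ltrDl.
have K0 : 0 <= K by exact: le_trans (fK 0).
have ifQ : integ Q f by exact: integ_bounded mf fK.
have mfZ n : measurable_fun setT (f \o Z n) by exact: measurableT_comp (mZ n).
have ifP n : integ P (f \o Z n).
  by apply: (@integ_bounded _ _ _ P _ K) => // t; exact: fK.
rewrite integE//; under eq_fun do rewrite integE//.
apply: cvg_EFin; first exact: nearW.
apply/cvgrPdist_le => e e0.
pose e1 := e / (4 * K + 4) / 2.
have K4 : 0 < 4 * K + 4 by lra.
have e10 : 0 < e1 by rewrite !divr_gt0.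
have [M1 tP] := tight e10; have [M2 tQ] := tightQ e10.
pose M := Num.max 1 (Num.max M1 M2).
have M0 : 0 < M by rewrite /M lt_max ltr01.
have M1M : M1 <= M by rewrite /M !le_max lexx orbT.
have M2M : M2 <= M by rewrite /M !le_max lexx !orbT.
have [g [sg gK fg]] := trig_approximation cf fK M0 e10.
have [mg _ _] := sg.
have /cvgrPdist_le /(_ _ e10) gcv := trig_stable_cvg sg.
have mcube : measurable (cube M2) by [].
have eQ : `|Ex Q f - Ex Q g| <= e1 + 2 * K * e1.
  apply: (Ex_close mcube mf mg fK gK (ltW e10)) tQ => x /(cubeS M2M) xM.
  by rewrite distrC; exact: fg.
near=> n.
have [D mD [DM PD]] : exists2 D, measurable D & D `<=` Z n @^-1` cube M1 /\ 1 - e1 <= fine (P D).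
  by near: n.
have eP : `|Ex P (f \o Z n) - Ex P (g \o Z n)| <= e1 + 2 * K * e1.
  apply: (Ex_close mD (mfZ n) _ _ _ (ltW e10)) PD.
  - exact: measurableT_comp (mZ n).
  - by move=> t; exact: fK.
  - by move=> t; exact: gK.
  - move=> t /DM /(cubeS M1M) tM; rewrite distrC; exact: fg.
have eg : `|Ex Q g - Ex P (fun t => g (Z n t))| <= e1 by near: n.
have eE : e = 2 * (4 * K + 4) * e1 by rewrite /e1; field; rewrite gt_eqF.
have eg' : `|Ex Q g - Ex P (g \o Z n)| <= e1 by exact: eg.
have := ler_distD (Ex Q g) (Ex Q f) (Ex P (f \o Z n)).
have := ler_distD (Ex P (g \o Z n)) (Ex Q g) (Ex P (f \o Z n)).
rewrite (distrC (Ex P (g \o Z n))) => h1 h2.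
have : `|Ex Q f - Ex P (f \o Z n)| <= 3 * e1 + 4 * (K * e1) by lra.
have : 0 <= K * e1 by rewrite mulr_ge0// ltW.
by move=> h3 /le_trans; apply; rewrite eE; lra.
Unshelve. all: by end_near. Qed.

End levy.

(** * Deterministic analysis of the adaptive LASSO *)

Section positive_definite.
Context {R : realType}.
Variable m : nat.
Implicit Types (C : 'M[R]_m) (x : 'cV[R]_m).

Lemma pos_def_psd C : pos_def C -> psd C.
Proof.
move=> [symC posC]; split=> // x; have [->|x0] := eqVneq x 0; last exact/ltW/posC.
by rewrite quad_formE mulmx0 /dotp mulmx0 mxE.
Qed.

Lemma pos_def_unit C : pos_def C -> C \in unitmx.
Proof.
move=> [symC posC]; rewrite -row_free_unit -kermx_eq0; apply/rowV0P => v.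
move=> /sub_kermxP vC; apply/eqP/negPn/negP => v0.
have := posC v^T; rewrite trmx_eq0 => /(_ v0).
by rewrite /quad_form trmxK vC mul0mx mxE ltxx.
Qed.

(** Cauchy-Schwarz in the form [C] applied to $x_k = (C^{-1} e_k)^T C x$. *)
Lemma pos_def_coercive C : pos_def C ->
  exists2 kappa, 0 < kappa & forall x, \sum_k x k 0 ^+ 2 <= kappa * quad_form C x.
Proof.
move=> pC; have pC' := pos_def_psd pC; have uC := pos_def_unit pC.
pose w k : 'cV[R]_m := invmx C *m delta_mx k 0.
exists (1 + \sum_k quad_form C (w k)).
  by rewrite ltr_pwDl// sumr_ge0// => k _; exact: pC'.2.
move=> x; apply: (@le_trans _ _ (\sum_k quad_form C (w k) * quad_form C x)).
  apply: ler_sum => k _; have := psd_cauchy_schwarz (w k) x pC'.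
  have -> : dotp (w k) (C *m x) = x k 0.
    rewrite dotp_mx pC.1 /w mulmxA mulmxV// mul1mx dotpE (bigD1 k)//= big1.
      by rewrite !mxE !eqxx mul1r addr0.
    by move=> j jk; rewrite !mxE (negbTE jk) mul0r.
  by [].
by rewrite -mulr_suml mulrDl mul1r lerDr pC'.2.
Qed.

Lemma sqr_sum_norm_le x : (\sum_k `|x k 0|) ^+ 2 <= m%:R * \sum_k x k 0 ^+ 2.
Proof.
have -> : m%:R * (\sum_k x k 0 ^+ 2) = \sum_(i < m) \sum_(j < m) (x i 0 ^+ 2 + x j 0 ^+ 2) / 2.
  rewrite [RHS](eq_bigr (fun i => (m%:R * x i 0 ^+ 2 + \sum_j x j 0 ^+ 2) / 2)).
    rewrite -mulr_suml big_split /= -mulr_sumr sumr_const card_ord.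
    by rewrite -(mulr_natl (\sum_j x j 0 ^+ 2)); field.
  move=> i _; rewrite -mulr_suml big_split /= sumr_const card_ord.
  by rewrite -(mulr_natl (x i 0 ^+ 2)).
rewrite expr2 mulr_suml; apply: ler_sum => i _; rewrite mulr_sumr; apply: ler_sum => j _.
rewrite -[x i 0 ^+ 2]real_normK ?num_real// -[x j 0 ^+ 2]real_normK ?num_real//.
have := sqr_ge0 (`|x i 0| - `|x j 0|); rewrite sqrrB; lra.
Qed.

Lemma quad_form_sum C x : quad_form C x = \sum_i \sum_j x i 0 * C i j * x j 0.
Proof.
rewrite quad_formE dotpE; apply: eq_bigr => i _; rewrite mxE mulr_sumr.
by apply: eq_bigr => j _; rewrite mulrA.
Qed.

(** An entrywise perturbation costs at most $\eta\|x\|_1^2 \le \eta m\|x\|_2^2$. *)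
Lemma quad_form_perturb C C' x (eta : R) : 0 <= eta ->
  (forall i j, `|C' i j - C i j| <= eta) ->
  quad_form C x - eta * m%:R * \sum_k x k 0 ^+ 2 <= quad_form C' x.
Proof.
move=> eta0 CC; rewrite lerBlDr -lerBlDl.
have -> : quad_form C x - quad_form C' x = \sum_i \sum_j x i 0 * (C i j - C' i j) * x j 0.
  rewrite !quad_form_sum -sumrB; apply: eq_bigr => i _; rewrite -sumrB.
  by apply: eq_bigr => j _; rewrite mulrBr mulrBl.
apply: (@le_trans _ _ (eta * (\sum_k `|x k 0|) ^+ 2)); last first.
  by rewrite -mulrA ler_wpM2l// sqr_sum_norm_le.
rewrite expr2 mulr_suml mulr_sumr; apply: ler_sum => i _.
rewrite mulr_sumr mulr_sumr; apply: ler_sum => j _.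
rewrite (le_trans (ler_norm _))// !normrM mulrAC mulrC ler_wpM2r ?mulr_ge0//.
by rewrite distrC.
Qed.

End positive_definite.

Section adaptive_lasso_sample.
Context {R : realType}.
Variables (n m : nat) (Y : 'cV[R]_n) (D : 'M[R]_(n, m)).
Variables (init sigma b : 'cV[R]_m) (lam : R).
Hypothesis n0 : (0 < n)%N.
Hypothesis lam0 : 0 < lam.
Hypothesis lasso_b : is_adaptive_lasso Y D init lam b.

Let N : R := n%:R.
Let N0 : 0 < N. Proof. by rewrite ltr0n. Qed.
Let r : R := Num.sqrt N.
Let r0 : 0 < r. Proof. by rewrite sqrtr_gt0. Qed.
Let rr : r * r = N. Proof. by rewrite -expr2 sqr_sqrtr// ltW. Qed.

Definition gram : 'M[R]_m := n%:R^-1 *: (D^T *m D).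
Definition score : 'cV[R]_m := (Num.sqrt n%:R)^-1 *: (D^T *m (Y - D *m sigma)).
Definition scaled_error : 'cV[R]_m := Num.sqrt n%:R *: (b - sigma).

Lemma l2norm_sqr k (x : 'cV[R]_k) : l2norm x ^+ 2 = dotp x x.
Proof.
rewrite /l2norm sqr_sqrtr; first by rewrite dotpE; apply: eq_bigr => i _; rewrite expr2.
by apply: sumr_ge0 => i _; exact: sqr_ge0.
Qed.

(** Steps are of size $n^{-1/2}$ because the estimator is compared with points at
    this distance: perturbations of one coordinate, and the true value. *)
Lemma loss_increment (x h : 'cV[R]_m) :
  N^-1 * l2norm (Y - D *m (x + r^-1 *: h)) ^+ 2 - N^-1 * l2norm (Y - D *m x) ^+ 2 =
  N^-1 * (quad_form gram h -
    2 * dotp h (r^-1 *: (D^T *m (Y - D *m x)))).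
Proof.
have rn : r != 0 by rewrite gt_eqF.
rewrite -mulrBr; congr (_ * _); rewrite !l2norm_sqr.
have -> : Y - D *m (x + r^-1 *: h) = (Y - D *m x) + (- r^-1) *: (D *m h).
  by rewrite mulmxDr -scalemxAr opprD addrA scaleNr.
move: (Y - D *m x) => e.
rewrite !dotpDl !dotpDr !dotpZl !dotpZr (dotpC e (D *m h)).
have -> : dotp (D *m h) e = dotp h (D^T *m e).
  by rewrite /dotp trmx_mul mulmxA.
have -> : quad_form gram h = N^-1 * dotp (D *m h) (D *m h).
  rewrite quad_formE /gram -scalemxAl dotpZr; congr (_ * _).
  by rewrite /dotp trmx_mul !mulmxA.
by rewrite -rr; field.
Qed.

Lemma objective_increment (x h : 'cV[R]_m) :
  lasso_objective Y D init lam (x + r^-1 *: h) - lasso_objective Y D init lam x =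
  N^-1 * (quad_form gram h - 2 * dotp h (r^-1 *: (D^T *m (Y - D *m x)))) +
  2 * lam * \sum_k (`|(x + r^-1 *: h) k 0| - `|x k 0|) / `|init k 0|.
Proof.
rewrite /lasso_objective opprD addrACA loss_increment; congr (_ + _).
rewrite -mulrBr -sumrB; congr (_ * _); apply: eq_bigr => k _.
by rewrite -mulrBl.
Qed.

Lemma score_residual : r^-1 *: (D^T *m (Y - D *m b)) = score - gram *m scaled_error.
Proof.
have rn : r != 0 by rewrite gt_eqF.
rewrite /score /gram /scaled_error -/r -/N -scalemxAr -!scalemxAl.
rewrite scalerA (_ : r * N^-1 = r^-1); last by rewrite -rr; field.
rewrite -scalerBr -mulmxA -mulmxBr; congr (_ *: (_ *m _)).
by rewrite mulmxBr opprB addrA subrK.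
Qed.

(** Stationarity in a coordinate that the estimator does not kill: the
    objective restricted to it is differentiable at [b]. *)
Lemma lasso_stationary k : b k 0 != 0 ->
  (score - gram *m scaled_error) k 0 = r * lam * Num.sg (b k 0) / `|init k 0|.
Proof.
move=> bk0; have [feas_b min_b] := lasso_b.
have ik0 : init k 0 != 0 by apply: contra_neq bk0; exact: feas_b.
have ikp : 0 < `|init k 0| by rewrite normr_gt0.
have bkp : 0 < `|b k 0| by rewrite normr_gt0.
apply/eqP; rewrite -subr_eq0; apply/negPn/negP; set X := _ - _ => X0.
have X0' : 0 < `|X| by rewrite normr_gt0.
have ineq s : `|s| <= r * `|b k 0| -> 2 * s * X <= s ^+ 2 * gram k k.
  move=> sb; pose h : 'cV[R]_m := s *: delta_mx k 0.
  have rsb : `|r^-1 * s| <= `|b k 0|.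
    by rewrite normrM normfV (gtr0_norm r0) ler_pdivrMl.
  have hE j : (b + r^-1 *: h) j 0 = b j 0 + (if j == k then r^-1 * s else 0).
    by rewrite !mxE; case: eqP => _; rewrite /= ?mulr1 ?mulr0.
  have fb : lasso_feasible init (b + r^-1 *: h).
    move=> j ij; rewrite hE; have [jk|jk] := eqVneq j k.
      by rewrite jk in ij; rewrite ij eqxx in ik0.
    by rewrite addr0; exact: feas_b.
  have : 0 <= lasso_objective Y D init lam (b + r^-1 *: h) - lasso_objective Y D init lam b.
    by rewrite subr_ge0; exact: min_b.
  rewrite objective_increment score_residual.
  rewrite (bigD1 k)//= big1 ?addr0; last first.
    by move=> j jk; rewrite hE (negbTE jk) addr0 subrr mul0r.
  rewrite hE eqxx.
  have -> : `|b k 0 + r^-1 * s| - `|b k 0| = Num.sg (b k 0) * (r^-1 * s).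
    move: rsb; rewrite ler_norml; have [b_gt0|b_lt0|b0] := ltrgtP 0 (b k 0).
    - rewrite (gtr0_norm b_gt0) gtr0_sg// mul1r => /andP[h1 h2].
      by rewrite ger0_norm; lra.
    - rewrite (ltr0_norm b_lt0) ltr0_sg// mulN1r => /andP[h1 h2].
      by rewrite ler0_norm; lra.
    - by rewrite -b0 eqxx in bk0.
  have -> : quad_form gram h = s ^+ 2 * gram k k.
    by rewrite quad_formE /h -scalemxAr dotpZl dotpZr -quad_formE quad_form_delta mulrA.
  have -> : dotp h (score - gram *m scaled_error) = s * (score - gram *m scaled_error) k 0.
    by rewrite dotpZl /dotp trmx_delta -rowE mxE.
  have -> : (score - gram *m scaled_error) k 0 = X + r * lam * Num.sg (b k 0) / `|init k 0|.
    by rewrite /X subrK.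
  have -> : N^-1 * (s ^+ 2 * gram k k - 2 * (s * (X + r * lam * Num.sg (b k 0) / `|init k 0|))) +
      2 * lam * (Num.sg (b k 0) * (r^-1 * s) / `|init k 0|) =
      N^-1 * (s ^+ 2 * gram k k - 2 * s * X).
    by rewrite -rr; field; rewrite !gt_eqF.
  by rewrite pmulr_rge0 ?invr_gt0// subr_ge0.
have g0 : 0 <= gram k k.
  rewrite /gram !mxE; apply: mulr_ge0; first by rewrite invr_ge0 ltW.
  by apply: sumr_ge0 => i _; rewrite mxE -expr2 sqr_ge0.
pose t := Num.min (r * `|b k 0|) (`|X| / (gram k k + 1)).
have g1 : 0 < gram k k + 1 by lra.
have t0 : 0 < t by rewrite lt_min mulr_gt0//= divr_gt0.
have tb : t <= r * `|b k 0| by rewrite ge_min lexx.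
have tX : t * (gram k k + 1) <= `|X|.
  by rewrite -ler_pdivlMr// ge_min lexx orbT.
have := ineq (Num.sg X * t).
rewrite normrM normr_sg X0 mul1r (gtr0_norm t0) => /(_ tb).
rewrite exprMn sqr_sg X0 mul1r.
have -> : 2 * (Num.sg X * t) * X = 2 * t * `|X| by rewrite [in RHS]normrEsg; ring.
have h1 : t * (t * (gram k k + 1)) <= t * `|X| by rewrite ler_wpM2l// ltW.
have h2 : 0 < t * `|X| by rewrite mulr_gt0.
have h3 : 0 < t * t by rewrite mulr_gt0.
by rewrite expr2; lra.
Qed.

(** Comparison of the estimator with the true value, which is feasible as soon as
    [init] does not vanish on its support. *)
Lemma lasso_basic_inequality : (forall k, sigma k 0 != 0 -> init k 0 != 0) ->
  quad_form gram scaled_error <=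
  2 * \sum_k `|score k 0| * `|scaled_error k 0| +
  2 * \sum_(k | sigma k 0 != 0) r * lam / `|init k 0| * `|scaled_error k 0|.
Proof.
move=> init_n0; have [feas_b min_b] := lasso_b.
have rn : r != 0 by rewrite gt_eqF.
have fs : lasso_feasible init sigma.
  by move=> k ik; apply/eqP/negPn/negP => /init_n0; rewrite ik eqxx.
have bE : b = sigma + r^-1 *: scaled_error.
  by rewrite /scaled_error scalerA mulVf// scale1r addrC subrK.
have : lasso_objective Y D init lam (sigma + r^-1 *: scaled_error)
    - lasso_objective Y D init lam sigma <= 0.
  by rewrite -bE subr_le0; exact: min_b.
rewrite objective_increment -bE -/score.
set pen := \sum_k _ => H.
have penS : - (\sum_(k | sigma k 0 != 0) r^-1 / `|init k 0| * `|scaled_error k 0|) <= pen.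
  rewrite -sumrN big_mkcond /=; apply: ler_sum => k _.
  have bk : b k 0 = sigma k 0 + r^-1 * scaled_error k 0 by rewrite {1}bE !mxE.
  case: ifPn => [sk|/negPn/eqP sk].
    rewrite mulrAC -mulNr ler_wpM2r ?invr_ge0//.
    have -> : r^-1 * `|scaled_error k 0| = `|sigma k 0 - b k 0|.
      by rewrite bk opprD addrA subrr add0r normrN normrM gtr0_norm ?invr_gt0.
    by rewrite lerNl opprB lerBlDl -{1}(subrK (b k 0) (sigma k 0)) addrC ler_normD.
  by rewrite sk normr0 subr0 divr_ge0.
have gs : - (\sum_k `|score k 0| * `|scaled_error k 0|) <= - dotp scaled_error score.
  rewrite lerN2 dotpE; apply: ler_sum => k _.
  by rewrite (le_trans (ler_norm _))// normrM mulrC.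
have H2 : quad_form gram scaled_error - 2 * dotp scaled_error score + 2 * lam * N * pen <= 0.
  have := H; rewrite -(ler_pM2l N0) mulr0 mulrDr mulrA divff ?gt_eqF// mul1r.
  by rewrite (_ : N * (2 * lam * pen) = 2 * lam * N * pen)//; ring.
have H3 : - (\sum_(k | sigma k 0 != 0) r * lam / `|init k 0| * `|scaled_error k 0|)
    <= lam * N * pen.
  apply: le_trans (ler_wpM2l _ penS); last by rewrite mulr_ge0// ltW.
  rewrite mulrN mulr_sumr lerN2; apply: ler_sum => k _.
  by rewrite !mulrA (_ : lam * N / r = r * lam)// -rr; field.
by lra.
Qed.

End adaptive_lasso_sample.

Section good_event.
Context {R : realType}.
Variables (n m : nat) (Y : 'cV[R]_n) (D : 'M[R]_(n, m)).
Variables (init sigma b : 'cV[R]_m) (lam : R).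
Hypothesis n0 : (0 < n)%N.
Hypothesis lam0 : 0 < lam.
Hypothesis lasso_b : is_adaptive_lasso Y D init lam b.
Local Notation r := (Num.sqrt (n%:R : R)).
Local Notation delta := (scaled_error n sigma b).
Local Notation u := (score Y D sigma).

Variables (C : 'M[R]_m) (kappa eta c U V K : R).
Hypothesis kappa0 : 0 < kappa.
Hypothesis coercive : forall x : 'cV[R]_m, \sum_k x k 0 ^+ 2 <= kappa * quad_form C x.
Hypothesis eta0 : 0 <= eta.
Hypothesis eta_small : eta * m%:R * (2 * kappa) <= 1.
Hypothesis c0 : 0 < c.
Hypothesis V0 : 0 < V.
Hypothesis gram_close : forall i j, `|gram D i j - C i j| <= eta.
Hypothesis score_bound : forall k, `|u k 0| <= U.
Hypothesis init_large : forall k, sigma k 0 != 0 -> c <= `|init k 0|.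
Hypothesis init_small : forall k, sigma k 0 = 0 -> r * `|init k 0| <= V.
Hypothesis sigma_large : forall k, sigma k 0 != 0 -> c <= `|sigma k 0|.
Hypothesis C_bound : forall k, \sum_j `|C k j| + eta * m%:R <= K.

(** The basic inequality bounds the quadratic form of the scaled error by $2(U+1)$
    times its $\ell_1$ norm $s$, and coercivity bounds it below by $s^2/(2m\kappa)$. *)
Definition error_bound : R := 4 * kappa * m%:R * (U + 1).

Hypothesis lam_small : r * lam <= c.
Hypothesis lam_large : U + K * error_bound < n%:R * lam / V.
Hypothesis n_large : error_bound < r * c.

Let N0 : 0 < n%:R :> R. Proof. by rewrite ltr0n. Qed.
Let r0 : 0 < r. Proof. by rewrite sqrtr_gt0. Qed.
Let rr : r * r = n%:R. Proof. by rewrite -expr2 sqr_sqrtr// ltW. Qed.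

Let init_n0 k : sigma k 0 != 0 -> init k 0 != 0.
Proof. by move=> /init_large h; rewrite -normr_gt0; exact: lt_le_trans h. Qed.

Let penalty_le1 k : sigma k 0 != 0 -> r * lam / `|init k 0| <= r * lam / c.
Proof.
move=> sk; rewrite ler_wpM2l ?mulr_ge0 ?(ltW r0) ?(ltW lam0)//.
by rewrite lef_pV2 ?posrE// ?init_large// normr_gt0 init_n0.
Qed.

Let sum_delta : \sum_k `|delta k 0| <= error_bound.
Proof.
set s := \sum_k _; have s0 : 0 <= s by rewrite sumr_ge0.
have [->|sn0] := eqVneq s 0.
  have [m0|mp] := posnP m.
    by rewrite /error_bound m0 mulr0 mul0r.
  have U0 : 0 <= U by exact: le_trans (normr_ge0 _) (score_bound (Ordinal mp)).
  by rewrite /error_bound !mulr_ge0// ?(ltW kappa0)// addr_ge0.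
have sp : 0 < s by rewrite lt_def sn0.
pose q := \sum_k delta k 0 ^+ 2.
have q0 : 0 <= q by rewrite sumr_ge0// => k _; exact: sqr_ge0.
have sq : s ^+ 2 <= m%:R * q by exact: sqr_sum_norm_le.
have qC := coercive delta; rewrite -/q in qC.
have qG := quad_form_perturb delta eta0 gram_close; rewrite -/q in qG.
have basic := lasso_basic_inequality n0 lam0 lasso_b init_n0.
have S1 : \sum_k `|u k 0| * `|delta k 0| <= U * s.
  by rewrite mulr_sumr; apply: ler_sum => k _; rewrite ler_wpM2r.
have S2 : \sum_(k | sigma k 0 != 0) r * lam / `|init k 0| * `|delta k 0| <= s.
  rewrite /s [leRHS](bigID (fun k => sigma k 0 != 0))/=.
  apply: (@le_trans _ _ (\sum_(k | sigma k 0 != 0) `|delta k 0|)); last first.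
    by rewrite lerDl sumr_ge0.
  apply: ler_sum => k sk; rewrite ler_piMl// (le_trans (penalty_le1 sk))//.
  by rewrite ler_pdivrMr// mul1r.
set qf := quad_form C delta in qC qG; set qg := quad_form _ delta in qG basic.
have h1 : q <= 2 * kappa * qg.
  have : kappa * (qf - eta * m%:R * q) <= kappa * qg by rewrite ler_wpM2l// ltW.
  have : eta * m%:R * (2 * kappa) * q <= 1 * q by rewrite ler_wpM2r.
  lra.
have h2 : qg <= 2 * ((U + 1) * s) by lra.
have h3 : q <= 4 * kappa * ((U + 1) * s).
  have : 2 * kappa * qg <= 2 * kappa * (2 * ((U + 1) * s)).
    by rewrite ler_wpM2l// mulr_ge0// ltW.
  lra.
have h4 : s * s <= error_bound * s.
  rewrite -expr2; apply: le_trans sq _.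
  have : m%:R * q <= m%:R * (4 * kappa * ((U + 1) * s)) by rewrite ler_wpM2l.
  by rewrite /error_bound; lra.
by rewrite ler_pM2r in h4.
Qed.

Lemma delta_bound k : `|delta k 0| <= error_bound.
Proof.
apply: le_trans sum_delta; rewrite (bigD1 k)//= lerDl.
by rewrite sumr_ge0.
Qed.

Let gram_delta_close k : `|(gram D *m delta) k 0 - (C *m delta) k 0| <= eta * m%:R * error_bound.
Proof.
rewrite !mxE -sumrB (le_trans (ler_norm_sum _ _ _))//.
apply: (@le_trans _ _ (\sum_(j < m) eta * error_bound)).
  apply: ler_sum => j _; rewrite -mulrBl normrM ler_pM//; exact: delta_bound.
by rewrite sumr_const card_ord -(mulr_natr (eta * error_bound)) mulrAC.
Qed.

Let gram_delta_bound k : `|(gram D *m delta) k 0| <= K * error_bound.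
Proof.
have E0 : 0 <= error_bound by exact: le_trans (normr_ge0 _) (delta_bound k).
apply: (@le_trans _ _ ((\sum_j `|C k j| + eta * m%:R) * error_bound)); last first.
  by rewrite ler_wpM2r.
have -> : (gram D *m delta) k 0 =
  (C *m delta) k 0 + ((gram D *m delta) k 0 - (C *m delta) k 0) by ring.
rewrite mulrDl (le_trans (ler_normD _ _))// lerD//.
rewrite mxE (le_trans (ler_norm_sum _ _ _))// mulr_suml; apply: ler_sum => j _.
rewrite normrM ler_pM//; exact: delta_bound.
Qed.

Let bE k : b k 0 = sigma k 0 + r^-1 * delta k 0.
Proof.
have -> : delta k 0 = r * (b k 0 - sigma k 0) by rewrite !mxE.
by field; rewrite gt_eqF.
Qed.

(** A nonzero coordinate off the support would have a penalty of order
    $n\lambda_n/V$ in its stationarity equation, more than the score and the Gram matrix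
    can balance. *)
Lemma lasso_kills k : sigma k 0 = 0 -> b k 0 = 0.
Proof.
move=> sk; apply/eqP/negPn/negP => bk.
have ik0 : init k 0 != 0.
  by apply: contra_neq bk => ik; have [feas _] := lasso_b; exact: feas.
have ikp : 0 < `|init k 0| by rewrite normr_gt0.
have := lasso_stationary sigma n0 lasso_b bk => /(congr1 (fun x : R => `|x|)).
rewrite !normrM normr_sg bk mulr1 normfV normr_id (gtr0_norm lam0) (gtr0_norm r0).
move=> E1; have : r * lam / `|init k 0| <= U + K * error_bound.
  rewrite -E1 [X in `|X|]mxE [X in `|_ + X|]mxE.
  by rewrite (le_trans (ler_normB _ _))// lerD.
move=> /le_lt_trans/(_ lam_large); apply/negP; rewrite -leNgt.
rewrite ler_pdivrMr// mulrAC ler_pdivlMr//.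
have := init_small sk; have rl : 0 < r * lam by rewrite mulr_gt0.
have -> : n%:R * lam * `|init k 0| = r * lam * (r * `|init k 0|) by rewrite -{1}rr; ring.
by move=> h; rewrite ler_wpM2l// ltW.
Qed.

Lemma lasso_sign : sign_vec b = sign_vec sigma.
Proof.
apply/matrixP => k j; rewrite !mxE (ord1 j).
have [sk|sk] := eqVneq (sigma k 0) 0; first by rewrite (lasso_kills sk) sk.
have close : `|r^-1 * delta k 0| < `|sigma k 0|.
  rewrite normrM normfV (gtr0_norm r0) ltr_pdivrMl//.
  apply: le_lt_trans (delta_bound k) _; apply: lt_le_trans n_large _.
  by rewrite ler_wpM2l ?sigma_large// ltW.
rewrite bE; move: (r^-1 * _) close => x.
have [sp|sn|s0] := ltrgtP 0 (sigma k 0); last by rewrite -s0 eqxx in sk.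
- rewrite (gtr0_norm sp) ltr_norml => /andP[h1 h2].
  by rewrite !gtr0_sg//; lra.
- rewrite (ltr0_norm sn) ltr_norml opprK => /andP[h1 h2].
  by rewrite !ltr0_sg//; lra.
Qed.

(** On the support the penalty term of the stationarity equation is
    $O(\sqrt n\lambda_n)$. *)
Lemma lasso_linearization k : sigma k 0 != 0 ->
  `|(C *m delta) k 0 - u k 0| <= r * lam / c + eta * m%:R * error_bound.
Proof.
move=> sk; have bk : b k 0 != 0.
  have := congr1 (fun x : 'cV[R]_m => x k 0) lasso_sign; rewrite !mxE => h.
  by rewrite -sgr_eq0 h sgr_eq0.
have := lasso_stationary sigma n0 lasso_b bk => /(congr1 (fun x : R => `|x|)).
rewrite !normrM normr_sg bk mulr1 normfV normr_id (gtr0_norm lam0) (gtr0_norm r0).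
rewrite [X in `|X|]mxE [X in `|_ + X|]mxE => E1.
have -> : (C *m delta) k 0 - u k 0 =
  - (u k 0 - (gram D *m delta) k 0) - ((gram D *m delta) k 0 - (C *m delta) k 0) by ring.
rewrite (le_trans (ler_normB _ _))// lerD//.
by rewrite normrN E1; exact: penalty_le1.
Qed.

End good_event.

(** * Square-integrable and separable functions *)

Section square_integrable.
Context {R : realType} {d : measure_display} {T : measurableType d}.
Variable P : probability T R.
Implicit Types f g : T -> R.

Definition L2 f : Prop := measurable_fun [set: T] f /\ integ P (fun t => f t ^+ 2).

Lemma L2_mul f g : L2 f -> L2 g -> integ P (fun t => f t * g t).
Proof.
move=> [mf f2] [mg g2]; apply: (integ_le _ _ (integD f2 g2)).
  exact: measurable_funM.
move=> t; rewrite normrM -[f t ^+ 2]real_normK ?num_real// -[g t ^+ 2]real_normK ?num_real//.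
have := sqr_ge0 (`|f t| - `|g t|); rewrite sqrrB.
have := mulr_ge0 (normr_ge0 (f t)) (normr_ge0 (g t)); lra.
Qed.

Lemma L2_integ f : L2 f -> integ P f.
Proof. by move=> [mf f2]; exact: integ_of_sqr. Qed.

Lemma L2_cst (c : R) : L2 (fun=> c).
Proof. by split; [exact: measurable_cst|exact: integ_cst]. Qed.

Lemma L2Z (c : R) f : L2 f -> L2 (fun t => c * f t).
Proof.
move=> [mf f2]; split; first exact: measurable_funM.
by under [X in EFin \o X]eq_fun do rewrite exprMn; exact: integZ.
Qed.

Lemma L2D f g : L2 f -> L2 g -> L2 (fun t => f t + g t).
Proof.
move=> lf lg; have [mf f2] := lf; have [mg g2] := lg.
split; first exact: measurable_funD.
have fg := L2_mul lf lg.
rewrite (_ : (fun t => (f t + g t) ^+ 2) = (fun t => f t ^+ 2 + 2 * (f t * g t) + g t ^+ 2)).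
  by apply: integD => //; apply: integD => //; exact: integZ.
by apply/funext => t; ring.
Qed.

Lemma L2_sum (I : Type) (s : seq I) (F : I -> T -> R) :
  (forall i, L2 (F i)) -> L2 (fun t => \sum_(i <- s) F i t).
Proof.
move=> LF; elim: s => [|i s IH].
  rewrite (_ : (fun t => _) = fun=> 0); first exact: L2_cst.
  by apply/funext => t; rewrite big_nil.
rewrite (_ : (fun t => _) = fun t => F i t + \sum_(j <- s) F j t); first exact: L2D.
by apply/funext => t; rewrite big_cons.
Qed.

Lemma L2_eq f g : f =1 g -> L2 f -> L2 g.
Proof. by move=> /funext ->. Qed.

Lemma L2_prod_of_fourth f g : measurable_fun [set: T] f -> measurable_fun [set: T] g ->
  integ P (fun t => f t ^+ 4) -> integ P (fun t => g t ^+ 4) ->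
  L2 (fun t => f t * g t).
Proof.
move=> mf mg f4 g4; split; first exact: measurable_funM.
apply: (integ_le _ _ (integD f4 g4)).
  by apply: measurable_funX; exact: measurable_funM.
move=> t; rewrite ger0_norm ?sqr_ge0//.
have := sqr_ge0 (f t ^+ 2 - g t ^+ 2); have := sqr_ge0 (f t * g t).
rewrite exprMn sqrrB -!exprM; lra.
Qed.

Lemma integ_pow_of_Lfun n f : (0 < n)%N -> f \in Lfun P (n%:R)%:E ->
  measurable_fun [set: T] f /\ integ P (fun t => `|f t| ^+ n).
Proof.
move=> n0 lf; have mf : measurable_fun setT f.
  by move: lf; rewrite inE => /andP[/[!inE]/=].
split=> //; have := Lfun_integrable _ lf; rewrite ler1n => /(_ n0).
congr (integrable _ _ _); apply/funext => t /=.
by rewrite powR_mulrn.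
Qed.

End square_integrable.

Section separable.
Context {R : realType} {d d1 d2 : measure_display}.
Context {T : measurableType d} {E1 : measurableType d1} {E2 : measurableType d2}.
Variables (P : probability T R) (X : T -> E1) (A : T -> E2).
Hypotheses (mX : measurable_fun [set: T] X) (mA : measurable_fun [set: T] A).
Hypothesis indXA : independent2 P X A.

Lemma Ex_separable (F : E1 -> R) (G : E2 -> R) :
  measurable_fun [set: E1] F -> measurable_fun [set: E2] G ->
  integ P (fun t => F (X t)) -> integ P (fun t => G (A t)) ->
  integ P (fun t => F (X t) * G (A t)) /\
  Ex P (fun t => F (X t) * G (A t)) = Ex P (fun t => F (X t)) * Ex P (fun t => G (A t)).
Proof.
move=> mF mG iF iG.
have ind : independent2 P (fun t => F (X t)) (fun t => G (A t)).
  exact: (independent2_comp (X := X) (Y := A) mF mG indXA).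
by split; [exact: integM_indep|exact: ExM_indep].
Qed.

Variable m : nat.
Variables (F : 'I_m -> E1 -> R) (G : 'I_m -> E2 -> R).
Hypotheses (mF : forall l, measurable_fun [set: E1] (F l))
           (mG : forall l, measurable_fun [set: E2] (G l)).
Hypotheses (F2 : forall l, L2 P (fun t => F l (X t)))
           (G2 : forall l, L2 P (fun t => G l (A t))).

(** The score of the model has this form, with weights depending on the regressors
    and centered functions of the coefficients; independence reduces its moments to
    products. *)
Definition separable (z : E1 * E2) : R := \sum_l F l z.1 * G l z.2.

Lemma measurable_separable : measurable_fun [set: E1 * E2] separable.
Proof.
apply: measurable_sum => l; apply: measurable_funM.
  exact: (measurableT_comp (mF l) measurable_fst).
exact: (measurableT_comp (mG l) measurable_snd).
Qed.

Lemma Ex_separable_sum :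
  Ex P (fun t => separable (X t, A t)) =
  \sum_l Ex P (fun t => F l (X t)) * Ex P (fun t => G l (A t)).
Proof.
have H l := Ex_separable (mF l) (mG l) (L2_integ (F2 l)) (L2_integ (G2 l)).
rewrite /separable Ex_sum => [|l]; last by have [] := H l.
by apply: eq_bigr => l _; have [_] := H l.
Qed.

Let H2 l k := Ex_separable (measurable_funM (mF l) (mF k)) (measurable_funM (mG l) (mG k))
  (L2_mul (F2 l) (F2 k)) (L2_mul (G2 l) (G2 k)).

Let sqrE t : separable (X t, A t) ^+ 2 =
  \sum_l \sum_k F l (X t) * F k (X t) * (G l (A t) * G k (A t)).
Proof.
rewrite expr2 /separable mulr_suml; apply: eq_bigr => l _.
by rewrite mulr_sumr; apply: eq_bigr => k _ /=; rewrite mulrACA.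
Qed.

Lemma L2_separable : L2 P (fun t => separable (X t, A t)).
Proof.
split.
  apply: (measurableT_comp measurable_separable (g := fun t => (X t, A t))).
  exact: measurable_fun_pair.
under [Y in EFin \o Y]eq_fun do rewrite sqrE.
by apply: integ_sum => l; apply: integ_sum => k; have [] := H2 l k.
Qed.

Lemma Ex_separable_sqr :
  Ex P (fun t => separable (X t, A t) ^+ 2) =
  \sum_l \sum_k Ex P (fun t => F l (X t) * F k (X t)) *
                Ex P (fun t => G l (A t) * G k (A t)).
Proof.
under eq_Rintegral do rewrite sqrE.
rewrite Ex_sum => [|l]; last by apply: integ_sum => k; have [] := H2 l k.
apply: eq_bigr => l _; rewrite Ex_sum => [|k]; last by have [] := H2 l k.
by apply: eq_bigr => k _; have [_] := H2 l k.
Qed.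

End separable.

(** * Score and noise of the random coefficient model *)

Section quadratic_monomials.
Context {R : realType}.
Variable p : nat.
Implicit Types (x : 'cV[R]_p) (k : 'I_(hdim p)).

Definition mono_coef k : R := if (hvec_index k).1 == (hvec_index k).2 then 1 else 2.

Lemma qvecE x k :
  qvec x k 0 = mono_coef k * (x (hvec_index k).1 0 * x (hvec_index k).2 0).
Proof.
rewrite mxE /mono_coef; case: (hvec_index k) => i j /=.
by case: eqP => [->|_]; rewrite ?mul1r ?expr2 ?mulrA.
Qed.

Lemma measurable_qvec k : measurable_fun [set: 'cV[R]_p] (fun x => qvec x k 0).
Proof.
under eq_fun do rewrite qvecE.
by apply: measurable_funM => //; apply: measurable_funM; exact: measurable_coord.
Qed.

End quadratic_monomials.

Section sample_expansion.
Context {R : realType}.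
Variables (p n : nat) (x alpha : nat -> 'cV[R]_p) (mu muhat : 'cV[R]_p).
Variable Sigma : 'M[R]_p.
Hypothesis n0 : (0 < n)%N.
Let y i := dotp (x i) (alpha i).
Let D := design_sigma n x.

(** The [l]-th entry of $\mathrm{vec}((a-\mu)(a-\mu)^T - \Sigma)$. *)
Definition centered_square (l : 'I_(hdim p)) (a : 'cV[R]_p) : R :=
  (a (hvec_index l).1 0 - mu (hvec_index l).1 0) *
  (a (hvec_index l).2 0 - mu (hvec_index l).2 0) -
  Sigma (hvec_index l).1 (hvec_index l).2.

(** Both sides are the quadratic form of $(a-\mu)(a-\mu)^T - \Sigma$ at [z]. *)
Lemma noiseE (z a : 'cV[R]_p) :
  (dotp z a - dotp z mu) ^+ 2 - dotp (qvec z) (vech Sigma) =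
  \sum_l qvec z l 0 * centered_square l a.
Proof.
have -> : dotp z a - dotp z mu = dotp z (a - mu).
  by rewrite dotpDr -[- mu]scaleN1r dotpZr mulN1r.
have -> : dotp z (a - mu) ^+ 2 = quad_form ((a - mu) *m (a - mu)^T) z.
  have := quad_form_rank1 0 (a - mu) z; rewrite quad_form0 !sub0r.
  rewrite {1}/quad_form mulmxN mulNmx mxE -/(quad_form _ z) => /oppr_inj ->.
  by [].
rewrite quad_form_vech; last by rewrite trmx_mul trmxK.
rewrite !dotpE -sumrB; apply: eq_bigr => l _; rewrite -mulrBr; congr (_ * _).
by rewrite !mxE big_ord1 !mxE.
Qed.

Lemma gramE k l : gram D k l = n%:R^-1 * \sum_(i < n) qvec (x i) k 0 * qvec (x i) l 0.
Proof.
rewrite /gram mxE; congr (_ * _); rewrite mxE; apply: eq_bigr => i _.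
by rewrite mxE /D /design_sigma !mxE.
Qed.

Let dm := Num.sqrt n%:R *: (muhat - mu).

(** The squared residual at [muhat] expands around [mu] into the noise, a term linear
    and a term quadratic in the estimation error; the powers of [n] are distributed so
    that the error appears only in the scaled form [dm]. *)
Lemma score_expansion k :
  score (response_sigma n x y muhat) D (vech Sigma) k 0 =
  (Num.sqrt n%:R)^-1 * \sum_(i < n) \sum_l
     qvec (x i) k 0 * qvec (x i) l 0 * centered_square l (alpha i)
  + \sum_j (- 2 * (n%:R^-1 * \sum_(i < n) \sum_l
      qvec (x i) k 0 * (x i j 0 * x i l 0) * (alpha i l 0 - mu l 0))) * dm j 0
  + (Num.sqrt n%:R)^-1 * \sum_j \sum_l (n%:R^-1 * \sum_(i < n)
      qvec (x i) k 0 * (x i j 0 * x i l 0)) * (dm j 0 * dm l 0).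
Proof.
pose r : R := Num.sqrt n%:R.
have r0 : r != 0 by rewrite gt_eqF// sqrtr_gt0 ltr0n.
have nE : n%:R = r * r by rewrite -expr2 sqr_sqrtr.
rewrite /score [LHS]mxE.
have -> : (D^T *m (response_sigma n x y muhat - D *m vech Sigma)) k 0 =
    \sum_(i < n) qvec (x i) k 0 * ((y i - dotp (x i) muhat) ^+ 2 - dotp (qvec (x i)) (vech Sigma)).
  rewrite mxE; apply: eq_bigr => i _.
  rewrite /D /design_sigma !mxE; congr (_ * (_ - _)).
  by rewrite dotpE; apply: eq_bigr => l _; rewrite !mxE.
have resid i : (y i - dotp (x i) muhat) ^+ 2 - dotp (qvec (x i)) (vech Sigma) =
    \sum_l qvec (x i) l 0 * centered_square l (alpha i)
    - 2 * (dotp (x i) (alpha i - mu) * (r^-1 * dotp (x i) dm))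
    + (r^-1 * dotp (x i) dm) ^+ 2.
  rewrite -noiseE.
  have -> : dotp (x i) muhat = dotp (x i) mu + r^-1 * dotp (x i) dm.
    rewrite /dm -/r dotpZr mulKf// dotpDr -[- mu]scaleN1r dotpZr; ring.
  have -> : dotp (x i) (alpha i - mu) = y i - dotp (x i) mu.
    by rewrite dotpDr -[- mu]scaleN1r dotpZr mulN1r.
  by rewrite /y; ring.
have -> : \sum_(i < n) qvec (x i) k 0 * ((y i - dotp (x i) muhat) ^+ 2 - dotp (qvec (x i)) (vech Sigma)) =
   \sum_(i < n) \sum_l qvec (x i) k 0 * qvec (x i) l 0 * centered_square l (alpha i)
   - 2 * r^-1 * \sum_(i < n) qvec (x i) k 0 * dotp (x i) (alpha i - mu) * dotp (x i) dm
   + r^-1 * r^-1 * \sum_(i < n) qvec (x i) k 0 * dotp (x i) dm * dotp (x i) dm.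
  rewrite !mulr_sumr -sumrB -big_split /=; apply: eq_bigr => i _.
  rewrite resid [in LHS]mulrDr [in LHS]mulrBr mulr_sumr; congr (_ - _ + _).
  - by apply: eq_bigr => l _; rewrite mulrA.
  - ring.
  - ring.
rewrite -/r mulrDr mulrBr; congr (_ + _).
- congr (_ + _).
  rewrite -mulNr -/r; under [RHS]eq_bigr => j _ do rewrite nE.
  have -> : \sum_(i < n) qvec (x i) k 0 * dotp (x i) (alpha i - mu) * dotp (x i) dm =
      \sum_j (\sum_(i < n) \sum_l qvec (x i) k 0 * (x i j 0 * x i l 0) * (alpha i l 0 - mu l 0)) * dm j 0.
    under [RHS]eq_bigr do rewrite mulr_suml.
    rewrite exchange_big /=; apply: eq_bigr => i _; rewrite [dotp (x i) dm]dotpE mulr_sumr.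
    apply: eq_bigr => j _; rewrite dotpE mulr_sumr !mulr_suml; apply: eq_bigr => l _.
    by rewrite !mxE; ring.
  rewrite mulrA mulr_sumr; apply: eq_bigr => j _; field.
  exact: r0.
- congr (_ * _).
  rewrite nE.
  have -> : \sum_(i < n) qvec (x i) k 0 * dotp (x i) dm * dotp (x i) dm =
      \sum_j \sum_l (\sum_(i < n) qvec (x i) k 0 * (x i j 0 * x i l 0)) * (dm j 0 * dm l 0).
    under [RHS]eq_bigr => j _.
      under eq_bigr => l _ do rewrite mulr_suml.
      rewrite exchange_big /=; over.
    rewrite exchange_big /=; apply: eq_bigr => i _.
    rewrite -mulrA dotpE mulr_suml mulr_sumr; apply: eq_bigr => j _.
    rewrite mulrA mulr_sumr; apply: eq_bigr => l _; ring.
  rewrite -invfM mulr_sumr; apply: eq_bigr => j _; rewrite mulr_sumr.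
  by apply: eq_bigr => l _; rewrite mulrA.
Qed.

End sample_expansion.

Section model_moments.
Context {R : realType} {d : measure_display} {T : measurableType d}.
Variables (P : probability T R) (p : nat) (X A : T -> 'cV[R]_p).
Hypotheses (mX : measurable_fun [set: T] X) (mA : measurable_fun [set: T] A).
Hypothesis indXA : independent2 P X A.
Hypotheses (A4 : finite_moment P 4 A) (X8 : finite_moment P 8 X).

Local Notation mu := (mu_star P A).
Local Notation Sigma := (cov_mx P A).
Local Notation m := (hdim p).
Local Notation w := (centered_square mu Sigma).

Lemma fine_expectation (f : T -> R) : fine ('E_P[f])%E = Ex P f.
Proof. by rewrite unlock. Qed.

Lemma fine_covariance (f g : T -> R) :
  fine (covariance P f g) = Ex P (fun t => (f t - Ex P f) * (g t - Ex P g)).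
Proof. by rewrite covariance.unlock !fine_expectation. Qed.

Let mXi i : measurable_fun [set: T] (fun t => X t i 0).
Proof. exact: measurableT_comp (@measurable_coord _ _ _ i 0) mX. Qed.

Let mAi i : measurable_fun [set: T] (fun t => A t i 0).
Proof. exact: measurableT_comp (@measurable_coord _ _ _ i 0) mA. Qed.

(** Squares of products of four coordinates are dominated by eighth powers. *)
Lemma L2_quartic i j k l : L2 P (fun t => (X t i 0 * X t j 0) * (X t k 0 * X t l 0)).
Proof.
have X8' a : integ P (fun t => X t a 0 ^+ 8).
  have [_] := integ_pow_of_Lfun (n := 8) isT (X8 a).
  congr (integrable _ _ _); apply/funext => t /=.
  by rewrite -normrX ger0_norm// (exprM _ 4 2) sqr_ge0.
have X4 a b : integ P (fun t => (X t a 0 * X t b 0) ^+ 4).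
  apply: (integ_le _ _ (integD (X8' a) (X8' b))).
    by apply: measurable_funX; exact: measurable_funM.
  move=> t; rewrite (exprM _ 2 2) ger0_norm ?sqr_ge0//.
  have := sqr_ge0 (X t a 0 ^+ 4 - X t b 0 ^+ 4).
  have := sqr_ge0 ((X t a 0 * X t b 0) ^+ 2).
  rewrite sqrrB -!exprM !exprMn; lra.
by apply: L2_prod_of_fourth => //; exact: measurable_funM.
Qed.

Lemma L2_qvec_pair k i j : L2 P (fun t => qvec (X t) k 0 * (X t i 0 * X t j 0)).
Proof.
apply: L2_eq (L2Z (mono_coef k)
  (L2_quartic (hvec_index k).1 (hvec_index k).2 i j)) => t.
by rewrite qvecE mulrA.
Qed.

Lemma L2_qvec_qvec k l : L2 P (fun t => qvec (X t) k 0 * qvec (X t) l 0).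
Proof.
apply: L2_eq (L2Z (mono_coef l)
  (L2_qvec_pair k (hvec_index l).1 (hvec_index l).2)) => t.
by rewrite [in RHS](qvecE (X t) l) mulrCA.
Qed.

Let muE i : mu i 0 = Ex P (fun t => A t i 0).
Proof. by rewrite mxE fine_expectation. Qed.

Let SigmaE i j : Sigma i j = Ex P (fun t => (A t i 0 - mu i 0) * (A t j 0 - mu j 0)).
Proof. by rewrite mxE fine_covariance !muE. Qed.

Let A4' i : integ P (fun t => (A t i 0 - mu i 0) ^+ 4).
Proof.
have iA : integ P (fun t => A t i 0 ^+ 4).
  have [_] := integ_pow_of_Lfun (n := 4) isT (A4 i).
  congr (integrable _ _ _); apply/funext => t /=.
  by rewrite -normrX ger0_norm// (exprM _ 2 2) sqr_ge0.
have iD := integZ 8 (integD iA (integ_cst P (mu i 0 ^+ 4))).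
apply: (integ_le _ _ iD); first by apply: measurable_funX; exact: measurable_funB.
move=> t; rewrite (exprM _ 2 2) ger0_norm ?sqr_ge0//.
set a := A t i 0; set b := mu i 0.
have h1 : (a - b) ^+ 2 <= 2 * (a ^+ 2 + b ^+ 2) by have := sqr_ge0 (a + b); nra.
have h2 : ((a - b) ^+ 2) ^+ 2 <= (2 * (a ^+ 2 + b ^+ 2)) ^+ 2.
  by rewrite ler_sqr// nnegrE ?sqr_ge0// mulr_ge0// addr_ge0 ?sqr_ge0.
apply: le_trans h2 _; have := sqr_ge0 (a ^+ 2 - b ^+ 2); nra.
Qed.

Let L2_centered_pair i j : L2 P (fun t => (A t i 0 - mu i 0) * (A t j 0 - mu j 0)).
Proof. by apply: L2_prod_of_fourth => //; exact: measurable_funB. Qed.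

Lemma L2_centered i : L2 P (fun t => A t i 0 - mu i 0).
Proof.
split; first exact: measurable_funB.
by under [Y in EFin \o Y]eq_fun do rewrite expr2; exact: L2_integ (L2_centered_pair i i).
Qed.

Lemma Ex_centered i : Ex P (fun t => A t i 0 - mu i 0) = 0.
Proof.
have iA : integ P (fun t => A t i 0).
  have := integD (L2_integ (L2_centered i)) (integ_cst P (mu i 0)).
  by under [Y in EFin \o Y]eq_fun do rewrite subrK.
by rewrite ExB ?Ex_cst ?muE ?subrr//; exact: integ_cst.
Qed.

Lemma L2_centered_square l : L2 P (fun t => w l (A t)).
Proof. exact: L2D (L2_centered_pair _ _) (L2_cst P (- Sigma _ _)). Qed.

Lemma Ex_centered_square l : Ex P (fun t => w l (A t)) = 0.
Proof.
rewrite ExB; [|exact: L2_integ (L2_centered_pair _ _)|exact: integ_cst].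
by rewrite Ex_cst SigmaE subrr.
Qed.

Lemma Ex_centered_squareM k l :
  Ex P (fun t => w k (A t) * w l (A t)) = Psi_star P A k l.
Proof. by rewrite 4![RHS]mxE fine_covariance /centered_square !SigmaE. Qed.

Lemma measurable_centered_square l : measurable_fun [set: 'cV[R]_p] (w l).
Proof.
apply: measurable_funB => //.
by apply: measurable_funM; apply: measurable_funB => //; exact: measurable_coord.
Qed.

Section noise_score.
Variable c : 'cV[R]_m.

Definition noise_weight (l : 'I_m) (x : 'cV[R]_p) : R := dotp c (qvec x) * qvec x l 0.

(** The summand of the score in the direction [c]: $c^T v(x)$ times the noise. *)
Definition noise_score : 'cV[R]_p * 'cV[R]_p -> R := separable noise_weight w.

Let noise_weightE l x :
  noise_weight l x = \sum_k c k 0 * (qvec x k 0 * qvec x l 0).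
Proof. by rewrite /noise_weight dotpE mulr_suml; apply: eq_bigr => k _; rewrite mulrA. Qed.

Lemma measurable_noise_weight l : measurable_fun [set: 'cV[R]_p] (noise_weight l).
Proof.
rewrite (_ : noise_weight l = fun x => \sum_k c k 0 * (qvec x k 0 * qvec x l 0)).
  apply: measurable_sum => k; apply: measurable_funM => //.
  by apply: measurable_funM; exact: measurable_qvec.
by apply/funext => x; rewrite noise_weightE.
Qed.

Let L2_noise_weight l : L2 P (fun t => noise_weight l (X t)).
Proof.
apply: L2_eq (L2_sum _ (fun k => L2Z (c k 0) (L2_qvec_qvec k l))) => t.
by rewrite noise_weightE.
Qed.

Lemma measurable_noise_score : measurable_fun [set: 'cV[R]_p * 'cV[R]_p] noise_score.
Proof.
by apply: measurable_separable => l;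
  [exact: measurable_noise_weight|exact: measurable_centered_square].
Qed.

Lemma L2_noise_score : L2 P (fun t => noise_score (X t, A t)).
Proof.
apply: L2_separable => // l.
- exact: measurable_noise_weight.
- exact: measurable_centered_square.
- exact: L2_centered_square.
Qed.

Lemma Ex_noise_score : Ex P (fun t => noise_score (X t, A t)) = 0.
Proof.
rewrite (Ex_separable_sum indXA)//; first last.
- exact: L2_centered_square.
- exact: measurable_centered_square.
- exact: measurable_noise_weight.
by rewrite big1// => l _; rewrite Ex_centered_square mulr0.
Qed.

Let Ex_weights l k : Ex P (fun t => noise_weight l (X t) * noise_weight k (X t)) =
  \sum_(ij : 'I_m * 'I_m) c ij.1 0 * c ij.2 0 *
    Ex P (fun t => (qvec (X t) ij.1 0 * qvec (X t) l 0) * (qvec (X t) ij.2 0 * qvec (X t) k 0)).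
Proof.
have iq (ij : 'I_m * 'I_m) : integ P (fun t => (qvec (X t) ij.1 0 * qvec (X t) l 0) *
    (qvec (X t) ij.2 0 * qvec (X t) k 0)).
  by apply: L2_mul; exact: L2_qvec_qvec.
under [RHS]eq_bigr => ij _ do rewrite -(ExZ _ (iq ij)).
rewrite -Ex_sum; last by move=> ij; exact: integZ.
apply: eq_Rintegral => t _; rewrite !noise_weightE mulr_suml.
rewrite -(pair_bigA _ (fun i j => c i 0 * c j 0 *
  (qvec (X t) i 0 * qvec (X t) l 0 * (qvec (X t) j 0 * qvec (X t) k 0))))/=.
apply: eq_bigr => i _; rewrite mulr_sumr; apply: eq_bigr => j _; ring.
Qed.

(** Given the regressors, the noise has the conditional variance
    $v(X)^\top \Psi^* v(X)$. *)
Lemma Ex_noise_score_sqr :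
  Ex P (fun t => noise_score (X t, A t) ^+ 2) = quad_form (B_sigma P X A) c.
Proof.
rewrite (Ex_separable_sqr indXA)//; first last.
- exact: L2_centered_square.
- exact: measurable_centered_square.
- exact: measurable_noise_weight.
rewrite quad_form_sum.
have BE i j : B_sigma P X A i j = \sum_(lk : 'I_m * 'I_m) Psi_star P A lk.1 lk.2 *
    Ex P (fun t => (qvec (X t) i 0 * qvec (X t) lk.1 0) * (qvec (X t) j 0 * qvec (X t) lk.2 0)).
  have iq (lk : 'I_m * 'I_m) : integ P (fun t => (qvec (X t) i 0 * qvec (X t) lk.1 0) *
      (qvec (X t) j 0 * qvec (X t) lk.2 0)).
    by apply: L2_mul; exact: L2_qvec_qvec.
  rewrite mxE fine_expectation.
  under [RHS]eq_bigr => lk _ do rewrite -(ExZ _ (iq lk)).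
  rewrite -Ex_sum; last by move=> lk; exact: integZ.
  apply: eq_Rintegral => t _; rewrite mxE [in LHS]mxE big_ord1 quad_form_sum.
  rewrite -(pair_bigA _ (fun l k => Psi_star P A l k *
    (qvec (X t) i 0 * qvec (X t) l 0 * (qvec (X t) j 0 * qvec (X t) k 0))))/=.
  rewrite mulr_suml; apply: eq_bigr => l _; rewrite mulr_suml; apply: eq_bigr => k _.
  by rewrite [(qvec (X t))^T 0 j]mxE; ring.
under eq_bigr => l _ do under eq_bigr => k _ do
  rewrite Ex_weights Ex_centered_squareM.
rewrite pair_bigA [RHS]pair_bigA /=.
under eq_bigr do rewrite mulr_suml.
under [RHS]eq_bigr do rewrite BE mulr_sumr mulr_suml.
rewrite exchange_big /=; apply: eq_bigr => ij _; apply: eq_bigr => lk _; ring.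
Qed.

End noise_score.

End model_moments.

(** * Coordinate selection and Slutsky's lemma *)

Section selection.
Context {R : realType}.
Variables (m : nat) (S : {set 'I_m}).

(** As a matrix product, restriction to [S] composes with the other linear maps. *)
Definition selmx : 'M[R]_(#|S|, m) := rowsub enum_val 1%:M.

Lemma subvectorE (x : 'cV[R]_m) : subvector S x = selmx *m x.
Proof. by rewrite /subvector rowsubE. Qed.

Lemma mul_selmxT n (M : 'M[R]_(n, m)) : M *m selmx^T = colsub enum_val M.
Proof.
apply/matrixP => i j; rewrite !mxE (bigD1 (enum_val j))//= big1 => [|k kj].
  by rewrite !mxE eqxx mulr1 addr0.
by rewrite !mxE eq_sym (negbTE kj) mulr0.
Qed.

Lemma principal_submxE (M : 'M[R]_m) : principal_submx S M = selmx *m M *m selmx^T.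
Proof. by rewrite mul_selmxT -rowsubE; apply/matrixP => i j; rewrite !mxE. Qed.

Lemma selmxK : selmx *m selmx^T = 1%:M.
Proof.
rewrite mul_selmxT; apply/matrixP => i j; rewrite !mxE.
by rewrite (inj_eq enum_val_inj).
Qed.

Lemma selmxTK (x : 'cV[R]_m) : (forall k, k \notin S -> x k 0 = 0) ->
  selmx^T *m (selmx *m x) = x.
Proof.
move=> x0; apply/matrixP => k j; rewrite (ord1 j) -subvectorE mxE.
under eq_bigr do rewrite !mxE.
rewrite -(big_enum_val (fun l => (l == k)%:R * x l 0)) /=.
have [kS|kS] := boolP (k \in S).
  rewrite (bigD1 k)//= eqxx mul1r big1 ?addr0// => l /andP[_ lk].
  by rewrite (negbTE lk) mul0r.
rewrite x0// big1// => l lS; have [lk|] := eqVneq l k; last by rewrite mul0r.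
by rewrite lk (negbTE kS) in lS.
Qed.

Lemma quad_form_selmx (M : 'M[R]_m) (y : 'cV[R]_#|S|) :
  quad_form (principal_submx S M) y = quad_form M (selmx^T *m y).
Proof. by rewrite principal_submxE /quad_form trmx_mul trmxK !mulmxA. Qed.

Lemma pos_def_principal (M : 'M[R]_m) : pos_def M -> pos_def (principal_submx S M).
Proof.
move=> [symM posM]; split.
  by rewrite principal_submxE !trmx_mul trmxK symM mulmxA.
move=> y y0; rewrite quad_form_selmx; apply: posM.
apply: contra_neq y0 => h; rewrite -(mul1mx y) -selmxK -mulmxA h mulmx0.
by [].
Qed.

End selection.

Section in_probability.
Context {R : realType} {d : measure_display} {T : measurableType d}.
Variable P : probability T R.

Lemma oP_eq_near (Y Z : nat -> T -> R) : (\forall n \near \oo, forall t, Y n t = Z n t) ->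
  oP P Z -> oP P Y.
Proof.
move=> YZ oZ eta e eta0 e0; apply: whpS (oZ eta e eta0 e0).
by apply: filterS YZ => n YZ t /=; rewrite YZ.
Qed.

Lemma OP_norm (Z : nat -> T -> R) : OP P Z -> OP P (fun n t => `|Z n t|).
Proof. by apply: OP_le => n t; rewrite normr_id. Qed.

Lemma oP_norm (Z : nat -> T -> R) : oP P Z -> oP P (fun n t => `|Z n t|).
Proof. by apply: oP_le => n t; rewrite normr_id. Qed.

Lemma oPZ (c : R) (Z : nat -> T -> R) : oP P Z -> oP P (fun n t => c * Z n t).
Proof.
by move=> oZ; apply: oP_eq (oPM oZ (OP_cst P c)) => n t; rewrite mulrC.
Qed.

Lemma l2norm_ge_coord n (x : 'cV[R]_n) k : `|x k 0| <= l2norm x.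
Proof.
rewrite -sqrtr_sqr /l2norm ler_wsqrtr// (bigD1 k)//= lerDl sumr_ge0// => i _.
exact: sqr_ge0.
Qed.

Lemma bounded_in_probability_OP k (Z : nat -> T -> 'cV[R]_k) i :
  (forall n, measurable_fun [set: T] (Z n)) -> bounded_in_probability P Z ->
  OP P (fun n t => Z n t i 0).
Proof.
move=> mZ bZ e e0; have [M HM] := bZ e e0; exists M.
have mZn n : measurable [set t | l2norm (Z n t) <= M].
  rewrite -[X in measurable X]setTI; apply: (measurable_fun_le measurableT) => //.
  have ms : measurable_fun [set: R] (@Num.sqrt R).
    by apply: continuous_measurable_fun; exact: sqrt_continuous.
  apply: (measurableT_comp ms); apply: measurable_sum => j.
  by apply: measurable_funX; exact: measurableT_comp (@measurable_coord _ _ _ j 0) (mZ n).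
have : whp P e (fun n => [set t | l2norm (Z n t) <= M]).
  apply: whp_compl => //; apply: filterS HM => n.
  rewrite (_ : ~` _ = [set t | M < l2norm (Z n t)]); last first.
    by apply/seteqP; split => t /=; rewrite ltNge => /negP.
  move=> h; rewrite -lee_fin fineK//; apply: fin_num_measure.
  rewrite (_ : [set t | _] = ~` [set t | l2norm (Z n t) <= M]); first exact: measurableC.
  by apply/seteqP; split => t /=; rewrite ltNge => /negP.
apply: whpS; apply: nearW => n t /=; exact: le_trans (l2norm_ge_coord _ _).
Qed.

(** Slutsky's lemma for characteristic functions: cosine and sine are bounded and
    1-Lipschitz. *)
Lemma oP_cos_sin (Y Z : nat -> T -> R) : (forall n, measurable_fun [set: T] (Y n)) ->
  (forall n, measurable_fun [set: T] (Z n)) -> oP P (fun n t => Y n t - Z n t) ->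
  (Ex P (fun t => cos (Y n t)) - Ex P (fun t => cos (Z n t)) @[n --> \oo] --> 0) /\
  (Ex P (fun t => sin (Y n t)) - Ex P (fun t => sin (Z n t)) @[n --> \oo] --> 0).
Proof.
move=> mY mZ oYZ.
have mc : measurable_fun [set: R] (@cos R).
  exact: (continuous_measurable_fun (@continuous_cos R)).
have ms : measurable_fun [set: R] (@sin R).
  exact: (continuous_measurable_fun (@continuous_sin R)).
have sinu (x : R) : `|sin x| <= `|x|.
  wlog x0 : x / 0 <= x.
    move=> H; have [x0|x0] := leP 0 x; first exact: H.
    by have := H (- x); rewrite sinN !normrN; apply; rewrite oppr_ge0 ltW.
  have := sin_le x0; have := sin_ge_cubic x0; have := sin_geN1 x; have := sin_le1 x.
  rewrite (ger0_norm x0) ler_norml => h1 h2 h3 h4; apply/andP; split=> //.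
  have [x1|x1] := leP x 1; last lra.
  suff : x ^+ 3 <= x by lra.
  by rewrite exprS ler_piMr// expr_le1.
(* half-sum and half-difference, as in the sum-to-product formulas *)
have half (f : R -> R) : (forall p q, `|f (p + q) - f (p - q)| <= 2 * `|q|) ->
    forall x y, `|f x - f y| <= `|x - y|.
  move=> H x y; have := H ((x + y) / 2) ((x - y) / 2).
  rewrite (_ : (x + y) / 2 + (x - y) / 2 = x); last by field.
  rewrite (_ : (x + y) / 2 - (x - y) / 2 = y); last by field.
  by rewrite normrM (@ger0_norm _ 2^-1) ?invr_ge0// mulrCA divff ?mulr1// pnatr_eq0.
have lip_cos : forall x y : R, `|cos x - cos y| <= `|x - y|.
  apply: half => p q; rewrite cosD cosB.
  rewrite (_ : _ - _ = - (2 * (sin p * sin q))); last by ring.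
  by rewrite normrN !normrM ger0_norm// ler_pM2l// -[leRHS]mul1r ler_pM// sin_max.
have lip_sin : forall x y : R, `|sin x - sin y| <= `|x - y|.
  apply: half => p q; rewrite sinD sinB.
  rewrite (_ : _ - _ = 2 * (cos p * sin q)); last by ring.
  by rewrite !normrM ger0_norm// ler_pM2l// -[leRHS]mul1r ler_pM// cos_max.
have main (f : R -> R) : measurable_fun [set: R] f -> (forall x, `|f x| <= 1) ->
    (forall x y, `|f x - f y| <= `|x - y|) ->
    Ex P (fun t => f (Y n t)) - Ex P (fun t => f (Z n t)) @[n --> \oo] --> 0.
  move=> mf f1 lipf; apply/cvgr0Pnorm_le => e e0.
  have e3 : 0 < e / 3 by rewrite divr_gt0.
  apply: filterS (oYZ _ _ e3 e3) => n [D mD [DYZ PD]].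
  have -> : e = e / 3 + 2 * 1 * (e / 3) by field.
  apply: (Ex_close mD) PD => //.
  - exact: measurableT_comp (mY n).
  - exact: measurableT_comp (mZ n).
  - exact: ltW.
  - by move=> t /DYZ /=; exact: le_trans.
split; first exact: (main cos mc (@cos_max R)).
exact: (main sin ms (@sin_max R)).
Qed.

End in_probability.

(** * Asymptotics of the Gram matrix and of the score *)

Section sample_asymptotics.
Context {R : realType} {d : measure_display} {T : measurableType d}.
Variables (P : probability T R) (p : nat) (X A : T -> 'cV[R]_p).
Variables (Xs As muhat : nat -> T -> 'cV[R]_p).
Hypotheses (mX : measurable_fun [set: T] X) (mA : measurable_fun [set: T] A).
Hypotheses (mXs : forall i, measurable_fun [set: T] (Xs i))
           (mAs : forall i, measurable_fun [set: T] (As i))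
           (mmuhat : forall n, measurable_fun [set: T] (muhat n)).
Hypothesis indXA : independent2 P X A.
Hypothesis indZ : mutually_independent P (fun i t => (Xs i t, As i t)).
Hypothesis lawZ : forall i, same_law P (fun t => (Xs i t, As i t)) (fun t => (X t, A t)).
Hypotheses (A4 : finite_moment P 4 A) (X8 : finite_moment P 8 X).
Local Notation mu := (mu_star P A).
Local Notation Sigma := (cov_mx P A).
Local Notation sigma := (sigma_star P A).
Local Notation m := (hdim p).
Hypothesis muhat_rate : bounded_in_probability P
  (fun n t => Num.sqrt n%:R *: (muhat n t - mu)).

Let Zs i t := (Xs i t, As i t).
Let Z t := (X t, A t).

Let mZs i : measurable_fun [set: T] (Zs i).
Proof. exact: measurable_fun_pair. Qed.

Let mZ : measurable_fun [set: T] Z.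
Proof. exact: measurable_fun_pair. Qed.

Let LLN (h : 'cV[R]_p * 'cV[R]_p -> R) : measurable_fun [set: 'cV[R]_p * 'cV[R]_p] h ->
  L2 P (fun t => h (X t, A t)) ->
  oP P (fun n t => n%:R^-1 * \sum_(i < n) h (Xs i t, As i t) - Ex P (fun t => h (X t, A t))).
Proof. by move=> mh [_ h2]; exact: (weak_law mZs mZ indZ lawZ mh h2). Qed.

Definition sample_gram n t : 'M[R]_m := gram (design_sigma n (Xs^~ t)).

Definition sample_score n t : 'cV[R]_m :=
  score (response_sigma n (Xs^~ t) (fun i => dotp (Xs i t) (As i t)) (muhat n t))
    (design_sigma n (Xs^~ t)) sigma.

Let mfst (f : 'cV[R]_p -> R) : measurable_fun [set: 'cV[R]_p] f ->
  measurable_fun [set: 'cV[R]_p * 'cV[R]_p] (fun z => f z.1).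
Proof. by move=> mf; exact: measurableT_comp mf measurable_fst. Qed.

Lemma sample_gram_oP k l : oP P (fun n t => sample_gram n t k l - C_sigma P X k l).
Proof.
have -> : C_sigma P X k l = Ex P (fun t => qvec (X t) k 0 * qvec (X t) l 0).
  rewrite mxE fine_expectation; apply: eq_Rintegral => t _.
  by rewrite mxE big_ord1 [(qvec (X t))^T 0 l]mxE.
have := LLN (h := fun z => qvec z.1 k 0 * qvec z.1 l 0) _ (L2_qvec_qvec mX X8 k l).
have mh : measurable_fun [set: 'cV[R]_p * 'cV[R]_p]
    (fun z : 'cV[R]_p * 'cV[R]_p => qvec z.1 k 0 * qvec z.1 l 0).
  apply: (mfst (f := fun x => qvec x k 0 * qvec x l 0)).
  by apply: measurable_funM; exact: measurable_qvec.
by move=> /(_ mh); apply: oP_eq => n t; rewrite /sample_gram gramE.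
Qed.

Let dm n t : 'cV[R]_p := Num.sqrt n%:R *: (muhat n t - mu).

Let dm_OP j : OP P (fun n t => dm n t j 0).
Proof.
apply: (@bounded_in_probability_OP _ _ _ P p dm j _ muhat_rate) => n.
apply: measurable_fun_matrix => i j'.
rewrite (_ : (fun t => _) = (fun t => Num.sqrt n%:R * (muhat n t i j' - mu i j'))).
  apply: measurable_funM => //; apply: measurable_funB => //.
  exact: measurableT_comp (@measurable_coord _ _ _ i j') (mmuhat n).
by apply/funext => t; rewrite /dm !mxE.
Qed.

Let sqrtn_oP : oP P (fun n (_ : T) => (Num.sqrt n%:R)^-1).
Proof.
apply: oP_cvg; apply: (cvg_eq (v := fun n => 1 / Num.sqrt n%:R)) => [n|//|].
  by rewrite mul1r.
exact: cvg_div_sqrt.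
Qed.

(** A linear form of the score is asymptotically a normalized i.i.d. sum: the
    error of [muhat] enters linearly with a centered, hence asymptotically
    negligible, coefficient, and quadratically with the factor $n^{-1/2}$. *)
Lemma sample_score_linear c :
  oP P (fun n t => dotp c (sample_score n t) -
    (Num.sqrt n%:R)^-1 * \sum_(i < n) noise_score P A c (Xs i t, As i t)).
Proof.
pose lin k j n t := - 2 * (n%:R^-1 * \sum_(i < n) \sum_l
  qvec (Xs i t) k 0 * (Xs i t j 0 * Xs i t l 0) * (As i t l 0 - mu l 0)).
pose qua k j l n t := n%:R^-1 * \sum_(i < n)
  qvec (Xs i t) k 0 * (Xs i t j 0 * Xs i t l 0).
have mq k j l : measurable_fun [set: 'cV[R]_p] (fun x => qvec x k 0 * (x j 0 * x l 0)).
  apply: measurable_funM; first exact: measurable_qvec.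
  by apply: measurable_funM; exact: measurable_coord.
have mc l : measurable_fun [set: 'cV[R]_p] (fun a => a l 0 - mu l 0).
  by apply: measurable_funB => //; exact: measurable_coord.
have lin_oP k j : oP P (lin k j).
  apply: oPZ.
  have Lq l : L2 P (fun t => qvec (X t) k 0 * (X t j 0 * X t l 0)) by exact: L2_qvec_pair.
  have Lc l := L2_centered mA A4 l.
  have := LLN (measurable_separable (mq k j) mc)
    (L2_separable mX mA indXA (mq k j) mc Lq Lc).
  rewrite (Ex_separable_sum indXA (mq k j) mc Lq Lc) big1 => [|l _].
    by apply: oP_eq => n t; rewrite subr0.
  by rewrite (Ex_centered mA A4) mulr0.
have qua_OP k j l : OP P (qua k j l).
  have Lq : L2 P (fun t => qvec (X t) k 0 * (X t j 0 * X t l 0)) by exact: L2_qvec_pair.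
  have := OPD (oP_OP (LLN (mfst (mq k j l)) Lq))
    (OP_cst P (Ex P (fun t => qvec (X t) k 0 * (X t j 0 * X t l 0)))).
  by apply: OP_eq => n t; rewrite subrK.
have rem_oP : oP P (fun n t => \sum_k c k 0 * (\sum_j lin k j n t * dm n t j 0 +
    (Num.sqrt n%:R)^-1 * \sum_j \sum_l qua k j l n t * (dm n t j 0 * dm n t l 0))).
  apply: oP_sum => k; apply: oPZ; apply: oPD.
    by apply: oP_sum => j; exact: oPM.
  apply: oPM => //; apply: OP_sum => j; apply: OP_sum => l.
  by apply: OPM => //; exact: OPM.
apply: oP_eq_near rem_oP; near=> n; move=> t.
have n0 : (0 < n)%N by near: n; exists 1%N.
rewrite dotpE /sample_score.
under eq_bigr => k _ do rewrite (score_expansion (Xs^~ t) (As^~ t) mu (muhat n t) Sigma n0) -addrA mulrDr.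
rewrite big_split /= addrAC; set a := \sum_k _; set b := _ * _.
suff -> : a = b by rewrite subrr add0r.
transitivity (\sum_k (Num.sqrt n%:R)^-1 * (c k 0 * \sum_(i < n) \sum_l
    qvec (Xs i t) k 0 * qvec (Xs i t) l 0 * centered_square mu Sigma l (As i t))).
  by apply: eq_bigr => k _; rewrite mulrCA.
rewrite -mulr_sumr; congr (_ * _).
under [LHS]eq_bigr => k _ do rewrite mulr_sumr.
rewrite exchange_big /=; apply: eq_bigr => i _.
under [LHS]eq_bigr => k _ do rewrite mulr_sumr.
rewrite exchange_big /= /noise_score /separable; apply: eq_bigr => l _ /=.
rewrite /noise_weight dotpE !mulr_suml; apply: eq_bigr => k _.
by rewrite !mulrA.
Unshelve. all: by end_near. Qed.

(** Second moments of a normalized centered i.i.d. sum are constant. *)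
Lemma sample_score_OP k : OP P (fun n t => sample_score n t k 0).
Proof.
pose c : 'cV[R]_m := delta_mx k 0.
have [_ h2] := L2_noise_score mX mA indXA A4 X8 c.
have := OPD (oP_OP (sample_score_linear c)) (OP_normalized_sum mZs mZ indZ lawZ
  (measurable_noise_score P A c) h2 (Ex_noise_score mX mA indXA A4 X8 c)).
apply: OP_eq => n t; rewrite subrK dotpE (bigD1 k)//= big1 ?addr0.
  by rewrite [c k 0]mxE !eqxx mul1r.
by move=> j jk; rewrite [c j 0]mxE (negbTE jk) mul0r.
Qed.

End sample_asymptotics.

(** * Sign consistency and asymptotic normality *)

Section lasso_in_probability.
Context {R : realType} {d : measure_display} {T : measurableType d}.
Variables (P : probability T R) (m : nat).
Variables (Y : forall n, T -> 'cV[R]_n) (D : forall n, T -> 'M[R]_(n, m)).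
Variables (init b : nat -> T -> 'cV[R]_m) (lam : nat -> R).
Variables (sigma : 'cV[R]_m) (C : 'M[R]_m).
Hypothesis lasso_b : forall n t, (0 < n)%N ->
  is_adaptive_lasso (Y n t) (D n t) (init n t) (lam n) (b n t).
Hypothesis lam_gt0 : forall n, (0 < n)%N -> 0 < lam n.
Hypothesis lam_sqrt : Num.sqrt n%:R * lam n @[n --> \oo] --> 0.
Hypothesis lam_n : n%:R * lam n @[n --> \oo] --> +oo.
Hypothesis posC : pos_def C.
Hypothesis gram_oP : forall k l, oP P (fun n t => gram (D n t) k l - C k l).
Hypothesis score_OP : forall k, OP P (fun n t => score (Y n t) (D n t) sigma k 0).
Hypothesis init_OP : forall k,
  OP P (fun n t => Num.sqrt n%:R * (init n t k 0 - sigma k 0)).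

Let delta n t := scaled_error n sigma (b n t).

Lemma near_sqrt_gt (M : R) : \forall n \near \oo, M < Num.sqrt n%:R.
Proof.
near=> n; apply: le_lt_trans (ler_norm M) _.
rewrite -(ger0_norm (sqrtr_ge0 _)) -ltr_sqr ?nnegrE//.
rewrite [X in _ < X ^+ 2]ger0_norm ?sqrtr_ge0// sqr_sqrtr//.
near: n; exact: nbhs_infty_gtr.
Unshelve. all: by end_near. Qed.

(** With probability close to one the deterministic analysis applies, with a
    bound on the scaled error that does not depend on the accuracy [acc] of the
    linearization. *)
Lemma lasso_whp e : 0 < e -> exists M, forall acc, 0 < acc -> whp P e (fun n => [set t |
  [/\ sign_vec (b n t) = sign_vec sigma, forall k, `|delta n t k 0| <= M,
   forall k, sigma k 0 = 0 -> b n t k 0 = 0 &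
   forall k, sigma k 0 != 0 ->
     `|(C *m delta n t) k 0 - score (Y n t) (D n t) sigma k 0| <= acc]]).
Proof.
move=> e0; have e3 : 0 < e / 3 by rewrite divr_gt0.
have [kappa kappa0 coercive] := pos_def_coercive posC.
have [U wU] := OP_sum (index_enum 'I_m) (fun k => OP_norm (score_OP k)) e3.
have [V wV] := OP_sum (index_enum 'I_m) (fun k => OP_norm (init_OP k)) e3.
pose V1 := `|V| + 1; have V10 : 0 < V1 by rewrite ltr_wpDl.
(* at most half of every nonzero entry; a zero entry contributes 2 / 0 = 0 *)
pose c := (1 + \sum_k 2 / `|sigma k 0|)^-1.
have ci0 : 0 < 1 + \sum_k 2 / `|sigma k 0|.
  by rewrite ltr_pwDl// sumr_ge0// => k _; rewrite divr_ge0.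
have c0 : 0 < c by rewrite invr_gt0.
have c2 k : sigma k 0 != 0 -> 2 * c <= `|sigma k 0|.
  move=> sk; have sp : 0 < `|sigma k 0| by rewrite normr_gt0.
  rewrite /c ler_pdivrMr// mulrC -ler_pdivrMr//.
  rewrite (bigD1 k)//= ler_wpDl// lerDl sumr_ge0//.
exists (error_bound m kappa U) => acc acc0; set M := error_bound _ _ _.
(* small enough both for coercivity of the Gram matrix and for [acc] *)
pose eta := (1 + m%:R * (2 * kappa) + m%:R * `|M| * (2 / acc))^-1.
have h1 : 0 <= m%:R * (2 * kappa) by rewrite !mulr_ge0// ltW.
have h2 : 0 <= m%:R * `|M| * (2 / acc) by rewrite !mulr_ge0// invr_ge0 ltW.
have etai : 0 < 1 + m%:R * (2 * kappa) + m%:R * `|M| * (2 / acc) by lra.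
have eta0 : 0 < eta by rewrite invr_gt0.
have eta_kappa : eta * m%:R * (2 * kappa) <= 1.
  rewrite -mulrA mulrC ler_pdivrMr// mul1r; lra.
have eta_acc : eta * m%:R * M <= acc / 2.
  apply: (@le_trans _ _ (eta * (m%:R * `|M|))).
    by rewrite -mulrA ler_wpM2l ?(ltW eta0)// ler_wpM2l// ler_norm.
  rewrite mulrC ler_pdivrMr//.
  have {1}-> : m%:R * `|M| = acc / 2 * (m%:R * `|M| * (2 / acc)) by field; rewrite gt_eqF.
  by rewrite ler_wpM2l ?divr_ge0// ?(ltW acc0)//; lra.
pose K := \sum_k \sum_j `|C k j| + eta * m%:R.
have wG := oP_sum (index_enum 'I_m) (fun k =>
  oP_sum (index_enum 'I_m) (fun l => oP_norm (gram_oP k l))) eta0 e3.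
have -> : e = e / 3 + e / 3 + e / 3 by field.
apply: whpS (whpI (whpI wU wV) wG); near=> n.
move=> t /= [[Ut Vt] Gt].
have n0 : (0 < n)%N by near: n; exists 1%N.
have r0 : 0 < Num.sqrt (n%:R : R) by rewrite sqrtr_gt0 ltr0n.
have le_sum (F : 'I_m -> R) B : `|\sum_k `|F k| | <= B -> forall k, `|F k| <= B.
  move=> FB k; apply: le_trans FB; rewrite [leRHS]ger0_norm ?sumr_ge0// (bigD1 k)//=.
  by rewrite lerDl sumr_ge0.
have gram_close k l : `|gram (D n t) k l - C k l| <= eta.
  apply: le_trans Gt; rewrite [leRHS]ger0_norm; last by rewrite sumr_ge0// => i _; rewrite sumr_ge0.
  rewrite (bigD1 k)//= (bigD1 l)//= -addrA lerDl addr_ge0 ?sumr_ge0// => i _.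
  by rewrite sumr_ge0.
have score_bound := le_sum _ _ Ut.
have init_bound k : `|Num.sqrt n%:R * (init n t k 0 - sigma k 0)| <= V1.
  apply: le_trans (le_sum _ _ Vt k) _.
  by rewrite (le_trans (ler_norm _))// lerDl.
have nV : V1 < Num.sqrt n%:R * c.
  by rewrite -ltr_pdivrMr//; near: n; exact: near_sqrt_gt.
have init_large k : sigma k 0 != 0 -> c <= `|init n t k 0|.
  move=> sk; have := init_bound k; rewrite normrM (gtr0_norm r0).
  rewrite -ler_pdivlMl// => h.
  have h' : (Num.sqrt n%:R)^-1 * V1 <= c by rewrite ler_pdivrMl// ltW.
  have := c2 k sk; have := ler_normD (sigma k 0 - init n t k 0) (init n t k 0).
  rewrite subrK distrC; lra.
have init_small k : sigma k 0 = 0 -> Num.sqrt n%:R * `|init n t k 0| <= V1.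
  by move=> sk; have := init_bound k; rewrite sk subr0 normrM (gtr0_norm r0).
have sigma_large k : sigma k 0 != 0 -> c <= `|sigma k 0|.
  by move=> /c2; lra.
have C_bound k : \sum_j `|C k j| + eta * m%:R <= K.
  by rewrite lerD2r [leRHS](bigD1 k)//= lerDl sumr_ge0// => i _; rewrite sumr_ge0.
have lam_small : Num.sqrt n%:R * lam n <= Num.min c (c * (acc / 2)).
  apply: le_trans (ler_norm _) _; near: n.
  by move/cvgr0Pnorm_le : lam_sqrt; apply; rewrite lt_min c0 mulr_gt0// divr_gt0.
move: lam_small; rewrite le_min => /andP[lam_small lam_acc].
have lam_large : U + K * M < n%:R * lam n / V1.
  by rewrite ltr_pdivlMr//; near: n; move/cvgryPgt : lam_n; apply.
have n_large : M < Num.sqrt n%:R * c.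
  by rewrite -ltr_pdivrMr//; near: n; exact: near_sqrt_gt.
split.
- apply: (lasso_sign (C := C) (kappa := kappa) (eta := eta) (c := c) (U := U) (V := V1) (K := K)
    n0 (lam_gt0 n0) (lasso_b t n0)) => //; exact: ltW.
- move=> k; apply: (delta_bound (C := C) (eta := eta) (c := c)
    n0 (lam_gt0 n0) (lasso_b t n0)) => //; exact: ltW.
- move=> k; apply: (lasso_kills (C := C) (kappa := kappa) (eta := eta) (c := c) (U := U) (V := V1) (K := K)
    n0 (lam_gt0 n0) (lasso_b t n0)) => //; exact: ltW.
- move=> k sk; apply: (@le_trans _ _ (Num.sqrt n%:R * lam n / c + eta * m%:R * M)).
    apply: (lasso_linearization (V := V1) (K := K)
      n0 (lam_gt0 n0) (lasso_b t n0)) => //; exact: ltW.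
  by rewrite [leRHS]splitr lerD// ler_pdivrMr// [leRHS]mulrC.
Unshelve. all: by end_near. Qed.

End lasso_in_probability.

Section normal_characteristic.
Context {R : realType}.
Variables (k : nat) (V : 'M[R]_k) (Q : probability 'cV[R]_k R).
Hypothesis V0 : forall x, 0 <= quad_form V x.
Hypothesis normQ : is_normal 0 V Q.

(** A linear form has a one-dimensional Gaussian law. *)
Lemma is_normal_characteristic a :
  Ex Q (fun x => cos (dotp a x)) = expR (- (quad_form V a / 2)) /\
  Ex Q (fun x => sin (dotp a x)) = 0.
Proof.
pose g : 'cV[R]_k -> measurableTypeR R := dotp a.
have mg : measurable_fun [set: 'cV[R]_k] g by exact: measurable_dotp.
have law D : measurable D -> pushforward Q g D = gauss1 0 (quad_form V a) D.
  move=> mD; have := normQ.2 a D mD.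
  by rewrite (_ : dotp a 0 = 0)//; rewrite /dotp mulmx0 mxE.
have ilaw (f : R -> R) : measurable_fun [set: R] f -> (forall x, `|f x| <= 1) ->
    integ (pushforward Q g) f.
  move=> mf f1; apply/(integ_law (P := Q) mg (Q := pushforward Q g)) => //.
  apply: (@integ_bounded _ _ _ Q _ 1) => [|x]; last exact: f1.
  exact: measurableT_comp mf mg.
have mcos : measurable_fun [set: R] (@cos R).
  exact: (continuous_measurable_fun (@continuous_cos R)).
have msin : measurable_fun [set: R] (@sin R).
  exact: (continuous_measurable_fun (@continuous_sin R)).
split.
  rewrite -(gauss1_cos (V0 a) law) (Ex_law (P := Q) mg)//.
  exact: ilaw (@cos_max R).
rewrite -(gauss1_sin (V0 a) law) (Ex_law (P := Q) mg)//.
exact: ilaw (@sin_max R).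
Qed.

End normal_characteristic.

Section lasso_limit.
Context {R : realType} {d : measure_display} {T : measurableType d}.
Variables (P : probability T R) (m : nat).
Variables (Y : forall n, T -> 'cV[R]_n) (D : forall n, T -> 'M[R]_(n, m)).
Variables (init b : nat -> T -> 'cV[R]_m) (lam : nat -> R).
Variables (sigma : 'cV[R]_m) (C B : 'M[R]_m).
Hypothesis mb : forall n, measurable_fun [set: T] (b n).
Hypothesis lasso_b : forall n t, (0 < n)%N ->
  is_adaptive_lasso (Y n t) (D n t) (init n t) (lam n) (b n t).
Hypothesis lam_gt0 : forall n, (0 < n)%N -> 0 < lam n.
Hypothesis lam_sqrt : Num.sqrt n%:R * lam n @[n --> \oo] --> 0.
Hypothesis lam_n : n%:R * lam n @[n --> \oo] --> +oo.
Hypothesis posC : pos_def C.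
Hypothesis gram_oP : forall k l, oP P (fun n t => gram (D n t) k l - C k l).
Hypothesis score_OP : forall k, OP P (fun n t => score (Y n t) (D n t) sigma k 0).
Hypothesis init_OP : forall k,
  OP P (fun n t => Num.sqrt n%:R * (init n t k 0 - sigma k 0)).

Local Notation u := (fun n t => score (Y n t) (D n t) sigma).
Let delta n t := scaled_error n sigma (b n t).
Let whp_event := lasso_whp lasso_b lam_gt0 lam_sqrt lam_n posC gram_oP score_OP init_OP.

Let measurable_b n k : measurable_fun [set: T] (fun t => b n t k 0).
Proof. exact: measurableT_comp (@measurable_coord _ _ _ k 0) (mb n). Qed.

Let measurable_sign n : measurable [set t | sign_vec (b n t) = sign_vec sigma].
Proof.
have -> : [set t | sign_vec (b n t) = sign_vec sigma] = \bigcap_(k in [set: 'I_m])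
    ([set t | (0 < b n t k 0) = (0 < sigma k 0)] `&`
     [set t | (b n t k 0 < 0) = (sigma k 0 < 0)]).
  apply/seteqP; split => t /=.
    move=> /matrixP H k _; have := H k 0; rewrite !mxE => h.
    by split=> /=; rewrite -?(sgr_gt0 (b n t k 0)) -?(sgr_lt0 (b n t k 0)) h ?sgr_gt0 ?sgr_lt0.
  move=> H; apply/matrixP => k j; rewrite !mxE (ord1 j); have /= [] := H k I.
  by case: (ltrgtP 0 (b n t k 0)) => [s|s|s]; case: (ltrgtP 0 (sigma k 0)) => [s'|s'|s'] // _ _;
    rewrite ?(gtr0_sg s) ?(gtr0_sg s') ?(ltr0_sg s) ?(ltr0_sg s') -?s -?s'.
apply: fin_bigcap_measurable; first exact: finite_finset.
move=> k _; apply: measurableI.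
- have mgt : measurable_fun [set: T] (fun t => 0 < b n t k 0) by exact: measurable_fun_ltr.
  by have := mgt measurableT [set (0 < sigma k 0)] I; rewrite setTI.
- have mlt : measurable_fun [set: T] (fun t => b n t k 0 < 0) by exact: measurable_fun_ltr.
  by have := mlt measurableT [set (sigma k 0 < 0)] I; rewrite setTI.
Qed.

Theorem lasso_sign_consistent :
  P [set t | sign_vec (b n t) = sign_vec sigma] @[n --> \oo] --> 1%E.
Proof.
have fin n : P [set t | sign_vec (b n t) = sign_vec sigma] \is a fin_num.
  exact: fin_num_measure.
apply/fine_cvgP; split; first exact: nearW.
apply/cvgrPdist_le => e e0 /=.
have [M /(_ 1 ltr01) H] := whp_event e0.
have {}H : whp P e (fun n => [set t | sign_vec (b n t) = sign_vec sigma]).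
  by apply: whpS H; apply: nearW => n t [].
apply: filterS (whp_le measurable_sign H) => n h.
rewrite ger0_norm; first by rewrite lerBlDr -lerBlDl.
by rewrite subr_ge0 -lee_fin fineK// probability_le1.
Qed.

Local Notation S := (supp_set sigma).
Local Notation E := (@selmx R m S).
Local Notation CS := (principal_submx S C).
Local Notation Z := (fun n t => Num.sqrt n%:R *: (subvector S (b n t) - subvector S sigma)).

Let ZE n t : Z n t = E *m delta n t.
Proof. by rewrite /delta /scaled_error !subvectorE -scalemxAr mulmxBr. Qed.

Let notin_S k : k \notin S -> sigma k 0 = 0.
Proof. by rewrite inE negbK => /eqP. Qed.

(** As $C_{SS}\delta_S$ is asymptotically the score restricted to the support, the
    linear form [a] of $\delta_S$ reads the score in this direction. *)
Let dir a : 'cV[R]_m := E^T *m (invmx CS *m a).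

Let dir_notin a k : k \notin S -> dir a k 0 = 0.
Proof.
move=> kS; rewrite mxE big1// => j _; rewrite !mxE.
have [jk|] := eqVneq (enum_val j) k; last by rewrite mul0r.
by rewrite -jk enum_valP in kS.
Qed.

Let symCS : (invmx CS)^T = invmx CS.
Proof. by rewrite trmx_inv (pos_def_principal S posC).1. Qed.

Let dotp_Z a n t : (forall k, sigma k 0 = 0 -> b n t k 0 = 0) ->
  dotp a (Z n t) = dotp (dir a) (C *m delta n t).
Proof.
move=> H; have d0 k : k \notin S -> delta n t k 0 = 0.
  by move=> /notin_S sk; rewrite !mxE (H _ sk) sk subrr mulr0.
have CSZ : CS *m (E *m delta n t) = E *m (C *m delta n t).
  by rewrite principal_submxE -!mulmxA selmxTK.
have uCS := pos_def_unit (pos_def_principal S posC).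
rewrite ZE -[E *m delta n t](mulKmx uCS) CSZ.
by rewrite [LHS]dotp_mx symCS /dir /dotp [in RHS]trmx_mul trmxK -mulmxA.
Qed.

(** With probability close to one the estimator vanishes off the support, whence
    $C_{SS}\delta_S = (C\delta)_S$ exactly, and this is close to the score. *)
Lemma projection_linear a :
  oP P (fun n t => dotp a (Z n t) - dotp (dir a) (u n t)).
Proof.
move=> eta e eta0 e0; have [M H] := whp_event e0.
have s0 : 0 < 1 + \sum_k `|dir a k 0| by rewrite ltr_pwDl// sumr_ge0.
have acc0 : 0 < eta / (1 + \sum_k `|dir a k 0|) by rewrite divr_gt0.
apply: whpS (H _ acc0); apply: nearW => n t /= [_ _ kills lin].
rewrite dotp_Z// !dotpE -sumrB.
rewrite (le_trans (ler_norm_sum _ _ _))//.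
apply: (@le_trans _ _ ((\sum_k `|dir a k 0|) * (eta / (1 + \sum_k `|dir a k 0|)))).
  rewrite mulr_suml; apply: ler_sum => k _; rewrite -mulrBr normrM.
  have [sk|sk] := eqVneq (sigma k 0) 0; last by rewrite ler_wpM2l// lin.
  by rewrite dir_notin ?normr0 ?mul0r// inE sk eqxx.
by rewrite mulrCA ger_pMr// ler_pdivrMr// mul1r lerDr.
Qed.

Hypothesis symB : B^T = B.
Hypothesis B0 : forall x, 0 <= quad_form B x.

(** [W] stands for a normalized i.i.d. sum; the score itself, which involves the
    estimated mean, is only compared with it. *)
Hypothesis score_clt : forall c, exists W : nat -> T -> R,
  [/\ forall n, measurable_fun [set: T] (W n),
   oP P (fun n t => dotp c (u n t) - W n t),
   Ex P (fun t => cos (W n t)) @[n --> \oo] --> expR (- (quad_form B c / 2)) &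
   Ex P (fun t => sin (W n t)) @[n --> \oo] --> 0].

Let V := invmx CS *m principal_submx S B *m invmx CS.

Let quad_form_V a : quad_form V a = quad_form B (dir a).
Proof.
by rewrite /V /dir -quad_form_selmx /quad_form trmx_mul symCS !mulmxA.
Qed.

(** [projection_linear] and Slutsky's lemma give the limits of the characteristic
    functions, and the bound of [lasso_whp] gives tightness. The quadratic form of the
    limit covariance at [a] is that of [B] at [dir a]. *)
Theorem lasso_asymptotic_normality : exists Q : probability 'cV[R]_#|S| R,
  is_normal 0 V Q /\ cvg_in_distribution P Z Q.
Proof.
have psdV : psd V.
  split; last by move=> a; rewrite quad_form_V.
  rewrite /V !trmx_mul symCS (_ : (principal_submx S B)^T = principal_submx S B) ?mulmxA//.
  by rewrite principal_submxE !trmx_mul trmxK symB mulmxA.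
have [Q normQ] := normal_exists psdV; exists Q; split=> //.
have mZ n : measurable_fun [set: T] (Z n).
  apply: measurable_fun_matrix => i j.
  rewrite (_ : (fun t => _) = fun t =>
      Num.sqrt n%:R * (b n t (enum_val i) 0 - sigma (enum_val i) 0)).
    by apply: measurable_funM => //; exact: measurable_funB.
  by apply/funext => t; rewrite !mxE (ord1 j).
have cf a : (Ex P (fun t => cos (dotp a (Z n t))) @[n --> \oo]
      --> Ex Q (fun x => cos (dotp a x))) /\
    (Ex P (fun t => sin (dotp a (Z n t))) @[n --> \oo]
      --> Ex Q (fun x => sin (dotp a x))).
  have [-> ->] := is_normal_characteristic psdV.2 normQ a.
  have [W [mW oW cW sW]] := score_clt (dir a).
  have oZW : oP P (fun n t => dotp a (Z n t) - W n t).
    by apply: oP_eq (oPD (projection_linear a) oW) => n t; rewrite addrA subrK.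
  have mdZ n : measurable_fun [set: T] (fun t => dotp a (Z n t)).
    exact: measurableT_comp (measurable_dotp a) (mZ n).
  have [c0 s0] := oP_cos_sin mdZ mW oZW.
  rewrite quad_form_V; split.
    apply: (cvg_eq _ _ (cvgD c0 cW)) => [n /=|]; last by rewrite add0r.
    by rewrite subrK.
  apply: (cvg_eq _ _ (cvgD s0 sW)) => [n /=|]; last by rewrite addr0.
  by rewrite subrK.
apply: levy_continuity => // [a|a|e e0].
- exact: (cf a).1.
- exact: (cf a).2.
- have [M /(_ 1 ltr01) H] := whp_event e0; exists M.
  apply: whpS H; apply: nearW => n t /= [_ H _ _] i.
  have ZD : (Z n t) i 0 = delta n t (enum_val i) 0 by rewrite !mxE.
  by have := H (enum_val i); rewrite -ZD.
Qed.

End lasso_limit.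

Lemma measurable_regressor {R : realType} {d : measure_display} {T : measurableType d}
  q (w : T -> 'cV[R]_q) : measurable_fun [set: T] w ->
  measurable_fun [set: T] (fun t => regressor (w t)).
Proof.
move=> mw; apply: measurable_fun_matrix => i j.
rewrite /regressor; under eq_fun do rewrite mxE.
case: (@fintype.split 1 q i) => k; first exact: measurable_cst.
exact: measurableT_comp (@measurable_coord _ _ _ k j) mw.
Qed.

Theorem theorem8 (R : realType) (d : measure_display) (T : measurableType d)
  (P : probability T R) (q : nat)
  (W : {RV P >-> 'cV[R]_q}) (A : {RV P >-> 'cV[R]_q.+1})
  (Ws : nat -> {RV P >-> 'cV[R]_q}) (As : nat -> {RV P >-> 'cV[R]_q.+1})
  (mu_hat : nat -> {RV P >-> 'cV[R]_q.+1})
  (sigma_init sigma_AL : nat -> {RV P >-> 'cV[R]_(hdim q.+1)})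
  (lam : nat -> R) :
  let X := fun t => regressor (W t) in
  let Xs := fun i t => regressor (Ws i t) in
  let Ys := fun i t => dotp (Xs i t) (As i t) in
  let mu := mu_star P A in
  let sigma := sigma_star P A in
  let S := supp_set sigma in
  let C := C_sigma P X in
  let B := B_sigma P X A in
  independent2 P X A ->
  mutually_independent P (fun i t => (Xs i t, As i t)) ->
  (forall i, same_law P (fun t => (Xs i t, As i t)) (fun t => (X t, A t))) ->
  finite_moment P 4 A ->
  finite_moment P 8 X ->
  pos_def C ->
  bounded_in_probability P (fun n t => Num.sqrt n%:R *: (mu_hat n t - mu)) ->
  bounded_in_probability P
    (fun n t => Num.sqrt n%:R *: (sigma_init n t - sigma)) ->
  (forall n, (0 < n)%N -> 0 < lam n) ->
  lam n @[n --> \oo] --> 0 ->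
  Num.sqrt n%:R * lam n @[n --> \oo] --> 0 ->
  n%:R * lam n @[n --> \oo] --> +oo ->
  (forall n t, (0 < n)%N ->
    is_adaptive_lasso
      (response_sigma n (Xs^~ t) (Ys^~ t) (mu_hat n t))
      (design_sigma n (Xs^~ t))
      (sigma_init n t) (lam n) (sigma_AL n t)) ->
  P [set t | sign_vec (sigma_AL n t) = sign_vec sigma] @[n --> \oo] --> 1%E /\
  exists Q : probability 'cV[R]_#|S| R,
    is_normal 0 (invmx (principal_submx S C) *m principal_submx S B *m invmx (principal_submx S C)) Q /\
    cvg_in_distribution P
      (fun n t => Num.sqrt n%:R *:
        (subvector S (sigma_AL n t) - subvector S sigma)) Q.

Proof.
move=> X Xs Ys mu sigma S C B indXA indZ lawZ A4 X8 posC muhat_rate init_rate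
  lam_gt0 _ lam_sqrt lam_n lasso_b.
have mX : measurable_fun [set: T] X by apply: measurable_regressor; exact: measurable_funPT.
have mXs i : measurable_fun [set: T] (Xs i).
  by apply: measurable_regressor; exact: measurable_funPT.
have mA : measurable_fun [set: T] A by exact: measurable_funPT.
have mAs i : measurable_fun [set: T] (As i) by exact: measurable_funPT.
have mmu n : measurable_fun [set: T] (mu_hat n) by exact: measurable_funPT.
have mAL n : measurable_fun [set: T] (sigma_AL n) by exact: measurable_funPT.
have minit n : measurable_fun [set: T] (sigma_init n) by exact: measurable_funPT.
pose Y n t := response_sigma n (Xs^~ t) (Ys^~ t) (mu_hat n t).
pose D n t := design_sigma n (Xs^~ t).
have gram_oP k l : oP P (fun n t => gram (D n t) k l - C k l).
  exact: (sample_gram_oP mX mA mXs mAs indZ lawZ X8 k l).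
have score_OP k : OP P (fun n t => score (Y n t) (D n t) sigma k 0).
  exact: (sample_score_OP mX mA mXs mAs mmu indXA indZ lawZ A4 X8 muhat_rate k).
have init_OP k : OP P (fun n t => Num.sqrt n%:R * (sigma_init n t k 0 - sigma k 0)).
  apply: (OP_eq _ (bounded_in_probability_OP k _ init_rate)) => [n t|n].
    by rewrite !mxE.
  apply: measurable_fun_matrix => i j.
  rewrite (_ : (fun t => _) = fun t => Num.sqrt n%:R * (sigma_init n t i j - sigma i j)).
    apply: measurable_funM => //; apply: measurable_funB => //.
    exact: measurableT_comp (@measurable_coord _ _ _ i j) (minit n).
  by apply/funext => t; rewrite !mxE.
have score_clt c : exists V : nat -> T -> R,
  [/\ forall n, measurable_fun [set: T] (V n),
   oP P (fun n t => dotp c (score (Y n t) (D n t) sigma) - V n t),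
   Ex P (fun t => cos (V n t)) @[n --> \oo] --> expR (- (quad_form B c / 2)) &
   Ex P (fun t => sin (V n t)) @[n --> \oo] --> 0].
  have mZ : measurable_fun [set: T] (fun t => (X t, A t)) by exact: measurable_fun_pair.
  have mZs i : measurable_fun [set: T] (fun t => (Xs i t, As i t)).
    exact: measurable_fun_pair.
  have [_ h2] := L2_noise_score mX mA indXA A4 X8 c.
  have mh := measurable_noise_score P A c.
  have [cV sV] := clt_characteristic_function mZs mZ indZ lawZ mh h2
    (Ex_noise_score mX mA indXA A4 X8 c).
  rewrite (Ex_noise_score_sqr mX mA indXA A4 X8) in cV.
  exists (fun n t => (Num.sqrt n%:R)^-1 * \sum_(i < n) noise_score P A c (Xs i t, As i t)).
  split=> // [n|].
    apply: measurable_funM => //; apply: measurable_sum => i.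
    exact: measurableT_comp mh (mZs i).
  exact: (sample_score_linear mX mA mXs mAs mmu indXA indZ lawZ A4 X8 muhat_rate c).
have symB : B^T = B.
  apply/matrixP => i j; rewrite mxE 2!mxE; congr (fine _); congr ('E_P[_])%E.
  have qq k l t : (qvec (X t) *m (qvec (X t))^T) k l = qvec (X t) k 0 * qvec (X t) l 0.
    by rewrite mxE big_ord1 [(qvec (X t))^T 0 l]mxE.
  by apply/funext => t; rewrite [LHS]mxE [RHS]mxE !qq [qvec (X t) j 0 * _]mulrC.
have B0 c : 0 <= quad_form B c.
  rewrite -(Ex_noise_score_sqr mX mA indXA A4 X8); apply: Ex_ge0 => t.
  exact: sqr_ge0.
split.
  exact: (lasso_sign_consistent mAL lasso_b lam_gt0 lam_sqrt lam_n posC gram_oP score_OP init_OP).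
exact: (lasso_asymptotic_normality mAL lasso_b lam_gt0 lam_sqrt lam_n posC gram_oP score_OP
  init_OP symB B0 score_clt).
Qed.
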